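(* Let $u\in W^{1,2}_{loc}(B_1)$ be a weak solution of $$\Delta u=f\quad\text{in } B_1.$$ (i) Suppose that $f\in BMO(0)$ with radius $1$. Then $u\in W^{2,BMO}(0)$ with radius $\eta^2$ and $$|D^2u|_{*,0}\leq C\left(\|u\|_{L^2(B_1)}+\|f\|_{L^2(B_1)}+|f|_{*,0}\right),$$ where $\eta\in(0,1)$ is the constant, depending only on $n$, described in the context, and $C$ depends only on $n$. (ii) If $f\in BMO(B_1)$, then $u\in W^{2,BMO}(B_{1/2})$ and $$\|u\|_{W^{2,BMO}(B_{1/2})}\leq C\left(\|u\|_{L^2(B_1)}+\|f\|_{BMO(B_1)}\right),$$ where $C$ depends only on $n$.
   Context: $B_r(x)\subset\mathbb{R}^n$ is the ball of radius $r$ and center $x$, and $B_r:=B_r(0)$. For a bounded domain $\Omega\subset\mathbb{R}^n$ with Lebesgue measure $|\Omega|$ (and likewise for the sets $B_r(x_0)\cap\Omega$ below), set $f_\Omega:=\frac{1}{|\Omega|}\int_\Omega f$ and $\|f\|^*_{L^p(\Omega)}:=\left(\frac{1}{|\Omega|}\int_\Omega|f|^p\right)^{1/p}$ for $1\le p<\infty$ (averages of vector- and matrix-valued functions are taken componentwise). For $x_0\in\Omega$ and $r_0>0$, one says that $f\in BMO(x_0)$ (with radius $r_0$) if $$|f|_{*,x_0}:=\sup_{0<r<r_0}\|f-f_{B_r(x_0)\cap\Omega}\|^*_{L^2(B_r(x_0)\cap\Omega)}<+\infty.$$ One says that $f\in BMO(\Omega)$ (with radius $r_0$) if $f\in BMO(x_0)$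 for every $x_0\in\Omega$ with the same radius $r_0$ and $|f|_{*,\Omega}:=\sup_{x\in\Omega}|f|_{*,x}<+\infty$. The norm is $\|f\|_{BMO(\Omega)}:=\|f\|_{L^2(\Omega)}+|f|_{*,\Omega}$. One says that $u\in W^{2,BMO}(x_0)$ (resp. $W^{2,BMO}(\Omega)$) if $u$ has weak derivatives up to second order and $D^2u\in BMO(x_0)$ (resp. $D^2u\in BMO(\Omega)$), and $\|u\|_{W^{2,BMO}(\Omega)}:=\|u\|_{L^2(\Omega)}+\|Du\|_{L^2(\Omega)}+\|D^2u\|_{BMO(\Omega)}$. Where a membership in $BMO(\Omega)$ or $W^{2,BMO}(\Omega)$ is stated without a radius, it is with some radius $r_0>0$ that is left unspecified, and the corresponding norm is taken with that radius; the radii for $f$ and for $D^2u$ need not be the same. In part (i), the quantities $|f|_{*,0}$ and $|D^2u|_{*,0}$ are taken with $\Omega=B_1$ and with radii $1$ and $\eta^2$ respectively. The constant $\eta$ belongs to a fixed triple $(\delta,\eta,\bar C)$ with $0<\delta<1$, $0<\eta<1$ and $\bar C$ depending only on $n$, with the following property: whenever $v\in W^{1,2}_{loc}(B_1)$ is a weak solution of $\Delta v=g$ in $B_1$ with $\|v\|^*_{L^2(B_1)}\le1$ and $\|g\|^*_{L^2(B_1)}\le\delta$, there is a polynomial $P$ of degree $2$ with $\|v-P\|^*_{L^2(B_\eta)}\le\eta^2$, $\Delta P=g_{B_\eta}$ and $|P(0)|+|DP(0)|+|D^2P(0)|\le\bar C$. *)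

(* Defs.v *)
From HB Require Import structures.
From mathcomp Require Import all_boot all_order all_algebra.
From mathcomp Require Import all_classical all_reals all_analysis.

Set Implicit Arguments.
Unset Strict Implicit.
Unset Printing Implicit Defensive.

Import Order.TTheory GRing.Theory Num.Theory.
Import numFieldNormedType.Exports.

Local Open Scope classical_set_scope.
Local Open Scope ring_scope.

Definition measure_rV_display : measure_display.
Proof. exact: default_measure_display. Qed.

(* The Borel sigma-algebra of R^n, generated by the coordinate functions. *)
Section measurable_rV.
Context (R : realType) (n : nat).

Let coors : 'I_n -> 'rV[R]_n -> measurableTypeR R := fun i x => x ord0 i.

Let rV_set0 : g_sigma_preimage coors set0.
Proof. exact: sigma_algebra0. Qed.

Let rV_setC A : g_sigma_preimage coors A -> g_sigma_preimage coors (~` A).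
Proof. exact: sigma_algebraC. Qed.

Let rV_bigcup (F : _^nat) : (forall i, g_sigma_preimage coors (F i)) ->
  g_sigma_preimage coors (\bigcup_i (F i)).
Proof. exact: sigma_algebra_bigcup. Qed.

HB.instance Definition _ := @isMeasurable.Build measure_rV_display
  'rV[R]_n (g_sigma_preimage coors) rV_set0 rV_setC rV_bigcup.

End measurable_rV.

Definition rV_cons (R : realType) (n : nat)
    (p : measurableTypeR R * 'rV[R]_n) : 'rV[R]_n.+1 :=
  row_mx (\row_(_ < 1) p.1) p.2.

Lemma rV_cons0 (R : realType) (n : nat) (p : measurableTypeR R * 'rV[R]_n) :
  rV_cons p ord0 ord0 = p.1.
Proof.
by rewrite /rV_cons mxE; case: splitP => [j _|k]; rewrite ?mxE.
Qed.

Lemma rV_consS (R : realType) (n : nat) (p : measurableTypeR R * 'rV[R]_n)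
  (i : 'I_n) : rV_cons p ord0 (lift ord0 i) = p.2 ord0 i.
Proof.
rewrite /rV_cons mxE; case: splitP => [j /= jE|k /= ki].
  by have := ltn_ord j; rewrite -jE.
by congr (p.2 ord0 _); apply/val_inj; move: ki => /=; rewrite add1n => -[].
Qed.

Lemma measurable_coor (R : realType) (n : nat) (i : 'I_n) :
  measurable_fun [set: 'rV[R]_n] (fun x => x ord0 i : measurableTypeR R).
Proof.
move=> _ Y mY; rewrite setTI; apply: sub_sigma_algebra => /=.
rewrite -bigcup_seq/=; exists i => /=; first by rewrite mem_index_enum.
by exists Y => //; rewrite setTI.
Qed.

Lemma measurable_rV_cons (R : realType) (n : nat) :
  measurable_fun setT (@rV_cons R n).
Proof.
apply: (@measurability _ _ _ _ _ _
  (\big[setU/set0]_(i < n.+1) preimage_set_system setT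
     (fun x : 'rV[R]_n.+1 => x ord0 i : measurableTypeR R) measurable)) => //.
move=> _ [B + <-]; rewrite -bigcup_seq => -[i _ [Y mY <-]].
rewrite !setTI.
case: (unliftP ord0 i) => [j|] ->.
- have := measurableT_comp (@measurable_coor R n j)
    (@measurable_snd _ _ (measurableTypeR R) 'rV[R]_n).
  move=> /(_ measurableT Y mY); rewrite setTI; congr (measurable _).
  by apply/seteqP; split=> p /=; rewrite rV_consS.
- have := @measurable_fst _ _ (measurableTypeR R) 'rV[R]_n.
  move=> /(_ measurableT Y mY); rewrite setTI; congr (measurable _).
  by apply/seteqP; split=> p /=; rewrite rV_cons0.
Qed.

Lemma measurable_rV_uncons (R : realType) (n : nat) :
  measurable_fun [set: 'rV[R]_n.+1]
    (fun x => \row_(i < n) x ord0 (lift ord0 i) : 'rV[R]_n).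
Proof.
apply: (@measurability _ _ _ _ _ _
  (\big[setU/set0]_(i < n) preimage_set_system setT
     (fun x : 'rV[R]_n => x ord0 i : measurableTypeR R) measurable)) => //.
move=> _ [B + <-]; rewrite -bigcup_seq => -[i _ [Y mY <-]].
rewrite !setTI.
have := @measurable_coor R n.+1 (lift ord0 i).
move=> /(_ measurableT Y mY); rewrite setTI; congr (measurable _).
by apply/seteqP; split=> p /=; rewrite mxE.
Qed.

Section lebesgue_rV_cons.
Local Open Scope ereal_scope.
Context (R : realType) (n : nat).
Variable mu : {sigma_finite_measure set 'rV[R]_n -> \bar R}.

Definition lebesgue_rV_cons : set 'rV[R]_n.+1 -> \bar R :=
  pushforward (@lebesgue_measure R \x mu) (@rV_cons R n).

Let leb0 : lebesgue_rV_cons set0 = 0.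
Proof. by rewrite /lebesgue_rV_cons /pushforward preimage_set0 measure0. Qed.

Let leb_ge0 A : 0 <= lebesgue_rV_cons A.
Proof. by rewrite /lebesgue_rV_cons /pushforward; exact: measure_ge0. Qed.

Let leb_sigma_additive : semi_sigma_additive lebesgue_rV_cons.
Proof.
move=> F mF tF mUF; rewrite /lebesgue_rV_cons /pushforward preimage_bigcup.
have mpre A : measurable A -> measurable (@rV_cons R n @^-1` A).
  by move=> mA; have := @measurable_rV_cons R n measurableT A mA; rewrite setTI.
apply: measure_semi_sigma_additive.
- by move=> k; exact: mpre.
- apply/trivIsetP => /= i j _ _ ij; rewrite -preimage_setI.
  by move/trivIsetP : tF => /(_ _ _ _ _ ij) ->//; rewrite preimage_set0.
- by rewrite -preimage_bigcup; exact: mpre.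
Qed.

HB.instance Definition _ := isMeasure.Build _ _ _
  lebesgue_rV_cons leb0 leb_ge0 leb_sigma_additive.

Let leb_sigma_finite : sigma_finite setT lebesgue_rV_cons.
Proof.
have /sigma_finiteP[F [FT ndF Foo]] := sigma_finiteT (@lebesgue_measure R).
have /sigma_finiteP[G [GT ndG Goo]] := sigma_finiteT mu.
pose g (x : 'rV[R]_n.+1) : measurableTypeR R * 'rV[R]_n :=
  (x ord0 ord0, \row_(i < n) x ord0 (lift ord0 i)).
have gK : cancel (@rV_cons R n) g.
  move=> [a v]; rewrite /g rV_cons0; congr pair.
  by apply/rowP => i; rewrite mxE rV_consS.
have mg : measurable_fun setT g.
  apply/measurable_fun_pairP; split.
    exact: measurable_coor.
  exact: measurable_rV_uncons.
exists (fun k => g @^-1` (F k `*` G k)).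
  apply/seteqP; split=> // x _.
  have : (\bigcup_i F i) (g x).1 by rewrite -FT.
  have : (\bigcup_i G i) (g x).2 by rewrite -GT.
  move=> [j _ Gj] [i _ Fi]; exists (maxn i j) => //; split.
  - by move: Fi; exact/subsetPset/ndF/leq_maxl.
  - by move: Gj; exact/subsetPset/ndG/leq_maxr.
move=> k; have [mFk Fkoo] := Foo k; have [mGk Gkoo] := Goo k; split.
  by rewrite -[X in measurable X]setTI; apply: mg => //; exact: measurableX.
rewrite /lebesgue_rV_cons /pushforward.
rewrite (_ : _ @^-1` _ = F k `*` G k); last first.
  by apply/seteqP; split=> p; rewrite /preimage /mkset gK.
by rewrite product_measure1E// lte_mul_pinfty// ge0_fin_numE.
Qed.

HB.instance Definition _ := Measure_isSigmaFinite.Build _ _ _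
  lebesgue_rV_cons leb_sigma_finite.

End lebesgue_rV_cons.

(* Lebesgue measure on the Borel sets of R^n, as an n-fold product measure. *)
Fixpoint lebesgue_rV (R : realType) (n : nat) :
    {sigma_finite_measure set 'rV[R]_n -> \bar R} :=
  if n is m.+1 then lebesgue_rV_cons (lebesgue_rV R m)
  else \d_(0 : 'rV[R]_0).

Section euclidean.
Context (R : realType) (n : nat).
Implicit Types (x y : 'rV[R]_n) (f g : 'rV[R]_n -> R).

(* The library's norm on 'rV[R]_n is the sup norm. *)
Definition enorm x : R := Num.sqrt (\sum_i x ord0 i ^+ 2).

Definition eball x (r : R) : set 'rV[R]_n := [set y | enorm (y - x) < r].

Definition pderiv (i : 'I_n) f : 'rV[R]_n -> R := 'D_(delta_mx ord0 i) f.

Definition laplacian f x : R := \sum_i pderiv i (pderiv i f) x.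

Definition iter_pderiv (s : seq 'I_n) f : 'rV[R]_n -> R := foldr pderiv f s.

Definition smooth f := forall s,
  continuous (iter_pderiv s f) /\
  forall i x, derivable (iter_pderiv s f) x (delta_mx ord0 i).

Definition test_function (Omega : set 'rV[R]_n) f :=
  smooth f /\ exists K, [/\ compact K, K `<=` Omega &
                          forall x, ~ K x -> f x = 0].

Definition poly_degree_le2 f :=
  exists (a : R) (b : 'rV[R]_n) (M : 'M[R]_n), forall x,
    f x = a + \sum_i b ord0 i * x ord0 i
            + \sum_i \sum_j M i j * x ord0 i * x ord0 j.

End euclidean.

Section weak_derivatives.
Context (R : realType) (n : nat) (Omega : set 'rV[R]_n).
Local Notation leb := (lebesgue_rV R n).
Implicit Types (u v f : 'rV[R]_n -> R) (Du : 'I_n -> 'rV[R]_n -> R).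

Definition Lloc (p : R) f := measurable_fun Omega f /\
  forall K, compact K -> K `<=` Omega ->
    (\int[leb]_(x in K) (`|f x| `^ p)%:E < +oo)%E.

Definition weak_pderiv (i : 'I_n) u v :=
  [/\ Lloc 1 u, Lloc 1 v & forall phi, test_function Omega phi ->
     \int[leb]_(x in Omega) (u x * pderiv i phi x) =
     - \int[leb]_(x in Omega) (v x * phi x)].

Definition W12loc u Du :=
  Lloc 2 u /\ forall i, Lloc 2 (Du i) /\ weak_pderiv i u (Du i).

(* u is in W^{1,2}_loc(Omega) and Delta u = f weakly in Omega. *)
Definition weak_solution u f :=
  Lloc 1 f /\ exists2 Du, W12loc u Du & forall phi, test_function Omega phi ->
    \sum_i \int[leb]_(x in Omega) (Du i x * pderiv i phi x) =
    - \int[leb]_(x in Omega) (f x * phi x).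

Definition weak_D2 u Du (D2u : 'I_n * 'I_n -> 'rV[R]_n -> R) :=
  (forall i, weak_pderiv i u (Du i)) /\
  forall i j, weak_pderiv j (Du i) (D2u (i, j)).

End weak_derivatives.

(* Vector- and matrix-valued functions are families F : I -> 'rV[R]_n -> R of
   components, with the Euclidean (Frobenius) norm on the values. *)
Definition scalar_fun (R : realType) (n : nat) (f : 'rV[R]_n -> R) :
  unit -> 'rV[R]_n -> R := fun=> f.

Section BMO.
Local Open Scope ereal_scope.
Context (R : realType) (n : nat) (I : finType).
Local Notation leb := (lebesgue_rV R n).
Implicit Types (A Omega : set 'rV[R]_n) (F : I -> 'rV[R]_n -> R).

Definition mean A (f : 'rV[R]_n -> R) : R :=
  ((fine (leb A))^-1 * \int[leb]_(x in A) f x)%R.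

Definition L2norm A F : \bar R :=
  sqrte (\int[leb]_(x in A) (\sum_i F i x ^+ 2)%:E).

Definition L2avg A F : \bar R :=
  sqrte ((fine (leb A))^-1%:E * \int[leb]_(x in A) (\sum_i F i x ^+ 2)%:E).

Definition oscillation A F : \bar R :=
  L2avg A (fun i x => F i x - mean A (F i))%R.

Definition BMO_seminorm_at Omega (r0 : R) (x0 : 'rV[R]_n) F : \bar R :=
  ereal_sup [set oscillation (eball x0 r `&` Omega) F | r in `]0%R, r0[].

Definition BMO_at Omega (r0 : R) (x0 : 'rV[R]_n) F :=
  (forall i r, (0 < r < r0)%R ->
     leb.-integrable (eball x0 r `&` Omega) (EFin \o F i)) /\
  BMO_seminorm_at Omega r0 x0 F < +oo.

Definition BMO_seminorm Omega (r0 : R) F : \bar R :=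
  ereal_sup [set BMO_seminorm_at Omega r0 x F | x in Omega].

Definition BMO Omega (r0 : R) F :=
  (forall x, Omega x -> BMO_at Omega r0 x F) /\
  BMO_seminorm Omega r0 F < +oo.

Definition BMO_norm Omega (r0 : R) F : \bar R :=
  L2norm Omega F + BMO_seminorm Omega r0 F.

End BMO.

Section W2BMO.
Local Open Scope ereal_scope.
Context (R : realType) (n : nat) (Omega : set 'rV[R]_n) (r0 : R).
Implicit Types (u : 'rV[R]_n -> R) (Du : 'I_n -> 'rV[R]_n -> R)
  (D2u : 'I_n * 'I_n -> 'rV[R]_n -> R).

Definition W2BMO_at (x0 : 'rV[R]_n) u Du D2u :=
  weak_D2 Omega u Du D2u /\ BMO_at Omega r0 x0 D2u.

Definition W2BMO u Du D2u := weak_D2 Omega u Du D2u /\ BMO Omega r0 D2u.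

Definition W2BMO_norm u Du D2u : \bar R :=
  L2norm Omega (scalar_fun u) + L2norm Omega Du + BMO_norm Omega r0 D2u.

End W2BMO.

Definition approximation_triple (R : realType) (n : nat)
    (delta eta Cbar : R) :=
  [/\ 0 < delta < 1, 0 < eta < 1 &
    forall v g : 'rV[R]_n -> R, weak_solution (eball 0 1) v g ->
      (L2avg (eball 0 1) (scalar_fun v) <= 1)%E ->
      (L2avg (eball 0 1) (scalar_fun g) <= delta%:E)%E ->
      exists P : 'rV[R]_n -> R,
        [/\ poly_degree_le2 P,
            (L2avg (eball 0 eta) (scalar_fun (fun x => v x - P x)%R)
               <= (eta ^+ 2)%:E)%E,
            forall x, laplacian P x = mean (eball 0 eta) g &
            `|P 0| + Num.sqrt (\sum_i pderiv i P 0 ^+ 2)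
              + Num.sqrt (\sum_i \sum_j pderiv j (pderiv i P) 0 ^+ 2)
            <= Cbar]].

(* Main.v *)
From HB Require Import structures.
Require Import Defs.
From mathcomp Require Import all_boot all_order all_algebra.
From mathcomp Require Import all_classical all_reals all_analysis.
From mathcomp Require Import measurable_realfun.
From mathcomp Require Import ring lra.

(** The Hessian of a solution of Poisson's equation is estimated by comparing the
    solution with quadratic polynomials at a geometric sequence of scales, in the
    manner of Campanato.

    Let first [v] be smooth. Averaging [v] with the radial kernel [bump_slope]
    reproduces [v] up to a term measuring how far the Laplacian is from a
    constant [c]; this mean value property ([mean_value]), transferred to [L^2]
    by duality ([sqint_mean_defect]), says that [v] is close to a mollified copy
    of itself. The Taylor polynomial of degree two of that copy therefore
    approximates [v] on a ball of radius [th] with a squared error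
    [th ^+ (n + 6)], plus the oscillation of the Laplacian
    ([quadratic_approximation]). Two powers of [th] are gained over the quadratic
    scaling [th ^+ (n + 4)], so for a fixed small [th] the approximation can be
    iterated: if the mean oscillation of the Laplacian stays bounded at all
    scales, so does the distance to quadratic polynomials divided by the scaling
    factor, and the initial distance is forgotten at the rate [4 ^- K]
    ([excess_decay]). A Bochner identity ([cutoff_bochner]) bounds the Hessian of
    a function in [L^2] by the function and its Laplacian on a larger ball.
    Applied to the difference of [v] and the approximating polynomial, it shows
    that the Hessian of [v] stays close in mean square to a constant matrix at
    every scale ([hessian_decay]).

    For a weak solution [u], mollification yields smooth functions converging to
    [u] whose Laplacians converge to [f] ([smooth_approximation]). The Hessian
    bound applied to their differences makes their second derivatives converge
    in [L^2] on smaller balls, and the limits are the weak second derivatives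
    ([weak_second_derivatives]); the decay estimate passes to the limit
    ([weak_hessian_decay]). In a set [A] the mean is the best constant, so this
    bounds the oscillation of the Hessian.

    At the origin the iteration starts at the radius [eta] ([W2BMO_at_origin]).
    In the interior it starts at a radius [rho] smaller than the radius of [f],
    and the rate [4 ^- K] is used to remove [rho] from the constant, at the price
    of a small radius for the Hessian ([W2BMO_interior]); a ball centred in the
    ball of radius [1 / 2] meets it in a set of comparable measure
    ([eballI_half_volume]). *)

Set Implicit Arguments.
Unset Strict Implicit.
Unset Printing Implicit Defensive.

Import Order.TTheory GRing.Theory Num.Theory.
Import numFieldNormedType.Exports.

Local Open Scope classical_set_scope.
Local Open Scope ring_scope.

(** * Borel sets and continuous functions on R^n *)

Section borel_rV.
Context (R : realType).
Implicit Types n : nat.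

Lemma measurable_fun_rV n d (T : measurableType d) (D : set T)
    (f : T -> 'rV[R]_n) : measurable D ->
  (forall i, measurable_fun D (fun t => f t ord0 i)) -> measurable_fun D f.
Proof.
move=> mD mf; apply: (@measurability _ _ _ _ _ _
  (\big[setU/set0]_(i < n) preimage_set_system setT
     (fun x : 'rV[R]_n => x ord0 i : measurableTypeR R) measurable)) => //.
move=> _ [B + <-]; rewrite -bigcup_seq => -[i _ [Y mY <-]].
rewrite setTI; exact: (mf i mD Y mY).
Qed.

Lemma measurable_fun_affine n (a : 'rV[R]_n) (s : R) :
  measurable_fun setT (fun x : 'rV[R]_n => a + s *: x).
Proof.
apply: measurable_fun_rV => // i; rewrite (_ : (fun _ => _) =
  (fun x : 'rV[R]_n => a ord0 i + s * x ord0 i)); last by apply/funext => x; rewrite !mxE.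
by apply: measurable_funD => //; apply: measurable_funM => //; exact: measurable_coor.
Qed.

Lemma ball_rVE n (x : 'rV[R]_n) (e : R) : 0 < e ->
  ball x e = [set y | forall i, ball (x ord0 i) e (y ord0 i)].
Proof.
move=> e0; rewrite /ball /=; apply/seteqP; split => y /=; first by case => _ h i; exact: h.
by move=> h; split => // i j; rewrite (ord1 i); exact: h.
Qed.

Lemma measurable_ball_rV n (x : 'rV[R]_n) (e : R) : 0 < e ->
  measurable (ball x e).
Proof.
move=> e0; rewrite (_ : ball x e = \bigcap_(i in [set: 'I_n])
    ((fun y : 'rV[R]_n => y ord0 i) @^-1` ball (x ord0 i) e)); last first.
  by rewrite ball_rVE//; apply/seteqP; split => y /= h i; [move=> _|]; exact: h.
apply: fin_bigcap_measurable => // i _.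
rewrite -[X in measurable X]setTI; apply: measurable_coor => //.
exact: measurable_ball.
Qed.

(** The Borel structure is generated by the coordinates, so boxes are
    measurable; an open set is the union of the countably many boxes with
    rational centres and radii of the form [1 / (k + 1)] that it contains. *)
Lemma open_measurable_rV n (U : set 'rV[R]_n) : open U -> measurable U.
Proof.
move=> oU.
pose q (p : {ffun 'I_n -> rat} * nat) : 'rV[R]_n := \row_i ratr (p.1 i).
pose r (p : {ffun 'I_n -> rat} * nat) : R := p.2.+1%:R^-1.
rewrite (_ : U = \bigcup_(p in [set p | ball (q p) (r p) `<=` U])
    ball (q p) (r p)).
  rewrite bigcup_mkcond; apply: countable_bigcupT_measurable => [|p]; first exact: countableP.
  by case: ifP => _; [apply: measurable_ball_rV; rewrite invr_gt0|exact: measurable0].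
apply/seteqP; split => [x Ux|x [p pU]]; last exact: pU.
have /nbhs_ballP[e /= e0 eU] : nbhs x U by exact: open_nbhs_nbhs.
have e20 : 0 < e / 2 by rewrite divr_gt0.
have [k ke] : exists k : nat, k.+1%:R^-1 < e / 2.
  have [N _ h] := near_infty_natSinv_lt (PosNum e20).
  by exists N; apply: h => /=.
have rat_ex i : {y : rat | ball (x ord0 i) k.+1%:R^-1 (ratr y : R)}.
  apply: cid; have := @dense_rat R (ball (x ord0 i) k.+1%:R^-1).
  have k0 : 0 < (k.+1%:R^-1 : R) by rewrite invr_gt0.
  case.
  - by exists (x ord0 i); exact: ballxx.
  - exact: ball_open.
  by move=> z [/= hz [y _ yz]]; exists y; rewrite yz.
have r0 i : 0 < (i.+1%:R^-1 : R) by rewrite invr_gt0.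
exists ([ffun i => sval (rat_ex i)], k) => /=; rewrite /r/=.
  move=> y; rewrite ball_rVE//= => hy; apply: eU; rewrite ball_rVE//= => j.
  have := svalP (rat_ex j); have := hy j; rewrite /q !mxE /= ffunE => h1 h2.
  apply: le_ball (ball_triangle h2 h1).
  by rewrite [leRHS]splitr; apply: lerD; exact: ltW.
rewrite ball_rVE//= => j; rewrite !mxE ffunE; apply: ball_sym; exact: (svalP (rat_ex j)).
Qed.

Lemma continuous_measurable_rV n (f : 'rV[R]_n -> R) :
  continuous f -> measurable_fun setT f.
Proof.
move=> /continuousP cf; apply: (measurability _ (RGenOpens.measurableE R)).
move=> _ [_ [a [b ->] <-]]; rewrite setTI; apply: open_measurable_rV.
exact/cf/interval_open.
Qed.

End borel_rV.

(** * Affine changes of variables *)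

(** The measurability of [phi] is an explicit argument, because the measure
    structure of [pushforward mu phi] depends on it. *)
Definition pushforward_measure d d' (T : measurableType d)
    (T' : measurableType d') (R : realType) (mu : {measure set T -> \bar R})
    (phi : T -> T') (mphi : measurable_fun setT phi) :
  {measure set T' -> \bar R}.
Proof.
by unshelve refine (pushforward mu phi : {measure set T' -> \bar R}); exact mphi.
Defined.

(** For [mu] the Lebesgue measure and [phi x = a + s *: x], the hypothesis
    [mu_phi] holds with [c = s ^+ n] by [lebesgue_rV_affine] below. *)
Section quasi_invariant.
Context d (T : measurableType d) (R : realType).
Variable mu : {measure set T -> \bar R}.
Variables (phi : T -> T) (c : R).
Hypotheses (c0 : 0 < c) (mphi : measurable_fun setT phi).
Hypothesis mu_phi : forall A, measurable A ->
  (c%:E * mu (phi @^-1` A))%E = mu A.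

Lemma ge0_integral_quasi D (f : T -> \bar R) : measurable D ->
  measurable_fun D f -> (forall x, D x -> 0 <= f x)%E ->
  (c%:E * \int[mu]_(x in phi @^-1` D) f (phi x) = \int[mu]_(x in D) f x)%E.
Proof.
move=> mD mf f0.
transitivity (\int[mscale (NngNum (ltW c0)) (pushforward_measure mu mphi)]_(x in D) f x)%E;
  last first.
  by apply: eq_measure_integral => A mA _; exact: mu_phi.
rewrite ge0_integral_mscale//; congr (_ * _)%E.
by rewrite (ge0_integral_pushforward mphi)//; move=> x; rewrite inE; exact: f0.
Qed.

Lemma integrable_quasi D (f : T -> R) : measurable D ->
  mu.-integrable D (EFin \o f) ->
  mu.-integrable (phi @^-1` D) (EFin \o (f \o phi)).
Proof.
move=> mD /integrableP[mf foo]; apply/integrableP.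
have mpD : measurable (phi @^-1` D).
  by rewrite -[X in measurable X]setTI; exact: mphi.
have mfp : measurable_fun (phi @^-1` D) (EFin \o (f \o phi)).
  by apply: (measurable_comp mD _ mf); [by move=> _ [x ? <-]|exact: measurable_funTS].
split => //.
have := ge0_integral_quasi mD (measurableT_comp (@abse_measurable R setT) mf)
  (fun x _ => abse_ge0 _).
move=> h; move: foo; rewrite -h => {}h.
move: h => /=; case: (\int[mu]_(x in _) _)%E => [r _|/=|//]; first exact: ltry.
by rewrite gt0_muley// lte_fin.
Qed.

Lemma Rintegral_quasi D (f : T -> R) : measurable D ->
  mu.-integrable D (EFin \o f) ->
  c * \int[mu]_(x in phi @^-1` D) f (phi x) = \int[mu]_(x in D) f x.
Proof.
move=> mD fi; have mpD : measurable (phi @^-1` D).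
  by rewrite -[X in measurable X]setTI; exact: mphi.
have fpi := integrable_quasi mD fi.
rewrite -RintegralZl// /Rintegral; congr fine.
rewrite [RHS]integralE [LHS]integralE.
have mf := measurable_int _ fi.
rewrite -(ge0_integral_quasi mD (measurable_funepos mf))//.
rewrite -(ge0_integral_quasi mD (measurable_funeneg mf))//.
have mfp := measurable_int _ fpi.
rewrite -!ge0_integralZl ?lee_fin ?ltW//; last 2 first.
- by have h := measurable_funeneg mfp; move: h; apply: eq_measurable_fun => x _; rewrite !funenegE.
- by have h := measurable_funepos mfp; move: h; apply: eq_measurable_fun => x _; rewrite !funeposE.
congr (_ - _)%E; apply: eq_integral => x _.
- by rewrite !funeposE /= EFinM maxe_pMr ?lee_fin ?ltW// mule0.
- by rewrite !funenegE /= -mulrN EFinM maxe_pMr ?lee_fin ?ltW// mule0.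
Qed.

End quasi_invariant.

Section affine_rV.
Context (R : realType).

Lemma lebesgue_measure_affine (a s : R) (A : set R) : 0 < s -> measurable A ->
  (s%:E * lebesgue_measure ((fun x => a + s * x)%R @^-1` A) = lebesgue_measure A)%E.
Proof.
move=> s0 mA; pose phi : measurableTypeR R -> measurableTypeR R := fun x => a + s * x.
have mphi : measurable_fun setT phi.
  by apply: measurable_funD => //; exact: measurable_funM.
apply/esym; apply: (@lebesgue_measure_unique R
  (mscale (NngNum (ltW s0)) (pushforward_measure lebesgue_measure mphi))) => // _ [[u v]] _ <- /=.
rewrite /mscale /= /pushforward.
rewrite (_ : phi @^-1` _ = `](u - a) / s, (v - a) / s]%classic); last first.
  apply/seteqP; split => x /=; rewrite !in_itv/= ltr_pdivrMr// ler_pdivlMr// /phi;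
    rewrite ltrBlDr lerBrDr (mulrC x) (addrC a); by [].
rewrite !lebesgue_measure_itv/= !lte_fin ltr_pM2r ?invr_gt0// ltrD2r.
case: ifP => _; last by rewrite mule0.
by rewrite -!EFinB -EFinM -mulrBl opprB addrA subrK mulrCA divff ?gt_eqF// mulr1.
Qed.

Lemma lebesgue_rV_S n (A : set 'rV[R]_n.+1) : lebesgue_rV R n.+1 A =
  (\int[lebesgue_measure]_t
     lebesgue_rV R n [set v | A (rV_cons (t, v))])%E.
Proof.
rewrite /= /lebesgue_rV_cons /pushforward /product_measure1.
apply: eq_integral => t _ /=; congr (lebesgue_rV R n _).
by apply/seteqP; split => v /=; rewrite /xsection /= inE.
Qed.

Lemma measurable_rV_section n (A : set 'rV[R]_n.+1) : measurable A ->
  measurable_fun setT (fun t : measurableTypeR R =>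
    lebesgue_rV R n [set v | A (rV_cons (t, v))]).
Proof.
move=> mA; have mc : measurable (@rV_cons R n @^-1` A).
  by rewrite -[X in measurable X]setTI; exact: measurable_rV_cons.
apply: eq_measurable_fun (measurable_fun_xsection (lebesgue_rV R n) mc).
move=> t _ /=; congr (lebesgue_rV R n _).
by apply/seteqP; split => v /=; rewrite /xsection /= inE.
Qed.

(** By induction on the dimension: the slices of the preimage of [A] are
    preimages of slices of [A], and the first coordinate is handled by the
    one-dimensional change of variables. *)
Lemma lebesgue_rV_affine n (a : 'rV[R]_n) (s : R) (A : set 'rV[R]_n) : 0 < s ->
  measurable A ->
  ((s ^+ n)%:E * lebesgue_rV R n ((fun x => a + s *: x)%R @^-1` A) =
    lebesgue_rV R n A)%E.
Proof.
move=> s0; elim: n => [|n IH] in a A *.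
  move=> mA; rewrite expr0 mul1e; congr (lebesgue_rV R 0 _).
  apply/seteqP; split => x /=; rewrite (_ : a + s *: x = x)//; apply/rowP => i; by case: (i).
move=> mA; rewrite !lebesgue_rV_S.
pose a' : 'rV[R]_n := \row_i a ord0 (lift ord0 i).
pose phi (t : measurableTypeR R) : measurableTypeR R := a ord0 ord0 + s * t.
have mphi : measurable_fun setT phi.
  by apply: measurable_funD => //; exact: measurable_funM.
have mF := measurable_rV_section mA.
rewrite -(ge0_integral_quasi s0 mphi (fun A => lebesgue_measure_affine _ s0) measurableT mF)//.
rewrite exprS EFinM -muleA; congr (_ * _)%E.
rewrite -ge0_integralZl_EFin//=; last 2 first.
- apply: (@measurable_rV_section _ ((fun x => a + s *: x) @^-1` A)); rewrite -[X in measurable X]setTI.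
  exact: measurable_fun_affine.
- by rewrite exprn_ge0 ?ltW.
apply: eq_integral => t _.
rewrite -[in RHS](IH a'); last first.
  have h : measurable_fun setT (fun v : 'rV[R]_n => rV_cons (phi t : measurableTypeR R, v)).
    exact: (measurableT_comp (@measurable_rV_cons R n) (pair1_measurable _)).
  by rewrite -[X in measurable X]setTI; exact: h.
have cE v : a + s *: rV_cons (t, v) = rV_cons (phi t, a' + s *: v).
  apply/rowP => i; rewrite -(ord1 ord0) [LHS]mxE [X in _ + X]mxE.
  by case: (unliftP ord0 i) => [j|] ->; rewrite ?rV_consS ?rV_cons0 //= !mxE.
by congr (_ * lebesgue_rV R n _)%E; apply/seteqP; split => v /=; rewrite cE.
Qed.

End affine_rV.

(** * Euclidean norm and volume of balls *)

Section euclidean_norm.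
Context (R : realType) (n : nat).
Local Notation V := 'rV[R]_n.
Local Notation leb := (lebesgue_rV R n).
Implicit Types (x y : V) (r s : R).

Lemma enorm_ge0 x : 0 <= enorm x. Proof. exact: sqrtr_ge0. Qed.

Lemma enorm_sqr x : enorm x ^+ 2 = \sum_i x ord0 i ^+ 2.
Proof. by rewrite sqr_sqrtr// sumr_ge0// => i _; exact: sqr_ge0. Qed.

Lemma enorm0 : enorm (0 : V) = 0.
Proof. by rewrite /enorm big1 ?sqrtr0// => i _; rewrite mxE expr0n. Qed.

Lemma enormZ s x : enorm (s *: x) = `|s| * enorm x.
Proof.
rewrite /enorm -sqrtr_sqr -sqrtrM ?sqr_ge0// mulr_sumr; congr Num.sqrt.
by apply: eq_bigr => i _; rewrite mxE exprMn.
Qed.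

Lemma enormN x : enorm (- x) = enorm x.
Proof. by rewrite -scaleN1r enormZ normrN1 mul1r. Qed.

Lemma enormB x y : enorm (x - y) = enorm (y - x).
Proof. by rewrite -enormN opprB. Qed.

Lemma normr_coord_le_enorm x i : `|x ord0 i| <= enorm x.
Proof.
rewrite -(ler_pXn2r (_ : 0 < 2)%N) ?nnegrE ?enorm_ge0// enorm_sqr real_normK ?num_real//.
by rewrite (bigD1 i)//= lerDl sumr_ge0// => j _; exact: sqr_ge0.
Qed.

Lemma normr_le_enorm x : `|x| <= enorm x.
Proof.
rewrite [leLHS]mx_normrE; apply/bigmax_leP; split; first exact: enorm_ge0.
by move=> [i j] _ /=; rewrite (ord1 i); exact: normr_coord_le_enorm.
Qed.

Lemma normr_coord_le x i : `|x ord0 i| <= `|x|.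
Proof.
by rewrite [leRHS]mx_normrE; apply: (@le_bigmax_cond _ _ _ _ (ord0, i) _ (fun ij => `|x ij.1 ij.2|)).
Qed.

Lemma enorm_le_normr x : enorm x <= n%:R * `|x|.
Proof.
rewrite -(ler_pXn2r (_ : 0 < 2)%N) ?nnegrE ?enorm_ge0 ?mulr_ge0// enorm_sqr.
apply: (@le_trans _ _ (\sum_(i < n) `|x| ^+ 2)).
  apply: ler_sum => i _; rewrite -real_normK ?num_real//.
  by apply: lerXn2r; rewrite ?nnegrE//; exact: normr_coord_le.
rewrite sumr_const card_ord exprMn -[leLHS]mulr_natl ler_wpM2r ?sqr_ge0//.
by rewrite -natrX ler_nat; case: n => // m; rewrite leq_pmulr.
Qed.

(** Lagrange's identity exhibits the defect in the Cauchy-Schwarz inequality as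
    a sum of squares. *)
Lemma sum_mul_le_enorm x y :
  \sum_i x ord0 i * y ord0 i <= enorm x * enorm y.
Proof.
set S := \sum_i _; have [S0|S0] := leP S 0.
  by rewrite (le_trans S0)// mulr_ge0 ?enorm_ge0.
rewrite -(ler_pXn2r (_ : 0 < 2)%N) ?nnegrE ?(ltW S0) ?mulr_ge0 ?enorm_ge0//.
rewrite exprMn !enorm_sqr -subr_ge0.
have -> : (\sum_i x ord0 i ^+ 2) * (\sum_i y ord0 i ^+ 2) - S ^+ 2 =
  2^-1 * \sum_i \sum_j (x ord0 i * y ord0 j - x ord0 j * y ord0 i) ^+ 2.
  rewrite expr2 /S !big_distrlr /=.
  have e : forall F G H : 'I_n -> 'I_n -> R,
    (forall i j, H i j = F i j + F j i - 2 * G i j) ->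
    \sum_i \sum_j F i j - \sum_i \sum_j G i j = 2^-1 * \sum_i \sum_j H i j.
    move=> F G H h.
    have -> : \sum_i \sum_j H i j =
        \sum_i \sum_j F i j + \sum_i \sum_j F j i - 2 * \sum_i \sum_j G i j.
      rewrite mulr_sumr -sumrN -!big_split /=; apply: eq_bigr => i _.
      rewrite mulr_sumr -sumrN -!big_split /=; apply: eq_bigr => j _; exact: h.
    have -> : \sum_i \sum_j F j i = \sum_i \sum_j F i j by rewrite exchange_big.
    lra.
  by apply: e => i j; ring.
by rewrite mulr_ge0 ?invr_ge0// sumr_ge0// => i _; apply: sumr_ge0 => j _; exact: sqr_ge0.
Qed.

Lemma ler_enormD x y : enorm (x + y) <= enorm x + enorm y.
Proof.
rewrite -(ler_pXn2r (_ : 0 < 2)%N) ?nnegrE ?addr_ge0 ?enorm_ge0// sqrrD !enorm_sqr.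
have -> : \sum_i (x + y) ord0 i ^+ 2 = \sum_i x ord0 i ^+ 2 +
    (\sum_i x ord0 i * y ord0 i) *+ 2 + \sum_i y ord0 i ^+ 2.
  rewrite -sumrMnl -!big_split /=; apply: eq_bigr => i _; rewrite mxE; ring.
by rewrite lerD2r lerD2l ler_wMn2r// sum_mul_le_enorm.
Qed.

Lemma ler_enorm_triangle y x z : enorm (x - z) <= enorm (x - y) + enorm (y - z).
Proof. by rewrite -[x - z](subrKA y) ler_enormD. Qed.

Lemma ler_dist_enorm x y : `|enorm x - enorm y| <= enorm (x - y).
Proof.
rewrite ler_norml; apply/andP; split.
  by rewrite lerNl opprB lerBlDr enormB -{1}(subrK x y) ler_enormD.
by rewrite lerBlDr -{1}(subrK y x) ler_enormD.
Qed.

Lemma lt_enorm_near x y z r : enorm (z - y) < enorm (y - x) - r -> r < enorm (z - x).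
Proof. have := ler_enorm_triangle z y x; rewrite (enormB y z); lra. Qed.

Lemma continuous_rVP (f : V -> R) : continuous f <->
  (forall x e, 0 < e -> exists2 d, 0 < d & forall y, `|y - x| < d -> `|f y - f x| < e).
Proof.
split=> [cf x e e0|h x].
  have F := nbhs_filter x.
  have /(@cvgrPdist_lt _ _ _ (nbhs x) F)/(_ e e0) := cf x.
  move=> /nbhs_ballP[d /= d0 hd]; exists d => // y xy; rewrite distrC; apply: hd.
  by rewrite mx_norm_ball /ball_ /= distrC.
have F := nbhs_filter x; apply/(@cvgrPdist_lt _ _ _ (nbhs x) F) => e e0.
have [d d0 hd] := h x e e0; apply/nbhs_ballP; exists d => //= y.
by rewrite mx_norm_ball /ball_ /= distrC => /hd; rewrite distrC.
Qed.

Lemma open_rVP (U : set V) : open U <->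
  (forall x, U x -> exists2 d, 0 < d & forall y, `|y - x| < d -> U y).
Proof.
split=> [oU x Ux|h].
  have /nbhs_ballP[d /= d0 hd] : nbhs x U by exact: open_nbhs_nbhs.
  by exists d => // y xy; apply: hd; rewrite mx_norm_ball /ball_ /= distrC.
rewrite openE => x /h[d d0 hd]; apply/nbhs_ballP; exists d => //= y.
by rewrite mx_norm_ball /ball_ /= distrC; exact: hd.
Qed.

Lemma enorm_lt_ball e : 0 < e ->
  exists2 d, 0 < d & forall x y, `|y - x| < d -> enorm (y - x) < e.
Proof.
move=> e0; have n1 : 0 < n%:R + 1 :> R by rewrite ltr_wpDl.
exists (e / (n%:R + 1)) => [|x y h]; first by rewrite divr_gt0.
apply: le_lt_trans (enorm_le_normr _) _; rewrite ltr_pdivlMr// in h.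
apply: le_lt_trans h; rewrite mulrC ler_wpM2l//; lra.
Qed.

Lemma enorm_continuous : continuous (@enorm R n).
Proof.
apply/continuous_rVP => x e e0; have [d d0 hd] := enorm_lt_ball e0.
by exists d => // y /hd; apply: le_lt_trans; exact: ler_dist_enorm.
Qed.

Lemma eballE x r y : eball x r y = (enorm (y - x) < r) :> Prop.
Proof. by []. Qed.

Lemma eball_open x r : open (eball x r).
Proof.
apply/open_rVP => y; rewrite eballE -subr_gt0 => /enorm_lt_ball[d d0 hd].
exists d => // z /hd h; rewrite eballE.
by apply: le_lt_trans (ler_enorm_triangle y _ _) _; rewrite -ltrBrDr.
Qed.

Lemma measurable_eball x r : measurable (eball x r).
Proof. by apply: open_measurable_rV; exact: eball_open. Qed.

Lemma sub_eball x r y s : enorm (y - x) + s <= r -> eball y s `<=` eball x r.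
Proof.
move=> h z; rewrite !eballE => zs; apply: lt_le_trans h.
by apply: le_lt_trans (ler_enorm_triangle y _ _) _; rewrite addrC ltrD2l.
Qed.

Lemma subset_eball x r s : r <= s -> eball x r `<=` eball x s.
Proof. by move=> rs; apply: sub_eball; rewrite subrr enorm0 add0r. Qed.

Lemma eball_affine a s x r : 0 < s ->
  (fun y => a + s *: y) @^-1` eball (a + s *: x) (s * r) = eball x r.
Proof.
move=> s0; apply/seteqP; split => y /=; rewrite !eballE opprD addrACA subrr add0r -scalerBr enormZ gtr0_norm// ltr_pM2l//.
Qed.

End euclidean_norm.

Section balls.
Context (R : realType).

(** Boxes have an explicit volume; comparison with them shows that balls have
    finite positive volume. *)
Definition box n (M : R) : set 'rV[R]_n := [set x | forall i, `|x ord0 i| <= M].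

Lemma measurable_box n (M : R) : measurable (@box n M).
Proof.
rewrite (_ : box M = \bigcap_(i in [set: 'I_n])
    ((fun y : 'rV[R]_n => y ord0 i) @^-1` `[- M, M]%classic)); last first.
  by apply/seteqP; split => y /= h i => [_|]; have := h i;
    rewrite /= in_itv/= -ler_norml => h'; apply: h'.
apply: fin_bigcap_measurable => // i _.
by rewrite -[X in measurable X]setTI; apply: measurable_coor.
Qed.

Lemma lebesgue_rV_box n (M : R) : 0 <= M ->
  lebesgue_rV R n (box M) = ((M *+ 2) ^+ n)%:E.
Proof.
move=> M0; elim: n => [|n IH].
  by rewrite expr0 /= diracE mem_set// => -[].
rewrite [LHS](_ : _ = ((@lebesgue_measure R) \x lebesgue_rV R n)%E
  (`[- M, M]%classic `*` @box n M)); last first.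
  rewrite /= /lebesgue_rV_cons /pushforward; congr ((_ \x _)%E _).
  apply/seteqP; split => -[t v] /=.
    move=> h; rewrite in_itv/= -ler_norml; split.
      by have := h ord0; rewrite rV_cons0.
    by move=> i; have := h (lift ord0 i); rewrite rV_consS.
  rewrite in_itv/= -ler_norml => -[h1 h2] i.
  by case: (unliftP ord0 i) => [j|] ->; rewrite ?rV_consS ?rV_cons0.
rewrite product_measure1E//; last exact: measurable_box.
rewrite IH /= lebesgue_measure_itv /= lte_fin; have [M0'|] := ltP (- M) M.
  by rewrite -EFinB -EFinM opprK exprS mulr2n.
rewrite le_eqVlt => /predU1P[MM|MM]; last by exfalso; lra.
have -> : M = 0 by lra.
by rewrite mul0e exprS mul0rn mul0r.
Qed.

Lemma lebesgue_eball_lty n (x : 'rV[R]_n) (r : R) :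
  (lebesgue_rV R n (eball x r) < +oo)%E.
Proof.
pose M := enorm x + `|r|; have M0 : 0 <= M by rewrite addr_ge0 ?enorm_ge0.
apply: (@le_lt_trans _ _ (lebesgue_rV R n (box M))); last first.
  by rewrite lebesgue_rV_box// ltry.
apply: le_measure; rewrite ?inE; [exact: measurable_eball|exact: measurable_box|].
move=> y; rewrite eballE => yr i /=; apply: le_trans (normr_coord_le_enorm _ _) _.
rewrite -(subrK x y); apply: le_trans (ler_enormD _ _) _; rewrite addrC lerD2l.
by rewrite (le_trans (ltW yr))// ler_norm.
Qed.

Definition unit_ball_volume n : R := fine (lebesgue_rV R n (eball 0 1)).

Lemma lebesgue_eball n (x : 'rV[R]_n) (r : R) : 0 < r ->
  lebesgue_rV R n (eball x r) = (r ^+ n * unit_ball_volume n)%:E.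
Proof.
move=> r0; rewrite -(lebesgue_rV_affine x r0 (measurable_eball x r)).
have := eball_affine x 0 1 r0; rewrite scaler0 addr0 mulr1 => ->.
by rewrite EFinM /unit_ball_volume fineK// ge0_fin_numE// lebesgue_eball_lty.
Qed.

Lemma unit_ball_volume_gt0 n : 0 < unit_ball_volume n.
Proof.
rewrite /unit_ball_volume fine_gt0// lebesgue_eball_lty andbT.
pose M : R := (n%:R + 1)^-1 / 2; have n1 : 0 < n%:R + 1 :> R by rewrite ltr_wpDl.
have M0 : 0 < M by rewrite divr_gt0// invr_gt0.
apply: (@lt_le_trans _ _ (lebesgue_rV R n (box M))).
  by rewrite lebesgue_rV_box ?ltW// lte_fin exprn_gt0// mulrn_wgt0.
apply: le_measure; rewrite ?inE; [exact: measurable_box|exact: measurable_eball|].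
move=> y /= h; rewrite eballE subr0; apply: le_lt_trans (enorm_le_normr _) _.
apply: (@le_lt_trans _ _ (n%:R * M)).
  rewrite ler_wpM2l// [leLHS]mx_normrE; apply/bigmax_leP; split; first exact: ltW.
  by move=> [i j] _ /=; rewrite (ord1 i).
rewrite /M mulrA ltr_pdivrMr// mul1r ltr_pdivrMr//.
have : 0 <= n%:R :> R by []. lra.
Qed.

End balls.

(** * Calculus of smooth functions *)

Section derivatives.
Context (R : realType).

Lemma is_derive_epsP (V : normedModType R) (f : V -> R) (x v : V) (l : R) :
  (forall e, 0 < e -> exists2 d, 0 < d & forall h, h != 0 -> `|h| < d ->
     `|h^-1 * (f (h *: v + x) - f x) - l| <= e) ->
  is_derive x v f l.
Proof.
move=> H.
have C : h^-1 *: ((f \o shift x) (h *: v) - f x) @[h --> 0^'] --> l.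
  apply/cvgrPdist_le => e e0; have [d d0 hd] := H e e0.
  near=> h; rewrite distrC; apply: hd.
    by near: h; exact: nbhs_dnbhs_neq.
  near: h; rewrite /dnbhs; apply: filter_app (nbhsx_ballx (0 : R) d d0).
  by near=> h; rewrite /ball /= sub0r normrN.
apply: DeriveDef; first by apply/cvg_ex; exists l.
exact/cvg_lim.
Unshelve. all: end_near. Qed.

Lemma is_derive_line (V : normedModType R) (f : V -> R) (x v : V) (t d : R) :
  is_derive (x + t *: v) v f d -> is_derive t 1 (fun s : R => f (x + s *: v)) d.
Proof.
move=> [df dE].
have E : (fun h : R => h^-1 *: (((fun s : R => f (x + s *: v)) \o shift t) (h *: (1 : R)) - f (x + t *: v))) =
         (fun h : R => h^-1 *: ((f \o shift (x + t *: v)) (h *: v) - f (x + t *: v))).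
  apply/funext => h /=; congr (_ *: (f _ - _)).
  by rewrite [h%:A]mulr1 scalerDl addrCA.
by apply: DeriveDef; rewrite /derivable /derive E.
Qed.

Lemma is_derive_lineC (V : normedModType R) (f : V -> R) (x v : V) (t d : R) :
  is_derive (t *: v + x) v f d -> is_derive t 1 (fun s : R => f (s *: v + x)) d.
Proof.
rewrite addrC => /is_derive_line.
rewrite (_ : (fun s : R => f (x + s *: v)) = (fun s : R => f (s *: v + x)))//.
by apply/funext => s; rewrite addrC.
Qed.

Lemma derive_line (V : normedModType R) (f : V -> R) (x v : V) :
  'D_v f x = 'D_1 (fun h : R => f (h *: v + x)) 0.
Proof.
rewrite /derive; set g1 := fun h => h^-1 *: _; set g2 := fun h => h^-1 *: _.
suff -> : g1 = g2 by [].
by apply/funext => h; rewrite /g1 /g2 /= addr0 scale0r add0r [_%:A]mulr1.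
Qed.

Lemma MVT_line (V : normedModType R) (f : V -> R) (x v : V) (t : R) :
  (forall y, derivable f y v) ->
  exists2 s, `|s| <= `|t| & f (x + t *: v) - f x = t * 'D_v f (x + s *: v).
Proof.
move=> df; pose g s := f (x + s *: v).
have dg (s : R) : is_derive s 1 g ('D_v f (x + s *: v)).
  by apply: is_derive_line; apply: derivableP.
have cg a b : {within `[a, b], continuous g}.
  apply: derivable_within_continuous => s _; exact: ex_derive.
have [t0|t0] := leP 0 t.
  have [s st] := @MVT_segment R g (fun s => 'D_v f (x + s *: v)) 0 t t0 (fun s _ => dg s) (cg _ _).
  move: st; rewrite in_itv/= => /andP[s0 st].
  rewrite /g scale0r addr0 subr0 mulrC => ->; exists s => //.
  by rewrite !ger0_norm.
have [s st] := @MVT_segment R g (fun s => 'D_v f (x + s *: v)) t 0 (ltW t0) (fun s _ => dg s) (cg _ _).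
move: st; rewrite in_itv/= => /andP[ts s0].
rewrite /g scale0r addr0 sub0r => E; exists s.
  by rewrite !ler0_norm ?(ltW t0)// lerN2.
by rewrite -opprB E mulrN opprK mulrC.
Qed.

Lemma MVT_bound (g dg : R -> R) (M t : R) : 0 <= t ->
  (forall s : R, is_derive s 1 g (dg s)) ->
  (forall s, 0 <= s <= t -> `|dg s| <= M) -> `|g t - g 0| <= M * t.
Proof.
move=> t0 Dg bg.
have [|s st ->] := @MVT_segment R g dg 0 t t0 (fun s _ => Dg s).
  by apply: derivable_within_continuous => s _; exact: ex_derive.
rewrite subr0 normrM (ger0_norm t0) ler_wpM2r// bg//.
Qed.

End derivatives.

Section smooth_functions.
Context (R : realType) (n : nat).
Local Notation V := 'rV[R]_n.
Local Notation e_ i := (delta_mx ord0 i : V).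
Implicit Types (f g : V -> R) (x y : V).

Lemma smooth_continuous f : smooth f -> continuous f.
Proof. by move=> sf; have [] := sf [::]. Qed.

Lemma smooth_derivable f i x : smooth f -> derivable f x (e_ i).
Proof. by move=> sf; have [_] := sf [::]; exact. Qed.

Lemma smooth_is_derive f i x : smooth f -> is_derive x (e_ i) f (pderiv i f x).
Proof. by move=> sf; apply: derivableP; exact: smooth_derivable. Qed.

Lemma smooth_pderiv i f : smooth f -> smooth (pderiv i f).
Proof.
move=> sf s; rewrite (_ : iter_pderiv s _ = iter_pderiv (rcons s i) f)//.
by rewrite /iter_pderiv foldr_rcons.
Qed.

(** Smoothness is coinductive: it suffices to find the function in a class
    of functions that is stable under partial derivatives. The classes used
    below are closures of the functions of interest under the operations that
    the differentiation rules introduce. *)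
Lemma smooth_coind (S : (V -> R) -> Prop) :
  (forall f, S f -> continuous f /\
     forall i, (forall x, derivable f x (e_ i)) /\ S (pderiv i f)) ->
  forall f, S f -> smooth f.
Proof.
move=> HS f Sf s; suff /HS[cf df] : S (iter_pderiv s f).
  by split => // i x; have [] := df i.
by elim: s => //= i s /HS[_ /(_ i)[]].
Qed.

Lemma continuousD_rV f g : continuous f -> continuous g -> continuous (fun x => f x + g x).
Proof.
move=> /continuous_rVP cf /continuous_rVP cg; apply/continuous_rVP => x e e0.
have e2 : 0 < e / 2 by rewrite divr_gt0.
have [d d0 hd] := cf x _ e2; have [d' d0' hd'] := cg x _ e2.
exists (Num.min d d'); first by rewrite lt_min d0.
move=> y; rewrite lt_min => /andP[/hd h1 /hd' h2].
by rewrite opprD addrACA (le_lt_trans (ler_normD _ _))// (splitr e) ltrD.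
Qed.

Lemma continuousM_rV f g : continuous f -> continuous g -> continuous (fun x => f x * g x).
Proof.
move=> /continuous_rVP cf /continuous_rVP cg; apply/continuous_rVP => x e e0.
pose A := `|f x| + 1; pose B := `|g x| + 1.
have A0 : 0 < A by rewrite ltr_wpDl.
have B0 : 0 < B by rewrite ltr_wpDl.
have e1 : 0 < Num.min 1 (e / 2 / B) by rewrite lt_min ltr01 !divr_gt0.
have e2 : 0 < e / 2 / A by rewrite !divr_gt0.
have [d d0 hd] := cf x _ e1; have [d' d0' hd'] := cg x _ e2.
exists (Num.min d d'); first by rewrite lt_min d0.
move=> y; rewrite lt_min => /andP[/hd h1 /hd' h2].
move: h1; rewrite lt_min => /andP[h0 h1].
have -> : f y * g y - f x * g x = f y * (g y - g x) + (f y - f x) * g x by ring.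
rewrite (le_lt_trans (ler_normD _ _))// (splitr e) !normrM; apply: ltr_leD.
  apply: (@le_lt_trans _ _ (A * `|g y - g x|)); last by rewrite mulrC -ltr_pdivlMr.
  rewrite ler_wpM2r// /A -{1}(subrK (f x) (f y)) (le_trans (ler_normD _ _))// addrC lerD2l ltW//.
apply: (@le_trans _ _ (`|f y - f x| * B)); first by rewrite ler_wpM2l// lerDl.
by rewrite -ler_pdivlMr// ltW.
Qed.

Lemma continuous_comp_rV (G : R -> R) f : continuous G -> continuous f ->
  continuous (fun x => G (f x)).
Proof. by move=> cG cf x; apply: (continuous_comp (cf x)); exact: cG. Qed.

Lemma continuous_affine_rV f (a : V) (s : R) : continuous f ->
  continuous (fun x => f (a + s *: x)).
Proof.
move=> /continuous_rVP cf; apply/continuous_rVP => x e e0.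
have [d d0 hd] := cf (a + s *: x) e e0.
have s1 : 0 < `|s| + 1 by rewrite ltr_wpDl.
exists (d / (`|s| + 1)); first by rewrite divr_gt0.
move=> y h; apply: hd; rewrite opprD addrACA subrr add0r -scalerBr normrZ.
by rewrite ltr_pdivlMr// mulrDr mulr1 in h; apply: le_lt_trans h; rewrite mulrC lerDl.
Qed.

Lemma continuous_cst_rV (c : R) : continuous (fun _ : V => c).
Proof. by apply/continuous_rVP => x e e0; exists 1 => // y _; rewrite subrr normr0. Qed.

Lemma continuous_coord_rV i : continuous (fun x : V => x ord0 i).
Proof.
apply/continuous_rVP => x e e0; exists e => // y; apply: le_lt_trans.
by have := normr_coord_le (y - x) i; rewrite !mxE.
Qed.

Lemma pderivD i f g : (forall x, derivable f x (e_ i)) ->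
  (forall x, derivable g x (e_ i)) ->
  pderiv i (fun x => f x + g x) = (fun x => pderiv i f x + pderiv i g x).
Proof. by move=> df dg; apply/funext => x; exact: deriveD. Qed.

Lemma pderivM i f g : (forall x, derivable f x (e_ i)) ->
  (forall x, derivable g x (e_ i)) ->
  pderiv i (fun x => f x * g x) = (fun x => f x * pderiv i g x + g x * pderiv i f x).
Proof. by move=> df dg; apply/funext => x; exact: deriveM. Qed.

Lemma pderiv_cst i (c : R) : pderiv i (fun _ : V => c) = (fun=> 0).
Proof. by apply/funext => x; exact: derive_cst. Qed.

Lemma is_derive_affine f i (a : V) (s : R) x d :
  is_derive (a + s *: x) (e_ i) f d ->
  is_derive x (e_ i) (fun x => f (a + s *: x)) (s * d).
Proof.
move=> D.
have D1 : is_derive (s * 0) 1 (fun t : R => f ((a + s *: x) + t *: e_ i)) d.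
  by rewrite mulr0; apply: is_derive_line; rewrite scale0r addr0.
have D2 : is_derive (0 : R) 1 (fun t => s * t) s.
  have -> : (fun t => s * t) = (s \*: (@id R)) by [].
  by apply: is_derive_eq (is_deriveZ _ _) _; rewrite [LHS]mulr1.
have [df dE] := @is_derive1_comp R _ _ _ _ _ D1 D2.
have E : (fun t : R => f (a + s *: x + t *: e_ i)) \o (fun t => s * t) =
    (fun h => f (a + s *: (h *: e_ i + x))).
  by apply/funext => h /=; congr f; rewrite scalerDr scalerA -addrA; congr (a + _); rewrite addrC.
rewrite E in df dE; apply: DeriveDef; first by apply/derivable1P.
by rewrite mulrC -dE derive_line.
Qed.

Lemma pderiv_affine i f (a : V) (s : R) : (forall x, derivable f x (e_ i)) ->
  pderiv i (fun x => f (a + s *: x)) = (fun x => s * pderiv i f (a + s *: x)).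
Proof.
move=> df; apply/funext => x; have h := derivableP (df (a + s *: x)).
by have := is_derive_affine h => /@derive_val.
Qed.

Lemma is_derive_coord i j x : is_derive x (e_ i) (fun x : V => x ord0 j) (i == j)%:R.
Proof.
apply: is_derive_epsP => e e0; exists 1 => // h h0 _; rewrite !mxE eqxx /=.
by rewrite addrK mulrA mulVf// mul1r (eq_sym j) subrr normr0 ltW.
Qed.

Lemma pderiv_coord i j : pderiv i (fun x : V => x ord0 j) = (fun=> (i == j)%:R).
Proof. by apply/funext => x; have := is_derive_coord i j x => /@derive_val. Qed.

Inductive smooth_closure : (V -> R) -> Prop :=
| smooth_closure_base f of smooth f : smooth_closure f
| smooth_closureD f g of smooth_closure f & smooth_closure g :
    smooth_closure (fun x => f x + g x)
| smooth_closureM f g of smooth_closure f & smooth_closure g :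
    smooth_closure (fun x => f x * g x).

Lemma smooth_closureP f : smooth_closure f -> smooth f.
Proof.
apply: smooth_coind => {}f; elim => {f} [f sf|f g Cf [cf hf] Cg [cg hg]|f g Cf [cf hf] Cg [cg hg]].
- split; first exact: smooth_continuous.
  move=> i; split; first by move=> x; exact: smooth_derivable.
  by apply: smooth_closure_base; exact: smooth_pderiv.
- split; first exact: continuousD_rV.
  move=> i; have [df Sf] := hf i; have [dg Sg] := hg i; split.
    by move=> x; apply: derivableD.
  by rewrite pderivD//; exact: smooth_closureD.
- split; first exact: continuousM_rV.
  move=> i; have [df Sf] := hf i; have [dg Sg] := hg i; split.
    by move=> x; apply: derivableM.
  by rewrite pderivM//; apply: smooth_closureD; exact: smooth_closureM.
Qed.

Lemma smoothD f g : smooth f -> smooth g -> smooth (fun x => f x + g x).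
Proof. by move=> sf sg; apply: smooth_closureP; apply: smooth_closureD; exact: smooth_closure_base. Qed.

Lemma smoothM f g : smooth f -> smooth g -> smooth (fun x => f x * g x).
Proof. by move=> sf sg; apply: smooth_closureP; apply: smooth_closureM; exact: smooth_closure_base. Qed.

Lemma smooth_cst (c : R) : smooth (fun _ : V => c).
Proof.
apply: (@smooth_coind (fun f => exists c, f = fun=> c)); last by exists c.
move=> _ [d ->]; split; first exact: continuous_cst_rV.
by move=> i; split => [x|]; [exact: derivable_cst|exists 0; exact: pderiv_cst].
Qed.

Lemma smooth_coord i : smooth (fun x : V => x ord0 i).
Proof.
apply: (@smooth_coind (fun f => smooth f \/ f = fun x => x ord0 i)); last by right.
move=> g [sf|->].
  split; first exact: smooth_continuous.
  by move=> j; split => [x|]; [exact: smooth_derivable|left; exact: smooth_pderiv].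
split; first exact: continuous_coord_rV.
move=> j; split => [x|]; first by have [] := is_derive_coord j i x.
by left; rewrite pderiv_coord; exact: smooth_cst.
Qed.

Lemma smoothZ (c : R) f : smooth f -> smooth (fun x => c * f x).
Proof. by move=> sf; apply: smoothM => //; exact: smooth_cst. Qed.

Lemma smoothN f : smooth f -> smooth (fun x => - f x).
Proof. by move=> /(smoothZ (-1)); congr (smooth _); apply/funext => x; rewrite mulN1r. Qed.

Lemma smoothB f g : smooth f -> smooth g -> smooth (fun x => f x - g x).
Proof. by move=> sf sg; exact: (smoothD sf (smoothN sg)). Qed.

Lemma smooth_sum (I : Type) (r : seq I) (F : I -> V -> R) :
  (forall i, smooth (F i)) -> smooth (fun x => \sum_(i <- r) F i x).
Proof.
move=> sF; elim: r => [|i r IH].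
  by rewrite (_ : (fun _ => _) = fun=> 0) ?[in LHS]big_nil//; [exact: smooth_cst|apply/funext => x; rewrite big_nil].
rewrite (_ : (fun _ => _) = fun x => F i x + \sum_(j <- r) F j x).
  exact: smoothD.
by apply/funext => x; rewrite big_cons.
Qed.

Lemma smooth_affine f (a : V) (s : R) : smooth f -> smooth (fun x => f (a + s *: x)).
Proof.
move=> sf; apply: (@smooth_coind (fun g => exists (c : R) h, smooth h /\ g = fun x => c * h (a + s *: x))); last first.
  by exists 1, f; split => //; apply/funext => x; rewrite mul1r.
move=> _ [c [h [sh ->]]]; split.
  apply: continuousM_rV; first exact: continuous_cst_rV.
  by apply: continuous_affine_rV; exact: smooth_continuous.
have dh i x : derivable (fun x => h (a + s *: x)) x (e_ i).
  by have [] := is_derive_affine (smooth_is_derive i (a + s *: x) sh).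
move=> i; split => [x|]; first by apply: derivableM; [exact: derivable_cst|exact: dh].
exists (c * s), (pderiv i h); split; first exact: smooth_pderiv.
rewrite pderivM// pderiv_cst pderiv_affine; last by move=> x; exact: smooth_derivable.
by apply/funext => x; rewrite mulr0 addr0 mulrA.
Qed.

Lemma is_derive_pderivE i f x d : is_derive x (e_ i) f d -> pderiv i f x = d.
Proof. by move=> /@derive_val. Qed.

Lemma smooth_pderivD i f g : smooth f -> smooth g ->
  pderiv i (fun x => f x + g x) = (fun x => pderiv i f x + pderiv i g x).
Proof. by move=> sf sg; apply: pderivD => x; exact: smooth_derivable. Qed.

Lemma smooth_pderivM i f g : smooth f -> smooth g ->
  pderiv i (fun x => f x * g x) = (fun x => f x * pderiv i g x + g x * pderiv i f x).
Proof. by move=> sf sg; apply: pderivM => x; exact: smooth_derivable. Qed.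

Lemma smooth_pderivZ i (c : R) f : smooth f ->
  pderiv i (fun x => c * f x) = (fun x => c * pderiv i f x).
Proof.
move=> sf; rewrite (smooth_pderivM i (@smooth_cst c) sf).
by apply/funext => x; rewrite pderiv_cst mulr0 addr0.
Qed.

Lemma smooth_pderivB i f g : smooth f -> smooth g ->
  pderiv i (fun x => f x - g x) = (fun x => pderiv i f x - pderiv i g x).
Proof.
move=> sf sg; rewrite (_ : (fun x => f x - g x) = fun x => f x + (-1) * g x); last first.
  by apply/funext => x; rewrite mulN1r.
rewrite (smooth_pderivD i sf (smoothZ (-1) sg)) (smooth_pderivZ i (-1) sg).
by apply/funext => x; rewrite mulN1r.
Qed.

Lemma smooth_pderiv_affine i f (a : V) (s : R) : smooth f ->
  pderiv i (fun x => f (a + s *: x)) = (fun x => s * pderiv i f (a + s *: x)).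
Proof. by move=> sf; apply: pderiv_affine => x; exact: smooth_derivable. Qed.

Lemma smooth_pderiv_sum i (I : Type) (r : seq I) (F : I -> V -> R) :
  (forall k, smooth (F k)) ->
  pderiv i (fun x => \sum_(k <- r) F k x) = (fun x => \sum_(k <- r) pderiv i (F k) x).
Proof.
move=> sF; elim: r => [|k r IH].
  rewrite (_ : (fun x => \sum_(k <- [::]) F k x) = fun=> 0); last first.
    by apply/funext => x; rewrite big_nil.
  by rewrite pderiv_cst; apply/funext => x; rewrite big_nil.
rewrite (_ : (fun x => \sum_(j <- k :: r) F j x) = fun x => F k x + \sum_(j <- r) F j x); last first.
  by apply/funext => x; rewrite big_cons.
rewrite smooth_pderivD// ?IH; last exact: smooth_sum.
by apply/funext => x; rewrite big_cons.
Qed.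

Lemma MVT_pderiv i f x (t : R) : smooth f ->
  exists2 s, `|s| <= `|t| & f (x + t *: e_ i) - f x = t * pderiv i f (x + s *: e_ i).
Proof. by move=> sf; apply: MVT_line => y; exact: smooth_derivable. Qed.

End smooth_functions.

Opaque pderiv.

(** * Taylor expansion *)

Section real_identities.
Context (R : realFieldType).
Implicit Types a b c d e : R.

Lemma second_difference_swap a b c d : a - b - (c - d) = a - c - (b - d).
Proof. by ring. Qed.

Lemma dist_through a b c e : `|c - a| < e / 2 -> `|c - b| < e / 2 -> `|a - b| <= e.
Proof.
move=> ca cb; rewrite (splitr e) -(subrKA c) (le_trans (ler_normD _ _))//.
by rewrite lerD// ltW// distrC.
Qed.

End real_identities.

Section taylor.
Context (R : realType) (n : nat).
Local Notation V := 'rV[R]_n.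
Local Notation e_ i := (delta_mx ord0 i : V).
Implicit Types (f g : V -> R) (x y h v : V).

Lemma smooth_near f x e : smooth f -> 0 < e ->
  exists2 d, 0 < d & forall y, `|y - x| < d -> `|f y - f x| < e.
Proof. by move=> /smooth_continuous/continuous_rVP/(_ x e) cf e0; exact: cf. Qed.

Lemma smooth_pderiv_near f x e : smooth f -> 0 < e ->
  exists2 d, 0 < d & forall i y, `|y - x| < d -> `|pderiv i f y - pderiv i f x| < e.
Proof.
move=> sf e0; have H i := cid2 (smooth_near x (smooth_pderiv i sf) e0).
pose dd i := s2val (H i); exists (\big[Num.min/1]_i dd i).
  by apply/bigmin_gtP; split => // i _; exact: (s2valP (H i)).
move=> i y yx; apply: (s2valP' (H i)); apply: lt_le_trans yx _.
exact: bigmin_le_cond.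
Qed.

Lemma row_norm_le x (r : R) : 0 <= r -> (forall i, `|x ord0 i| <= r) -> `|x| <= r.
Proof.
move=> r0 xr; rewrite [leLHS]mx_normrE; apply/bigmax_leP; split => //.
by move=> [i j] _ /=; rewrite (ord1 i).
Qed.

(** Continuous partial derivatives give a first-order expansion: moving from
    [x] to [x + h] one coordinate at a time, each step is controlled by the
    mean value theorem. *)
Lemma smooth_expansion f x e : smooth f -> 0 < e -> exists2 d, 0 < d &
  forall h, `|h| < d ->
    `|f (x + h) - f x - \sum_i h ord0 i * pderiv i f x| <= e * `|h|.
Proof.
move=> sf e0; have e1 : 0 < e / (n%:R + 1) by rewrite divr_gt0// ltr_wpDl.
have [d d0 hd] := smooth_pderiv_near x sf e1; exists d => // h hlt.
pose hk k : V := \row_i (if (i < k)%N then h ord0 i else 0).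
have hkS (k : 'I_n) : hk k.+1 = hk k + h ord0 k *: e_ k.
  apply/rowP => i; rewrite !mxE eqxx /= ltnS leq_eqVlt.
  case: ltngtP => //= ik; rewrite ?(mulr0, addr0, mulr1, add0r)//.
  - by rewrite (_ : (i == k) = false) ?mulr0 ?addr0//; apply/eqP => E; rewrite E ltnn in ik.
  - by rewrite (_ : (i == k) = false) ?mulr0//; apply/eqP => E; rewrite E ltnn in ik.
  - have -> : i = k by exact: val_inj.
    by rewrite eqxx mulr1.
have -> : f (x + h) - f x = \sum_(k < n) (f (x + hk k.+1) - f (x + hk k)).
  rewrite -(big_mkord xpredT (fun k => f (x + hk k.+1) - f (x + hk k))) telescope_sumr//.
  congr (f _ - f _); last by rewrite (_ : hk 0%N = 0) ?addr0//; apply/rowP => i; rewrite !mxE.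
  by congr (_ + _); apply/rowP => i; rewrite !mxE ltn_ord.
rewrite -sumrB; apply: le_trans (ler_norm_sum _ _ _) _.
apply: (@le_trans _ _ (\sum_(i < n) e / (n%:R + 1) * `|h|)); last first.
  rewrite sumr_const card_ord -[leLHS]mulr_natl mulrA ler_wpM2r//.
  have n1 : 0 < n%:R + 1 :> R by rewrite ltr_wpDl.
  by rewrite mulrA ler_pdivrMr// mulrC ler_pM2l// lerDl.
apply: ler_sum => k _.
have [s sh E] := MVT_pderiv k (x + hk k) (h ord0 k) sf.
rewrite hkS addrA E -mulrBr normrM mulrC.
apply: ler_pM => //; last exact: normr_coord_le.
apply: ltW; apply: hd; rewrite -[x + _ + _]addrA [x + _]addrC addrK; apply: le_lt_trans hlt.
apply: row_norm_le => // i; rewrite !mxE eqxx /=; case: ltnP => ik.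
  rewrite (_ : (i == k) = false) ?mulr0 ?addr0; first exact: normr_coord_le.
  by apply/eqP => Ei; rewrite Ei ltnn in ik.
rewrite add0r; case: eqP => [Ei|_]; last by rewrite mulr0 normr0.
by rewrite mulr1 (le_trans sh)// normr_coord_le.
Qed.

Definition dirderiv v f : V -> R := fun y => \sum_i v ord0 i * pderiv i f y.

Lemma smooth_dirderiv v f : smooth f -> smooth (dirderiv v f).
Proof. by move=> sf; apply: smooth_sum => i; apply: smoothZ; exact: smooth_pderiv. Qed.

Lemma smooth_is_dirderiv f x v : smooth f -> is_derive x v f (dirderiv v f x).
Proof.
move=> sf; apply: is_derive_epsP => e e0.
have v1 : 0 < `|v| + 1 by rewrite ltr_wpDl.
have [d d0 hd] := smooth_expansion x sf (divr_gt0 e0 v1).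
exists (d / (`|v| + 1)) => [|h h0 hlt]; first by rewrite divr_gt0.
have hv : `|h *: v| < d.
  rewrite normrZ; rewrite ltr_pdivlMr// in hlt; apply: le_lt_trans hlt.
  by rewrite ler_wpM2l// lerDl.
have := hd _ hv; rewrite [x + _]addrC.
have -> : \sum_i (h *: v) ord0 i * pderiv i f x = h * dirderiv v f x.
  by rewrite /dirderiv mulr_sumr; apply: eq_bigr => i _; rewrite mxE mulrA.
move=> H; have hn : 0 < `|h| by rewrite normr_gt0.
rewrite -(ler_pM2l hn) -normrM mulrBr mulrA divff// mul1r (le_trans H)//.
rewrite normrZ mulrCA ler_wpM2l// mulrAC ler_pdivrMr// ler_wpM2l ?ltW//.
by rewrite ltrDl.
Qed.

Lemma smooth_is_derive_line f x v (t : R) : smooth f ->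
  is_derive t 1 (fun s : R => f (x + s *: v)) (dirderiv v f (x + t *: v)).
Proof. by move=> sf; apply: is_derive_line; exact: smooth_is_dirderiv. Qed.

(** The mean value theorem in the direction [e_ j], then in the direction
    [e_ i]. *)
Lemma second_difference f i j x (h : R) : smooth f ->
  exists2 y, `|y - x| <= 2 * `|h| &
    f (x + h *: e_ i + h *: e_ j) - f (x + h *: e_ i) - (f (x + h *: e_ j) - f x)
      = h ^+ 2 * pderiv i (pderiv j f) y.
Proof.
move=> sf; pose g y := f (h *: e_ i + 1 *: y) - f y.
have saf : smooth (fun y => f (h *: e_ i + 1 *: y)) by exact: smooth_affine.
have sg : smooth g by exact: (smoothB saf sf).
have pg y : pderiv j g y = pderiv j f (y + h *: e_ i) - pderiv j f y.
  by rewrite /g (smooth_pderivB _ saf sf) (smooth_pderiv_affine _ _ _ sf) mul1r scale1r [_ + y]addrC.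
have [s sh E] := MVT_pderiv j x h sg.
have [t th E'] := MVT_pderiv i (x + s *: e_ j) h (smooth_pderiv j sf).
exists (x + s *: e_ j + t *: e_ i).
  rewrite -[x + _ + _]addrA [x + _]addrC addrK (le_trans (ler_normD _ _))// mulr_natl mulr2n.
  rewrite !normrZ; have N k : `|e_ k| <= 1.
    by apply: row_norm_le => // l; rewrite mxE eqxx /=; case: eqP => //; rewrite ?normr1 ?normr0.
  by apply: lerD; [apply: le_trans sh|apply: le_trans th]; rewrite ler_piMr.
rewrite pg E' mulrA -expr2 in E; rewrite -E /g !scale1r.
rewrite ![h *: e_ i + _]addrC [x + h *: e_ j + _]addrAC.
exact: second_difference_swap.
Qed.

(** Both mixed derivatives are limits of the same second difference quotient,
    which is symmetric in the two directions. *)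
Lemma pderivC f i j : smooth f -> pderiv i (pderiv j f) = pderiv j (pderiv i f).
Proof.
move=> sf; apply/funext => x; apply/eqP; rewrite -subr_eq0 -normr_le0.
apply/ler_addgt0Pr => e e0; rewrite add0r.
have e2 : 0 < e / 2 by rewrite divr_gt0.
have [d d0 hd] := smooth_near x (smooth_pderiv i (smooth_pderiv j sf)) e2.
have [d' d0' hd'] := smooth_near x (smooth_pderiv j (smooth_pderiv i sf)) e2.
pose h : R := Num.min d d' / 4.
have m0 : 0 < Num.min d d' by rewrite lt_min d0.
have h0 : 0 < h by rewrite divr_gt0.
have h2 : 2 * `|h| < Num.min d d' by rewrite gtr0_norm// /h; lra.
have [y yx E] := second_difference i j x h sf.
have [z zx E'] := second_difference j i x h sf.
have hyz : pderiv i (pderiv j f) y = pderiv j (pderiv i f) z.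
  apply: (mulfI (_ : h ^+ 2 != 0)); first by rewrite expf_neq0// gt_eqF.
  apply: etrans (esym E) _; apply: etrans _ E'; rewrite [x + h *: e_ j + _]addrAC.
  exact: second_difference_swap.
have := le_lt_trans yx h2; rewrite lt_min => /andP[/hd hy _].
have := le_lt_trans zx h2; rewrite lt_min => /andP[_ /hd' hz].
by rewrite -hyz in hz; exact: dist_through hy hz.
Qed.

(** One step of the Taylor formula along a segment: a bound on the derivative
    of the remainder gives the same bound on the remainder. It is iterated with
    [p] the Taylor polynomial and its derivatives. *)
Lemma line_poly_bound k (p : {poly R}) z x (B : R) : smooth k -> k z = p.[0] ->
  (forall t : R, 0 <= t <= 1 -> `|dirderiv x k (z + t *: x) - p^`().[t]| <= B) ->
  forall t : R, 0 <= t <= 1 -> `|k (z + t *: x) - p.[t]| <= B.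
Proof.
move=> sk kz bB t /andP[t0 t1].
have := @MVT_bound R _ _ B t t0
  (fun s => is_deriveB (smooth_is_derive_line z x s sk) (is_derive_poly p s)).
have E (s : R) : ((fun s : R => k (z + s *: x)) - horner p) s = k (z + s *: x) - p.[s] by [].
rewrite !E scale0r addr0 kz subrr subr0 => H.
apply: (le_trans (H _)) => [s /andP[s0 st]|].
  by apply: bB; rewrite s0 (le_trans st t1).
by rewrite ler_piMr// (le_trans _ (bB 0 _))// lexx ler01.
Qed.

Lemma taylor_dirderiv f z x (B : R) : smooth f ->
  (forall y, `|dirderiv x (dirderiv x (dirderiv x f)) y| <= B) ->
  `|f (z + x) - (f z + dirderiv x f z + 2^-1 * dirderiv x (dirderiv x f) z)| <= B.
Proof.
move=> sf; have s1 := smooth_dirderiv x sf; have s2 := smooth_dirderiv x s1.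
have := line_poly_bound (x := x) sf; have := line_poly_bound (x := x) s1.
have := line_poly_bound (x := x) s2.
move: {s1 s2} (dirderiv x f) => d1; move: (dirderiv x d1) => d2.
move: (dirderiv x d2) => d3 b2 b1 b0 bB.
pose p0 := (f z)%:P + d1 z *: 'X + (d2 z / 2) *: 'X^2.
pose p1 := (d1 z)%:P + d2 z *: 'X; pose p2 := (d2 z)%:P.
have dp0 : p0^`() = p1.
  rewrite /p0 /p1 !(derivD, derivC, derivZ, derivX, derivXn) expr1 add0r alg_polyC -scalerMnr scalerMnl -mulr_natr.
  by rewrite divfK ?pnatr_eq0.
have dp1 : p1^`() = p2 by rewrite /p1 /p2 !(derivD, derivC, derivZ, derivX) add0r alg_polyC.
have dp2 : p2^`() = 0 by rewrite /p2 derivC.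
have h2 := b2 p2 z B; rewrite dp2 in h2.
have h1 := b1 p1 z B; rewrite dp1 in h1.
have h0 := b0 p0 z B; rewrite dp0 in h0.
have := h0 _ _ 1; rewrite scale1r => h01.
have -> : f z + d1 z + 2^-1 * d2 z = p0.[1].
  by rewrite /p0 !(hornerD, hornerZ, hornerC, hornerX, hornerXn) expr1n !mulr1 [_ / 2]mulrC.
apply: h01; rewrite ?ler01 ?lexx//; first by rewrite /p0 !(hornerD, hornerZ, hornerC, hornerX, hornerXn) expr0n !mulr0 !addr0.
apply: h1; first by rewrite /p1 !(hornerD, hornerZ, hornerC, hornerX, hornerXn) mulr0 addr0.
apply: h2; first by rewrite /p2 hornerC.
by move=> t _; rewrite horner0 subr0; exact: bB.
Qed.

Lemma dirderiv_bound f x y (M : R) : 0 <= M ->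
  (forall i, `|pderiv i f y| <= M) -> `|dirderiv x f y| <= n%:R * `|x| * M.
Proof.
move=> M0 bM; apply: le_trans (ler_norm_sum _ _ _) _.
apply: (@le_trans _ _ (\sum_(i < n) `|x| * M)).
  by apply: ler_sum => i _; rewrite normrM ler_pM// normr_coord_le.
by rewrite sumr_const card_ord -[leLHS]mulr_natl mulrA.
Qed.

Lemma pderiv_dirderiv f x i : smooth f ->
  pderiv i (dirderiv x f) = dirderiv x (pderiv i f).
Proof.
move=> sf; rewrite /dirderiv smooth_pderiv_sum; last first.
  by move=> k; apply: smoothZ; exact: smooth_pderiv.
apply/funext => y; apply: eq_bigr => j _; rewrite smooth_pderivZ; last exact: smooth_pderiv.
by rewrite (pderivC i j sf).
Qed.

Lemma taylor3 f z x (M : R) : smooth f -> 0 <= M ->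
  (forall i j l y, `|pderiv l (pderiv j (pderiv i f)) y| <= M) ->
  `|f (z + x) - (f z + dirderiv x f z + 2^-1 * dirderiv x (dirderiv x f) z)|
    <= (n%:R * `|x|) ^+ 3 * M.
Proof.
move=> sf M0 bM; apply: taylor_dirderiv => // y.
have x0 : 0 <= n%:R * `|x| by rewrite mulr_ge0.
rewrite !exprS expr0 mulr1 -!mulrA.
rewrite [leRHS](_ : _ = n%:R * `|x| * (n%:R * `|x| * (n%:R * `|x| * M))); last by ring.
apply: dirderiv_bound => [|i]; first by rewrite !mulr_ge0.
rewrite pderiv_dirderiv; last exact: smooth_dirderiv.
apply: dirderiv_bound => [|j]; first by rewrite !mulr_ge0.
rewrite pderiv_dirderiv// pderiv_dirderiv; last exact: smooth_pderiv.
by apply: dirderiv_bound => // l; exact: bM.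
Qed.

End taylor.

(** * Integration of compactly supported functions *)

Section integrals_rV.
Context (R : realType) (n : nat).
Local Notation V := 'rV[R]_n.
Local Notation leb := (lebesgue_rV R n).
Local Notation e_ i := (delta_mx ord0 i : V).
Implicit Types (f g : V -> R) (x y h v : V).

Lemma compact_ecball x (r : R) : compact [set y | enorm (y - x) <= r].
Proof.
apply: bounded_closed_compact.
  exists (r + enorm x); split; first exact: num_real.
  move=> M rM y /= yr; apply: le_trans (ltW rM); apply: le_trans (normr_le_enorm _) _.
  by rewrite -{1}(subrK x y) (le_trans (ler_enormD _ _))// lerD2r.
rewrite -[X in closed X]setCK; apply: open_closedC; apply/open_rVP => y /= /negP.
rewrite -ltNge -subr_gt0 => /(enorm_lt_ball)-/(_ n)[d d0 hd]; exists d => // z yz.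
by apply/negP; rewrite -ltNge; exact: lt_enorm_near (hd _ _ yz).
Qed.

Lemma continuous_ecball_bound f x (r : R) : continuous f ->
  exists2 M, 0 <= M & forall y, enorm (y - x) <= r -> `|f y| <= M.
Proof.
move=> cf; have [r0|r0] := ltP r 0.
  by exists 0 => // y yr; have := le_lt_trans yr r0; rewrite ltNge enorm_ge0.
have cn : continuous (fun y => `|f y|) by apply: continuous_comp_rV => //; exact: norm_continuous.
have [|//||c _ hc] := @EVT_max_rV R n (fun y => `|f y|) [set y | enorm (y - x) <= r].
- by exists x; rewrite /= subrr enorm0.
- exact: compact_ecball.
- exact: continuous_subspaceT.
by exists `|f c| => // y yr; apply: hc; rewrite inE.
Qed.

Lemma compact_sub_eball (K : set V) x (r : R) : 0 < r -> compact K ->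
  K `<=` eball x r -> exists2 s, 0 < s < r & forall y, K y -> enorm (y - x) <= s.
Proof.
move=> r0 cK KB; have [->|/set0P K0] := eqVneq K set0.
  by exists (r / 2) => //; rewrite divr_gt0//= ltr_pdivrMr// ltr_pMr// ltr1n.
have cn : continuous (fun y => enorm (y - x)).
  have := @continuous_affine_rV R n (@enorm R n) (- x) 1 (@enorm_continuous R n).
  by rewrite (_ : (fun _ => _) = fun y => enorm (y - x))//; apply/funext => y; rewrite scale1r addrC.
have [c Kc hc] := @EVT_max_rV R n (fun y => enorm (y - x)) K K0 cK (continuous_subspaceT cn).
rewrite inE in Kc; have cr := KB _ Kc; rewrite eballE in cr.
exists (Num.max (r / 2) (enorm (c - x))).
  by rewrite lt_max divr_gt0//= gt_max cr andbT ltr_pdivrMr// ltr_pMr// ltr1n.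
by move=> y Ky; rewrite le_max; apply/orP; right; apply: hc; rewrite inE.
Qed.

Lemma continuous_integrable f x (r : R) (A : set V) : continuous f ->
  measurable A -> A `<=` eball x r -> leb.-integrable A (EFin \o f).
Proof.
move=> cf mA AB; apply: measurable_bounded_integrable => //.
- apply: le_lt_trans (lebesgue_eball_lty x r); apply: le_measure => //; rewrite ?inE//.
  exact: measurable_eball.
- by apply: measurable_funTS; exact: continuous_measurable_rV.
- have [M M0 hM] := continuous_ecball_bound x r cf.
  exists M; split => [|N MN y Ay]; first exact: num_real.
  by apply: le_trans (ltW MN); apply: hM; have := AB _ Ay; rewrite eballE => /ltW.
Qed.

Lemma continuous_integrable_eball f x (r : R) : continuous f ->
  leb.-integrable (eball x r) (EFin \o f).
Proof. by move=> cf; apply: (@continuous_integrable f x r) => //; exact: measurable_eball. Qed.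

(** A quantitative form of compact support, in a closed ball; it keeps track of
    the radii when cutoffs are nested. *)
Definition supported x (r : R) f := forall y, r < enorm (y - x) -> f y = 0.

Lemma supported_pderiv i x (r : R) f : smooth f -> supported x r f -> supported x r (pderiv i f).
Proof.
move=> sf S y; rewrite -subr_gt0 => yr.
have [d d0 hd] := @enorm_lt_ball R n _ yr.
apply/eqP; rewrite -normr_le0; apply/ler_addgt0Pr => e e0; rewrite add0r.
have [t t0 ht] := smooth_near y (smooth_pderiv i sf) e0.
pose h : R := Num.min d t / 2.
have m0 : 0 < Num.min d t by rewrite lt_min d0.
have h0 : 0 < h by rewrite divr_gt0.
have hm : h < Num.min d t by rewrite ltr_pdivrMr// ltr_pMr// ltr1n.
have N s : `|s| <= `|h| -> `|(y + s *: e_ i) - y| < Num.min d t.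
  move=> sh; rewrite addrC addKr normrZ; apply: le_lt_trans hm.
  rewrite -[leRHS]gtr0_norm// -[leRHS]mulr1; apply: ler_pM => //.
  by apply: row_norm_le => // l; rewrite mxE eqxx /=; case: eqP => //; rewrite ?normr1 ?normr0.
have F s : `|s| <= `|h| -> f (y + s *: e_ i) = 0.
  move=> /N; rewrite lt_min => /andP[/hd H _]; apply: S.
  exact: lt_enorm_near H.
have [s sh] := MVT_pderiv i y h sf.
rewrite F// -{1}[y]addr0 -(scale0r (e_ i)) F ?normr0// subrr => /esym/eqP.
rewrite mulf_eq0 gt_eqF//= => /eqP E; have := N s sh; rewrite lt_min => /andP[_ /ht].
by rewrite E sub0r normrN => /ltW.
Qed.

Lemma supportedM x (r : R) f g : supported x r f -> supported x r (fun y => f y * g y).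
Proof. by move=> S y /S ->; rewrite mul0r. Qed.

Lemma supported_patch x (r s : R) f : r < s -> supported x r f -> f = f \_ (eball x s).
Proof.
move=> rs S; apply/funext => y; rewrite patchE; case: ifPn => //; rewrite notin_setE eballE => /negP.
by rewrite -leNgt => ys; apply: S; exact: lt_le_trans ys.
Qed.

Lemma supported_integrable x (r : R) f : continuous f -> supported x r f ->
  leb.-integrable setT (EFin \o f).
Proof.
move=> cf S; have r1 : r < r + 1 by rewrite ltrDl.
rewrite (supported_patch r1 S) -restrict_EFin -integrable_mkcond; last exact: measurable_eball.
exact: continuous_integrable_eball.
Qed.

Lemma supported_Rintegral x (r s : R) f (A : set V) : r < s -> supported x r f -> eball x s `<=` A ->
  \int[leb]_(y in A) f y = \int[leb]_(y in eball x s) f y.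
Proof.
move=> rs S sA; rewrite [LHS]Rintegral_mkcond [RHS]Rintegral_mkcond -(supported_patch rs S).
congr Rintegral; apply/funext => y; rewrite patchE; case: ifPn => //; rewrite notin_setE => nA.
apply/esym/S; apply: lt_le_trans rs _; rewrite leNgt; apply/negP => yA; exact/nA/sA.
Qed.

Lemma is_derive_integral (B : set V) (k dk : R -> V -> R) (G : V -> R) (a : R) :
  measurable B -> (forall t, leb.-integrable B (EFin \o k t)) ->
  leb.-integrable B (EFin \o G) ->
  (forall t y, `|t - a| < 1 -> B y -> is_derive t 1 (fun t => k t y) (dk t y)) ->
  (forall t y, `|t - a| < 1 -> B y -> `|dk t y| <= G y) ->
  is_derive a 1 (fun t => \int[leb]_(y in B) k t y) (\int[leb]_(y in B) dk a y).
Proof.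
move=> mB ik iG Dk bk.
have Ia : `]a - 1, a + 1[%classic a by rewrite /= in_itv/= gtrDl ltrDl oppr_lt0 !ltr01.
have It t : `]a - 1, a + 1[%classic t -> `|t - a| < 1.
  by rewrite /= in_itv/= => /andP[h1 h2]; rewrite ltr_norml; apply/andP; split; lra.
have d1E t y : `|t - a| < 1 -> B y -> partial1of2 k t y = dk t y.
  by move=> ta By; rewrite partial1of2E; have /@derive_val := Dk t y ta By.
have iG' : leb.-integrable B (EFin \o (fun y => `|G y|)) by exact: integrable_norm.
have der : forall t y, `]a - 1, a + 1[%classic t -> B y -> derivable (k ^~ y) t 1.
  by move=> t y /It ta By; have [] := Dk t y ta By.
have bnd : forall t y, `]a - 1, a + 1[%classic t -> B y -> `|partial1of2 k t y| <= `|G y|.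
  by move=> t y /It ta By; rewrite d1E// (le_trans (bk t y ta By))// ler_norm.
apply: DeriveDef.
  exact: (derivable_under_integral mB Ia (fun t _ => ik t) der _ iG' bnd).
rewrite -derive1E (differentiation_under_integral mB Ia (fun t _ => ik t) der _ iG' bnd)//.
by apply: eq_Rintegral => y; rewrite inE => By; rewrite d1E// subrr normr0.
Qed.

Lemma lebesgue_rV_shift (a : V) (A : set V) : measurable A ->
  (1%:E * leb ((fun y => a + 1 *: y)%R @^-1` A) = leb A)%E.
Proof. by move=> mA; rewrite -[in RHS](lebesgue_rV_affine a ltr01 mA) expr1n. Qed.

Lemma Rintegral_shift (a : V) f : leb.-integrable setT (EFin \o f) ->
  \int[leb]_y f (a + 1 *: y) = \int[leb]_y f y.
Proof.
move=> fi; have := Rintegral_quasi ltr01 (@measurable_fun_affine R n a 1)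
  (lebesgue_rV_shift a) measurableT fi.
by rewrite mul1r preimage_setT.
Qed.

Lemma enorm_delta i (s : R) : enorm (s *: e_ i) = `|s|.
Proof.
rewrite enormZ /enorm (bigD1 i)//= big1 => [|j ji]; rewrite !mxE eqxx.
  by rewrite eqxx expr1n addr0 sqrtr1 mulr1.
by rewrite (negPf ji) expr0n.
Qed.

(** The integral of a derivative of a compactly supported function vanishes:
    translating the function along the coordinate does not change its
    integral. *)
Lemma Rintegral_pderiv i f x (r : R) : smooth f -> supported x r f ->
  \int[leb]_y pderiv i f y = 0.
Proof.
move=> sf S; pose k (t : R) y := f (t *: e_ i + 1 *: y).
pose dk (t : R) y := pderiv i f (t *: e_ i + 1 *: y).
have smk t : smooth (k t) by exact: smooth_affine.
have Sk (t : R) : `|t| <= 1 -> supported x (r + 1) (k t).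
  move=> t1 y ry; apply: S; rewrite scale1r.
  have := ler_enorm_triangle (t *: e_ i + y) y x.
  by rewrite opprD addrCA subrr addr0 enormN enorm_delta; lra.
have ik t : leb.-integrable (eball x (r + 2)) (EFin \o k t).
  by apply: continuous_integrable_eball; exact: smooth_continuous.
have r12 : r + 1 < r + 2 by rewrite ltrD2l ltr1n.
have kE t : `|t| <= 1 -> \int[leb]_(y in eball x (r + 2)) k t y = \int[leb]_y f y.
  move=> t1; rewrite -(supported_Rintegral r12 (Sk t t1) (@subsetT _ _)).
  apply: Rintegral_shift; apply: supported_integrable S; exact: smooth_continuous.
have [M M0 hM] := continuous_ecball_bound x (r + 3) (smooth_continuous (smooth_pderiv i sf)).
have D : is_derive (0 : R) 1 (fun t => \int[leb]_(y in eball x (r + 2)) k t y)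
    (\int[leb]_(y in eball x (r + 2)) dk 0 y).
  apply: (@is_derive_integral _ k dk (fun=> M)) => //.
  - exact: measurable_eball.
  - by apply: continuous_integrable_eball; exact: continuous_cst_rV.
  - move=> t y _ _; apply: is_derive_lineC; exact: smooth_is_derive.
  - move=> t y; rewrite subr0 eballE => t1 yr; apply: hM; rewrite scale1r -addrA.
    by rewrite (le_trans (ler_enormD _ _))// enorm_delta; lra.
have Dc : is_derive (0 : R) 1 (fun t => \int[leb]_(y in eball x (r + 2)) k t y) 0.
  apply: is_derive_epsP => e e0; exists 1 => // h _ h1.
  rewrite addr0 [h%:A]mulr1 (kE h (ltW h1)) kE ?normr0 ?ler01//.
  by rewrite subrr mulr0 subrr normr0; exact: ltW.
have -> : \int[leb]_y pderiv i f y = \int[leb]_(y in eball x (r + 2)) dk 0 y.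
  have r2 : r < r + 2 by rewrite ltrDl.
  rewrite (supported_Rintegral r2 (supported_pderiv i sf S) (@subsetT _ _)).
  by apply: eq_Rintegral => y _; rewrite /dk scale0r add0r scale1r.
by rewrite -(@derive_val _ _ _ _ _ _ _ D) (@derive_val _ _ _ _ _ _ _ Dc).
Qed.

Lemma Rintegral_by_parts i f g x (r : R) : smooth f -> smooth g -> supported x r f ->
  \int[leb]_y (f y * pderiv i g y) = - \int[leb]_y (pderiv i f y * g y).
Proof.
move=> sf sg S; have /(_ (supportedM _ S)) := @Rintegral_pderiv i _ x r (smoothM sf sg).
rewrite (smooth_pderivM i sf sg).
have c1 : continuous (fun y => f y * pderiv i g y).
  exact: (continuousM_rV (smooth_continuous sf) (smooth_continuous (smooth_pderiv i sg))).
have c2 : continuous (fun y => pderiv i f y * g y).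
  exact: (continuousM_rV (smooth_continuous (smooth_pderiv i sf)) (smooth_continuous sg)).
have i1 := supported_integrable c1 (supportedM _ S).
have i2 := supported_integrable c2 (supportedM _ (supported_pderiv i sf S)).
under eq_Rintegral do rewrite [g _ * _]mulrC.
by rewrite RintegralD// => /eqP; rewrite addr_eq0 => /eqP.
Qed.

End integrals_rV.

(** * Bump functions *)

Section exponential_cutoff.
Context (R : realType).
Implicit Types (p q : {poly R}) (t : R).

(** The derivatives of [exp (-1/t)] for [t > 0] are polynomials in [1/t] times
    the function itself; indexing the extensions by zero with the polynomial
    makes the family stable under differentiation. *)
Definition flat_exp p t : R := if 0 < t then p.[t^-1] * expR (- t^-1) else 0.

Definition flat_exp_next p : {poly R} := 'X^2 * (p - p^`()).

Lemma horner_growth p : exists2 C, 0 <= C &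
  forall y, 1 <= y -> `|p.[y]| <= C * y ^+ (size p).
Proof.
exists (\sum_(i < size p) `|p`_i|); first exact: sumr_ge0.
move=> y y1; rewrite horner_coef mulr_suml; apply: le_trans (ler_norm_sum _ _ _) _.
apply: ler_sum => i _; rewrite normrM ler_wpM2l// normrX ger0_norm; last lra.
by apply: ler_weXn2l => //; exact: ltnW.
Qed.

(** The exponential series dominates every power of [t^-1]. *)
Lemma flat_exp_small p e : 0 < e -> exists2 d, 0 < d &
  forall t, 0 < t -> t < d -> `|p.[t^-1] * expR (- t^-1)| <= e.
Proof.
move=> e0; have [C C0 hC] := horner_growth p; set m := size p in hC.
pose K := (C + 1) * m.+1`!%:R; have f0 : 0 < m.+1`!%:R :> R by rewrite ltr0n fact_gt0.
have K0 : 0 < K by rewrite mulr_gt0// ltr_wpDl.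
exists (Num.min 1 (e / K)); first by rewrite lt_min ltr01 divr_gt0.
move=> t t0; rewrite lt_min => /andP[t1 te].
have y1 : 1 <= t^-1 by rewrite invf_ge1// ltW.
have y0 : 0 < t^-1 by rewrite invr_gt0.
rewrite normrM (ger0_norm (expR_ge0 _)) expRN.
apply: (@le_trans _ _ (C * t^-1 ^+ m * (t^-1 ^+ m.+1 / m.+1`!%:R)^-1)).
  apply: ler_pM; rewrite ?invr_ge0 ?expR_ge0//; first exact: hC.
  rewrite lef_pV2 ?posrE ?expR_gt0 ?divr_gt0 ?exprn_gt0//.
  by apply: le_trans (expR_ge1Dxn m (ltW y0)); rewrite lerDr.
rewrite invf_div exprS invfM invrK mulrACA [t * _]mulrC mulrA.
rewrite [C * _ * _ * _](_ : _ = C * m.+1`!%:R * t); last first.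
  by field; rewrite !expf_neq0 ?invr_neq0 ?gt_eqF.
apply: (@le_trans _ _ (K * t)).
  by rewrite ler_wpM2r ?(ltW t0)// ler_wpM2r ?(ltW f0)// lerDl.
by rewrite mulrC -ler_pdivlMr// ltW.
Qed.

Lemma is_derive_flat_exp p t : is_derive t 1 (flat_exp p) (flat_exp (flat_exp_next p) t).
Proof.
case: (ltgtP 0 t) => [t0|t0|<-].
- have H : is_derive t 1 (fun x => p.[x^-1] * expR (- x^-1)) (flat_exp (flat_exp_next p) t).
    have tn : t != 0 by rewrite gt_eqF.
    have D1 : is_derive t 1 (fun x : R => x^-1) (- t ^- 2 *: 1) by exact: is_deriveV.
    have D2 : is_derive t 1 (fun x => p.[x^-1]) (p^`().[t^-1] * (- t ^- 2 *: 1)).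
      exact: (@is_derive1_comp R (horner p) (fun x => x^-1)).
    have D3 : is_derive t 1 (fun x => expR (- x^-1)) (expR (- t^-1) * (- (- t ^- 2 *: 1))).
      have De : is_derive (- t^-1) 1 (@expR R) (expR (- t^-1)).
        apply: DeriveDef; first exact: derivable_expR.
        exact: (congr1 (fun f => f (- t^-1)) (derive_expR R)).
      exact: (@is_derive1_comp R expR (fun x => - x^-1) t _ _ De (is_deriveN D1)).
    apply: is_derive_eq (is_deriveM D2 D3) _.
    rewrite /flat_exp t0 /flat_exp_next !hornerE /= -![_ *: _]/(_ * _) exprVn; ring.
  apply: near_eq_is_derive H.
  apply/nbhs_ballP; exists t => //= x; rewrite /ball /= ltr_norml => /andP[_ xt].
  by rewrite /flat_exp (_ : 0 < x)//; lra.
- have H : is_derive t 1 (cst 0) (flat_exp (flat_exp_next p) t).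
    by rewrite /flat_exp ltNge (ltW t0)/=; exact: is_derive_cst.
  apply: near_eq_is_derive H.
  apply/nbhs_ballP; exists (- t); first by rewrite /= oppr_gt0.
  move=> x; rewrite /ball /= ltr_norml => /andP[xt _].
  by rewrite /flat_exp (_ : (0 < x) = false)//; apply/negbTE; rewrite -leNgt; lra.
- rewrite {2}/flat_exp ltxx; apply: is_derive_epsP => e e0.
  have [d d0 hd] := flat_exp_small ('X * p) e0; exists d => // h h0 hlt.
  rewrite [h%:A]mulr1 addr0 subr0 /flat_exp ltxx subr0.
  case: ltP => hh; last by rewrite mulr0 normr0 ltW.
  by have := hd h hh; rewrite hornerM hornerX mulrA; apply; rewrite gtr0_norm in hlt.
Qed.

Lemma continuous_flat_exp p : continuous (flat_exp p).
Proof.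
move=> t; apply: differentiable_continuous; apply/derivable1_diffP.
by have [] := is_derive_flat_exp p t.
Qed.

Lemma flat_exp1_gt0 t : 0 < t -> 0 < flat_exp 1 t.
Proof. by move=> t0; rewrite /flat_exp t0 hornerE mul1r expR_gt0. Qed.

Lemma flat_exp1_ge0 t : 0 <= flat_exp 1 t.
Proof. by rewrite /flat_exp; case: ltP => // _; rewrite hornerE mul1r expR_ge0. Qed.

Lemma flat_exp1_le s t : s <= t -> flat_exp 1 s <= flat_exp 1 t.
Proof.
rewrite {1}/flat_exp; case: ltP => [s0 st|_ _]; last exact: flat_exp1_ge0.
have t0 := lt_le_trans s0 st.
by rewrite /flat_exp t0 !hornerE ler_expR lerN2 lef_pV2.
Qed.

End exponential_cutoff.

Section bumps.
Context (R : realType) (n : nat).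
Local Notation V := 'rV[R]_n.
Local Notation e_ i := (delta_mx ord0 i : V).
Implicit Types (f g w : V -> R) (x y : V).

Lemma is_derive_comp_rV (G : R -> R) w x v (a b : R) : is_derive (w x) 1 G a ->
  is_derive x v w b -> is_derive x v (fun y => G (w y)) (a * b).
Proof.
move=> DG Dw.
have D1 : is_derive (0 : R) 1 (fun t => w (t *: v + x)) b.
  by apply: is_derive_lineC; rewrite scale0r add0r.
have D2 : is_derive ((fun t => w (t *: v + x)) 0) 1 G a by rewrite scale0r add0r.
have [dG dE] := @is_derive1_comp R _ _ _ _ _ D2 D1.
apply: DeriveDef; first exact/derivable1P.
by rewrite derive_line -dE.
Qed.

Inductive flat_closure : (V -> R) -> Prop :=
| flat_closure_base f of smooth f : flat_closure f
| flat_closure_comp p w of smooth w : flat_closure (fun x => flat_exp p (w x))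
| flat_closureD f g of flat_closure f & flat_closure g :
    flat_closure (fun x => f x + g x)
| flat_closureM f g of flat_closure f & flat_closure g :
    flat_closure (fun x => f x * g x).

Lemma is_derive_flat_comp p w i x : smooth w ->
  is_derive x (e_ i) (fun x => flat_exp p (w x))
    (flat_exp (flat_exp_next p) (w x) * pderiv i w x).
Proof.
move=> sw; apply: is_derive_comp_rV; first exact: is_derive_flat_exp.
exact: smooth_is_derive.
Qed.

Lemma pderiv_flat_comp p w i : smooth w ->
  pderiv i (fun x => flat_exp p (w x)) =
  (fun x => flat_exp (flat_exp_next p) (w x) * pderiv i w x).
Proof.
move=> sw; apply/funext => x; apply: is_derive_pderivE; exact: is_derive_flat_comp.
Qed.

Lemma smooth_flat_comp p w : smooth w -> smooth (fun x => flat_exp p (w x)).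
Proof.
move=> sw; apply: (@smooth_coind _ _ flat_closure); last exact: flat_closure_comp.
move=> {p w sw} f; elim => {f} [f sf|p w sw|f g Cf [cf hf] Cg [cg hg]|f g Cf [cf hf] Cg [cg hg]].
- split; first exact: smooth_continuous.
  move=> i; split; first by move=> x; exact: smooth_derivable.
  by apply: flat_closure_base; exact: smooth_pderiv.
- split.
    by apply: continuous_comp_rV; [exact: continuous_flat_exp|exact: smooth_continuous].
  move=> i; split; first by move=> x; have [] := is_derive_flat_comp p i x sw.
  rewrite pderiv_flat_comp//; apply: flat_closureM; first exact: flat_closure_comp.
  by apply: flat_closure_base; exact: smooth_pderiv.
- split; first exact: continuousD_rV.
  move=> i; have [df Sf] := hf i; have [dg Sg] := hg i; split.
    by move=> x; apply: derivableD.
  by rewrite pderivD//; exact: flat_closureD.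
- split; first exact: continuousM_rV.
  move=> i; have [df Sf] := hf i; have [dg Sg] := hg i; split.
    by move=> x; apply: derivableM.
  by rewrite pderivM//; apply: flat_closureD; exact: flat_closureM.
Qed.

Definition gap (r : R) x : R := r ^+ 2 - \sum_i x ord0 i * x ord0 i.

Lemma smooth_gap r : smooth (gap r).
Proof.
apply: (smoothB (@smooth_cst R n (r ^+ 2))).
apply: (@smooth_sum R n _ _ (fun i x => x ord0 i * x ord0 i)) => i.
exact: (smoothM (@smooth_coord R n i) (@smooth_coord R n i)).
Qed.

Lemma pderiv_gap r i x : pderiv i (gap r) x = - (2 * x ord0 i).
Proof.
have s1 := @smooth_cst R n (r ^+ 2).
have s2 j : smooth (fun x : V => x ord0 j * x ord0 j).
  exact: (smoothM (@smooth_coord R n j) (@smooth_coord R n j)).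
have s3 : smooth (fun x : V => \sum_i x ord0 i * x ord0 i).
  exact: (@smooth_sum R n _ _ (fun i x => x ord0 i * x ord0 i)).
rewrite /gap (smooth_pderivB i s1 s3) pderiv_cst sub0r; congr (- _).
rewrite (@smooth_pderiv_sum R n i _ _ (fun i x => x ord0 i * x ord0 i))//.
rewrite (bigD1 i)//= big1 ?addr0 => [|j ji];
  rewrite (smooth_pderivM i (@smooth_coord R n _) (@smooth_coord R n _)) pderiv_coord.
  by rewrite eqxx mulr1 -mulr2n mulr_natl.
by rewrite eq_sym (negPf ji) !mulr0 addr0.
Qed.

Lemma gapE r x : gap r x = r ^+ 2 - enorm x ^+ 2.
Proof. by rewrite enorm_sqr /gap; congr (_ - _); apply: eq_bigr => i _; rewrite expr2. Qed.

Lemma gapN r x : gap r (- x) = gap r x.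
Proof. by rewrite !gapE enormN. Qed.

Lemma gap_le0 r x : 0 <= r -> r <= enorm x -> gap r x <= 0.
Proof.
move=> r0 rx; rewrite gapE subr_le0 ler_pXn2r ?nnegrE ?enorm_ge0//.
Qed.

Lemma gap_gt0 r x : enorm x < r -> 0 < gap r x.
Proof.
move=> xr; rewrite gapE subr_gt0 ltr_pXn2r ?nnegrE ?enorm_ge0//.
exact: le_trans (enorm_ge0 x) (ltW xr).
Qed.

Definition rbump (r : R) x := flat_exp 1 (gap r x).

(** Minus the gradient of [rbump r] at [x] is [bump_slope r x *: x], see
    [pderiv_bump]; this makes [bump_slope] the natural averaging kernel for the
    mean value property. *)
Definition bump_slope (r : R) x := 2 * flat_exp 'X^2 (gap r x).

Lemma smooth_bump r : smooth (rbump r).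
Proof. exact: smooth_flat_comp (smooth_gap r). Qed.

Lemma smooth_bump_slope r : smooth (bump_slope r).
Proof. by apply: smoothZ; exact: smooth_flat_comp (smooth_gap r). Qed.

Lemma bump_ge0 r x : 0 <= rbump r x. Proof. exact: flat_exp1_ge0. Qed.

Lemma bump_gt0 r x : enorm x < r -> 0 < rbump r x.
Proof. by move=> xr; apply/flat_exp1_gt0/gap_gt0. Qed.

Lemma bump_out r x : 0 <= r -> r <= enorm x -> rbump r x = 0.
Proof. by move=> r0 rx; rewrite /rbump /flat_exp ltNge gap_le0. Qed.

Lemma bump_slope_out r x : 0 <= r -> r <= enorm x -> bump_slope r x = 0.
Proof. by move=> r0 rx; rewrite /bump_slope /flat_exp ltNge gap_le0//= mulr0. Qed.

Lemma bump_slope_gt0 r x : enorm x < r -> 0 < bump_slope r x.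
Proof.
move=> xr; rewrite /bump_slope /flat_exp gap_gt0// mulr_gt0// mulr_gt0 ?expR_gt0//.
by rewrite hornerXn exprn_gt0// invr_gt0 gap_gt0.
Qed.

Lemma bump_slope_ge0 r x : 0 <= r -> 0 <= bump_slope r x.
Proof.
move=> r0; have [xr|rx] := ltP (enorm x) r; first exact/ltW/bump_slope_gt0.
by rewrite bump_slope_out.
Qed.

Lemma bumpN r x : rbump r (- x) = rbump r x.
Proof. by rewrite /rbump gapN. Qed.

Lemma supported_bump r : 0 <= r -> supported 0 r (rbump r).
Proof. by move=> r0 y /ltW; rewrite subr0; exact: bump_out. Qed.

Lemma supported_bump_slope r : 0 <= r -> supported 0 r (bump_slope r).
Proof. by move=> r0 y /ltW; rewrite subr0; exact: bump_slope_out. Qed.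

Lemma pderiv_bump r i : pderiv i (rbump r) = (fun x => - (x ord0 i * bump_slope r x)).
Proof.
apply/funext => x; rewrite /rbump (pderiv_flat_comp _ _ (smooth_gap r)) pderiv_gap.
by rewrite /flat_exp_next derivC subr0 mulr1 /bump_slope; ring.
Qed.

Lemma bump_lower_bound (r s : R) : 0 <= s < r ->
  exists2 c, 0 < c & forall x, enorm x <= s -> c <= rbump r x.
Proof.
move=> /andP[s0 sr]; exists (flat_exp 1 (r ^+ 2 - s ^+ 2)).
  by apply: flat_exp1_gt0; rewrite subr_gt0 ltr_pXn2r ?nnegrE//; exact: le_trans s0 (ltW sr).
move=> x xs; apply: flat_exp1_le; rewrite gapE lerD2l lerN2 ler_pXn2r ?nnegrE ?enorm_ge0//.
Qed.

End bumps.

(** * Square-integrable functions *)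

Section square_integrable.
Context (R : realType) (n : nat).
Local Notation V := 'rV[R]_n.
Local Notation leb := (lebesgue_rV R n).
Implicit Types (f g h : V -> R) (A B : set V).

Lemma integrable_RZ A (c : R) f : measurable A -> leb.-integrable A (EFin \o f) ->
  leb.-integrable A (EFin \o (fun x => c * f x)).
Proof. by move=> mA fi; exact: (integrableZl mA c fi). Qed.

Lemma integrable_RD A f g : measurable A -> leb.-integrable A (EFin \o f) ->
  leb.-integrable A (EFin \o g) -> leb.-integrable A (EFin \o (fun x => f x + g x)).
Proof. by move=> mA fi gi; exact: (integrableD mA fi gi). Qed.

Lemma integrable_RB A f g : measurable A -> leb.-integrable A (EFin \o f) ->
  leb.-integrable A (EFin \o g) -> leb.-integrable A (EFin \o (fun x => f x - g x)).
Proof. by move=> mA fi gi; exact: (integrableB mA fi gi). Qed.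

Definition sq_integrable A f :=
  measurable_fun A f /\ leb.-integrable A (EFin \o (fun x => f x ^+ 2)).

Definition sqint A f : R := \int[leb]_(x in A) (f x ^+ 2).

Lemma sqint_ge0 A f : 0 <= sqint A f.
Proof. by apply: Rintegral_ge0 => x _; exact: sqr_ge0. Qed.

Lemma sq_integrable_continuous A f x r : continuous f -> measurable A ->
  A `<=` eball x r -> sq_integrable A f.
Proof.
move=> cf mA AB; split; first by apply: measurable_funTS; exact: continuous_measurable_rV.
by apply: (continuous_integrable (x := x) (r := r)) => //; exact: continuousM_rV.
Qed.

Lemma sq_integrable_prod A f g : measurable A -> sq_integrable A f -> sq_integrable A g ->
  leb.-integrable A (EFin \o (fun x => f x * g x)).
Proof.
move=> mA [mf f2] [mg g2].
apply: (le_integrable mA _ _ (integrableD mA f2 g2)).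
  by apply/measurable_EFinP; exact: measurable_funM.
move=> x _ /=; rewrite lee_fin.
rewrite [leRHS]ger0_norm ?addr_ge0 ?sqr_ge0// ler_norml.
by apply/andP; split; [have := sqr_ge0 (f x + g x)|have := sqr_ge0 (f x - g x)];
  have := sqr_ge0 (f x); have := sqr_ge0 (g x); lra.
Qed.

Lemma sq_integrableZ A (c : R) f : measurable A -> sq_integrable A f -> sq_integrable A (fun x => c * f x).
Proof.
move=> mA [mf f2]; split; first exact: measurable_funM.
rewrite (_ : (fun x => _) = (fun x => c ^+ 2 * f x ^+ 2)); first exact: integrable_RZ.
by apply/funext => x; rewrite exprMn.
Qed.

Lemma sq_integrableD A f g : measurable A -> sq_integrable A f -> sq_integrable A g ->
  sq_integrable A (fun x => f x + g x).
Proof.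
move=> mA Sf Sg; have [mf f2] := Sf; have [mg g2] := Sg; split; first exact: measurable_funD.
have fg := sq_integrable_prod mA Sf Sg.
rewrite (_ : (fun x => _) = (fun x => f x ^+ 2 + 2 * (f x * g x) + g x ^+ 2)).
  by apply: integrable_RD => //; apply: integrable_RD => //; exact: integrable_RZ.
by apply/funext => x; rewrite sqrrD mulr_natl.
Qed.

Lemma sq_integrableB A f g : measurable A -> sq_integrable A f -> sq_integrable A g ->
  sq_integrable A (fun x => f x - g x).
Proof.
move=> mA Sf Sg; rewrite (_ : (fun _ => _) = fun x => f x + (-1) * g x).
  by apply: sq_integrableD => //; exact: sq_integrableZ.
by apply/funext => x; rewrite mulN1r.
Qed.

Lemma sq_integrable_cst A (c : R) : measurable A -> (leb A < +oo)%E -> sq_integrable A (fun=> c).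
Proof.
move=> mA Aoo; split => //; apply: measurable_bounded_integrable => //.
exists (c ^+ 2); split; first exact: num_real.
by move=> M /ltW cM y _ /=; rewrite ger0_norm// sqr_ge0.
Qed.

Lemma sq_integrable_integrable A f : measurable A -> (leb A < +oo)%E ->
  sq_integrable A f -> leb.-integrable A (EFin \o f).
Proof.
move=> mA Aoo Sf; have := sq_integrable_prod mA (sq_integrable_cst 1 mA Aoo) Sf.
by under [X in _ (EFin \o X)]eq_fun do rewrite mul1r.
Qed.

Lemma sq_integrableS A B f : measurable A -> measurable B -> A `<=` B ->
  sq_integrable B f -> sq_integrable A f.
Proof.
move=> mA mB AB [mf f2]; split; first exact: measurable_funS mf.
exact: integrableS f2.
Qed.

Lemma sqintS A B f : measurable A -> measurable B -> A `<=` B ->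
  sq_integrable B f -> sqint A f <= sqint B f.
Proof.
move=> mA mB AB Sf; have [mf f2] := Sf; rewrite /sqint /Rintegral.
have [mfA f2A] := sq_integrableS mA mB AB Sf.
apply: fine_le; [exact: integrable_fin_num|exact: integrable_fin_num|].
apply: ge0_subset_integral => //; first exact: measurable_int f2.
by move=> x _; rewrite lee_fin sqr_ge0.
Qed.

Lemma eq_sqint A f g : (forall x, A x -> f x = g x) -> sqint A f = sqint A g.
Proof. by move=> fg; apply: eq_Rintegral => x; rewrite inE => /fg ->. Qed.

Lemma sqintZ A (c : R) f : measurable A -> sq_integrable A f ->
  sqint A (fun x => c * f x) = c ^+ 2 * sqint A f.
Proof.
move=> mA [_ f2]; rewrite /sqint -RintegralZl//.
by apply: eq_Rintegral => x _; rewrite exprMn.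
Qed.

Lemma sqint_le_comb A f g h (a b : R) : measurable A -> sq_integrable A f ->
  sq_integrable A g -> sq_integrable A h ->
  (forall x, A x -> f x ^+ 2 <= a * g x ^+ 2 + b * h x ^+ 2) ->
  sqint A f <= a * sqint A g + b * sqint A h.
Proof.
move=> mA [_ f2] [_ g2] [_ h2] H.
have ag : leb.-integrable A (EFin \o (fun x => a * g x ^+ 2)) by exact: integrable_RZ.
have bh : leb.-integrable A (EFin \o (fun x => b * h x ^+ 2)) by exact: integrable_RZ.
rewrite -(RintegralZl a mA g2) -(RintegralZl b mA h2) -(RintegralD mA ag bh).
by apply: le_Rintegral => //; exact: integrable_RD.
Qed.

Lemma sqintD_le A f g : measurable A -> sq_integrable A f -> sq_integrable A g ->
  sqint A (fun x => f x + g x) <= 2 * sqint A f + 2 * sqint A g.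
Proof.
move=> mA Sf Sg; apply: sqint_le_comb => //; first exact: sq_integrableD.
by move=> x _; have := sqr_ge0 (f x - g x); lra.
Qed.

Lemma sqintB_le A f g : measurable A -> sq_integrable A f -> sq_integrable A g ->
  sqint A (fun x => f x - g x) <= 2 * sqint A f + 2 * sqint A g.
Proof.
move=> mA Sf Sg; apply: sqint_le_comb => //; first exact: sq_integrableB.
by move=> x _; have := sqr_ge0 (f x + g x); lra.
Qed.

Lemma sqint_triangle A f g h : measurable A -> sq_integrable A f -> sq_integrable A g ->
  sq_integrable A h ->
  sqint A (fun x => f x - h x) <= 2 * sqint A (fun x => f x - g x) + 2 * sqint A (fun x => g x - h x).
Proof.
move=> mA Sf Sg Sh; apply: sqint_le_comb => //; [exact: sq_integrableB..|].
by move=> x _; have := sqr_ge0 (f x - g x - (g x - h x)); lra.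
Qed.

(** Young's inequality: unlike the Cauchy-Schwarz inequality it involves no
    square root, and the weight [a] can be chosen to absorb one of the terms. *)
Lemma Rintegral_prod_le A f g (a : R) : measurable A -> 0 < a ->
  sq_integrable A f -> sq_integrable A g ->
  `|\int[leb]_(x in A) (f x * g x)| <= a / 2 * sqint A f + a^-1 / 2 * sqint A g.
Proof.
move=> mA a0 Sf Sg; have fg := sq_integrable_prod mA Sf Sg.
have [_ f2] := Sf; have [_ g2] := Sg.
have i1 : leb.-integrable A (EFin \o (fun x => a / 2 * f x ^+ 2)) by exact: integrable_RZ.
have i2 : leb.-integrable A (EFin \o (fun x => a^-1 / 2 * g x ^+ 2)) by exact: integrable_RZ.
apply: le_trans (le_normr_Rintegral mA fg) _.
rewrite -(RintegralZl _ mA f2) -(RintegralZl _ mA g2) -(RintegralD mA i1 i2).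
apply: le_Rintegral => //; first exact: integrable_norm.
  exact: integrable_RD.
move=> x _; have ai : 0 < a^-1 by rewrite invr_gt0.
rewrite normrM -(real_normK (num_real (f x))) -(real_normK (num_real (g x))).
set F := `|f x|; set G := `|g x|.
have -> : a / 2 * F ^+ 2 + a^-1 / 2 * G ^+ 2 = a^-1 / 2 * (a * F - G) ^+ 2 + F * G.
  by field; rewrite gt_eqF.
by rewrite lerDr mulr_ge0 ?sqr_ge0// divr_ge0// ltW.
Qed.

(** Young's inequality against the constant 1, with the optimal weight; the
    degenerate cases, where that weight is undefined, are treated apart. *)
Lemma Rintegral_sqr_le A f : measurable A -> (leb A < +oo)%E -> sq_integrable A f ->
  (\int[leb]_(x in A) f x) ^+ 2 <= fine (leb A) * sqint A f.
Proof.
move=> mA Aoo Sf; have fi := sq_integrable_integrable mA Aoo Sf.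
have S1 := sq_integrable_cst 1 mA Aoo; have [_ i1] := S1; have [_ f2] := Sf.
set m := fine (leb A); set I := \int[leb]_(x in A) f x.
have m0 : 0 <= m by exact: fine_ge0.
have I1 : sqint A (fun=> 1) = m.
  by rewrite /sqint Rintegral_cst// expr1n mul1r.
have key (t : R) : 0 < t -> `|I| <= t / 2 * m + t^-1 / 2 * sqint A f.
  move=> t0; have := Rintegral_prod_le mA t0 S1 Sf.
  by under eq_Rintegral do rewrite mul1r; rewrite I1.
have [mz|mp] := eqVneq m 0.
  have : `|I| <= 0.
    apply/ler_addgt0Pr => e e0; rewrite add0r.
    have t0 : 0 < (sqint A f + 1) / e by rewrite divr_gt0// ltr_wpDl// sqint_ge0.
    apply: le_trans (key _ t0) _; rewrite mz mulr0 add0r invf_div.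
    rewrite mulrAC ler_pdivrMr// mulrAC ler_pdivrMr; last by rewrite ltr_wpDl// sqint_ge0.
    rewrite mulrAC -mulrA ler_wpM2l ?(ltW e0)//; have := sqint_ge0 A f; lra.
  by rewrite normr_le0 mz mul0r => /eqP ->; rewrite expr0n.
have mp0 : 0 < m by rewrite lt_def mp.
have [Iz|Ip] := eqVneq I 0; first by rewrite Iz expr0n mulr_ge0// sqint_ge0.
have t0 : 0 < `|I| / m by rewrite divr_gt0 ?normr_gt0.
have I0 : 0 < `|I| by rewrite normr_gt0.
have := key _ t0; rewrite invf_div -(real_normK (num_real I)).
move=> /(ler_wpM2l (ltW I0)); rewrite mulrDr.
have -> : `|I| * (`|I| / m / 2 * m) = `|I| ^+ 2 / 2 by field; rewrite gt_eqF.
have -> : `|I| * (m / `|I| / 2 * sqint A f) = m * sqint A f / 2.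
  by field; rewrite gt_eqF.
by rewrite -expr2; lra.
Qed.

Lemma Rintegral_norm_sqr_le A f : measurable A -> (leb A < +oo)%E -> sq_integrable A f ->
  (\int[leb]_(x in A) `|f x|) ^+ 2 <= fine (leb A) * sqint A f.
Proof.
move=> mA Aoo [mf f2].
have E : (fun x => `|f x| ^+ 2) = (fun x => f x ^+ 2).
  by apply/funext => x; rewrite real_normK// num_real.
have Sn : sq_integrable A (fun x => `|f x|).
  by split; [exact: measurableT_comp|rewrite E].
by have := Rintegral_sqr_le mA Aoo Sn; rewrite /sqint E.
Qed.

Lemma integrable_fin_sum (I : finType) A (F : I -> V -> R) : measurable A ->
  (forall i, leb.-integrable A (EFin \o F i)) ->
  leb.-integrable A (EFin \o (fun x => \sum_i F i x)).
Proof.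
move=> mA iF; rewrite (_ : EFin \o _ = (fun x => \sum_i (EFin \o F i) x)%E).
  exact: integrable_sum.
by apply/funext => x /=; rewrite sumEFin.
Qed.

Lemma Rintegral_sum (I : finType) A (F : I -> V -> R) : measurable A ->
  (forall i, leb.-integrable A (EFin \o F i)) ->
  \int[leb]_(x in A) (\sum_i F i x) = \sum_i \int[leb]_(x in A) F i x.
Proof.
move=> mA iF; elim: (index_enum I) => [|i s IH].
  by under eq_Rintegral do rewrite big_nil; rewrite big_nil Rintegral_cst// mul0r.
under eq_Rintegral do rewrite big_cons.
rewrite big_cons -IH RintegralD//.
rewrite (_ : EFin \o _ = (fun x => \sum_(i <- s) (EFin \o F i) x)%E).
  exact: integrable_sum.
by apply/funext => x /=; rewrite sumEFin.
Qed.

End square_integrable.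

(** * Integral identities with a cutoff *)

Section derivative_rules.
Context (R : realType) (n : nat).
Local Notation V := 'rV[R]_n.
Local Notation e_ i := (delta_mx ord0 i : V).
Implicit Types (f g : V -> R) (x v : V).

Lemma is_deriveB_rV f g x v (a b : R) : is_derive x v f a -> is_derive x v g b ->
  is_derive x v (fun y => f y - g y) (a - b).
Proof. by move=> Df Dg; exact: (is_deriveB Df Dg). Qed.

Lemma is_deriveM_rV f g x v (a b : R) : is_derive x v f a -> is_derive x v g b ->
  is_derive x v (fun y => f y * g y) (f x * b + g x * a).
Proof. by move=> Df Dg; exact: (is_deriveM Df Dg). Qed.

Lemma is_deriveZ_rV f x v (c a : R) : is_derive x v f a ->
  is_derive x v (fun y => c * f y) (c * a).
Proof. by move=> Df; exact: (is_deriveZ c Df). Qed.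

Lemma smoothX2 f : smooth f -> smooth (fun x => f x ^+ 2).
Proof. by move=> sf; exact: (smoothM sf sf). Qed.

Lemma smooth_laplacian f : smooth f -> smooth (laplacian f).
Proof.
move=> sf; apply: (@smooth_sum R n _ _ (fun i => pderiv i (pderiv i f))) => i.
by do 2 apply: smooth_pderiv.
Qed.

End derivative_rules.

Section interior_estimates.
Context (R : realType) (n : nat).
Local Notation V := 'rV[R]_n.
Local Notation leb := (lebesgue_rV R n).
Local Notation e_ i := (delta_mx ord0 i : V).
Implicit Types (f g v z : V -> R) (x y : V).

Lemma smooth_integrable f x (r : R) : smooth f -> leb.-integrable (eball x r) (EFin \o f).
Proof. by move=> sf; apply: continuous_integrable_eball; exact: smooth_continuous. Qed.

Lemma smooth_sq_integrable f x (r : R) : smooth f -> sq_integrable (eball x r) f.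
Proof.
move=> sf; apply: (@sq_integrable_continuous R n _ f x r) => //.
  exact: smooth_continuous.
exact: measurable_eball.
Qed.

Lemma Rintegral_continuous_gt0 f x (r : R) : 0 < r -> continuous f ->
  (forall y, 0 <= f y) -> 0 < f x -> 0 < \int[leb]_(y in eball x r) f y.
Proof.
move=> r0 cf f0 fx; have f2 : 0 < f x / 2 by rewrite divr_gt0.
have /continuous_rVP/(_ x _ f2)[d d0 hd] := cf.
pose s := Num.min d r; have s0 : 0 < s by rewrite lt_min d0.
have fs : leb.-integrable (eball x r) (EFin \o f) by exact: continuous_integrable_eball.
have [mB mS] := (@measurable_eball R n x r, @measurable_eball R n x s).
have sr : eball x s `<=` eball x r by apply: subset_eball; rewrite ge_min lexx orbT.
apply: (@lt_le_trans _ _ (\int[leb]_(y in eball x s) (f x / 2))).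
  rewrite Rintegral_cst// mulr_gt0//.
  have -> : fine (leb (eball x s)) = s ^+ n * unit_ball_volume R n by rewrite (lebesgue_eball x s0).
  rewrite mulr_gt0 ?exprn_gt0//.
  exact: unit_ball_volume_gt0.
apply: (@le_trans _ _ (\int[leb]_(y in eball x s) f y)).
  apply: le_Rintegral => //.
  - by apply: continuous_integrable_eball; exact: continuous_cst_rV.
  - exact: integrableS fs.
  - move=> y; rewrite eballE => ys; have : `|y - x| < d.
      by apply: le_lt_trans (normr_le_enorm _) _; apply: lt_le_trans ys _; rewrite ge_min lexx.
    by move=> /hd; rewrite ltr_norml => /andP[+ _]; lra.
rewrite /Rintegral; apply: fine_le.
- by apply: integrable_fin_num => //; exact: integrableS fs.
- exact: integrable_fin_num.
apply: ge0_subset_integral => //; first exact: measurable_int fs.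
by move=> y _; rewrite lee_fin.
Qed.

Lemma Rintegral_divergence (I : finType) (idx : I -> 'I_n) (F : I -> V -> R) x (r s : R) :
  r < s -> (forall k, smooth (F k)) -> (forall k, supported x r (F k)) ->
  \int[leb]_(y in eball x s) (\sum_k pderiv (idx k) (F k) y) = 0.
Proof.
move=> rs sF SF; rewrite Rintegral_sum; last 2 first.
- exact: measurable_eball.
- by move=> k; apply: smooth_integrable; exact: smooth_pderiv.
apply: big1 => k _.
rewrite -(supported_Rintegral rs (supported_pderiv (idx k) (sF k) (SF k)) (@subsetT _ _)).
exact: Rintegral_pderiv (SF k).
Qed.

Definition grad_sq v x : R := \sum_i pderiv i v x ^+ 2.
Definition hess_sq v x : R := \sum_i \sum_j pderiv j (pderiv i v) x ^+ 2.

Lemma smooth_grad_sq v : smooth v -> smooth (grad_sq v).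
Proof.
move=> sv; apply: (@smooth_sum R n _ _ (fun i x => pderiv i v x ^+ 2)) => i.
by apply: smoothX2; exact: smooth_pderiv.
Qed.

Lemma smooth_hess_sq v : smooth v -> smooth (hess_sq v).
Proof.
move=> sv; apply: (@smooth_sum R n _ _ (fun i x => \sum_j pderiv j (pderiv i v) x ^+ 2)) => i.
apply: (@smooth_sum R n _ _ (fun j x => pderiv j (pderiv i v) x ^+ 2)) => j.
by apply: smoothX2; do 2 apply: smooth_pderiv.
Qed.

Lemma grad_sq_ge0 v x : 0 <= grad_sq v x.
Proof. by apply: sumr_ge0 => i _; exact: sqr_ge0. Qed.

Lemma hess_sq_ge0 v x : 0 <= hess_sq v x.
Proof. by apply: sumr_ge0 => i _; apply: sumr_ge0 => j _; exact: sqr_ge0. Qed.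

Lemma is_derive_symmetry z v zi vi x e (zii vii : R) :
  is_derive x e z (zi x) -> is_derive x e v (vi x) ->
  is_derive x e zi zii -> is_derive x e vi vii ->
  is_derive x e (fun x => z x * vi x - v x * zi x) (z x * vii - v x * zii).
Proof.
move=> Dz Dv Dzi Dvi.
by apply: is_derive_eq (is_deriveB_rV (is_deriveM_rV Dz Dvi) (is_deriveM_rV Dv Dzi)) _; ring.
Qed.

Lemma is_derive_energy z v zi vi x e (zii vii : R) :
  is_derive x e z (zi x) -> is_derive x e v (vi x) ->
  is_derive x e zi zii -> is_derive x e vi vii ->
  is_derive x e (fun x => z x * v x * vi x - 2^-1 * (v x * v x * zi x))
    (z x * vi x ^+ 2 + z x * v x * vii - 2^-1 * v x ^+ 2 * zii).
Proof.
move=> Dz Dv Dzi Dvi.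
apply: is_derive_eq (is_deriveB_rV (is_deriveM_rV (is_deriveM_rV Dz Dv) Dvi)
  (is_deriveZ_rV 2^-1 (is_deriveM_rV (is_deriveM_rV Dv Dv) Dzi))) _.
by field.
Qed.

Lemma is_derive_bochner z zi vi vj vij vjj x e (zii vii viij vijj : R) :
  is_derive x e z (zi x) -> is_derive x e zi zii ->
  is_derive x e vi vii -> is_derive x e vj (vij x) ->
  is_derive x e vij viij -> is_derive x e vjj vijj ->
  is_derive x e (fun x => z x * vj x * vij x - z x * vjj x * vi x
      - 2^-1 * (zi x * (vj x * vj x)))
    (z x * vij x ^+ 2 - z x * (vjj x * vii) - 2^-1 * zii * vj x ^+ 2
      - vjj x * (zi x * vi x) + z x * (vj x * viij - vi x * vijj)).
Proof.
move=> Dz Dzi Dvi Dvj Dvij Dvjj.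
apply: is_derive_eq (is_deriveB_rV (is_deriveB_rV
    (is_deriveM_rV (is_deriveM_rV Dz Dvj) Dvij) (is_deriveM_rV (is_deriveM_rV Dz Dvjj) Dvi))
  (is_deriveZ_rV 2^-1 (is_deriveM_rV Dzi (is_deriveM_rV Dvj Dvj)))) _.
by field.
Qed.

Lemma bochner_field_eq0 (z zi a b c d e : R) : z = 0 -> zi = 0 ->
  z * a * b - z * c * d - 2^-1 * (zi * (e * e)) = 0.
Proof. by move=> -> ->; ring. Qed.

(** Summation over both indices of the divergence computed in
    [is_derive_bochner]; [T] collects the third derivatives. *)
Lemma bochner_sum (z : R) (zi vi zii L : 'I_n -> R) (H T : 'I_n -> 'I_n -> R) :
  \sum_(k : 'I_n * 'I_n) (z * H k.1 k.2 ^+ 2 - z * (L k.2 * L k.1)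
     - 2^-1 * zii k.1 * vi k.2 ^+ 2 - L k.2 * (zi k.1 * vi k.1)
     + z * (T k.1 k.2 - T k.2 k.1)) =
  z * (\sum_i \sum_j H j i ^+ 2) - z * (\sum_i L i) ^+ 2
     - 2^-1 * (\sum_i zii i) * (\sum_i vi i ^+ 2) - (\sum_i L i) * \sum_i zi i * vi i.
Proof.
have anti : \sum_(k : 'I_n * 'I_n) z * (T k.1 k.2 - T k.2 k.1) = 0.
  rewrite -mulr_sumr sumrB -(pair_big xpredT xpredT (fun i j => T i j)) /=.
  rewrite -(pair_big xpredT xpredT (fun i j => T j i)) /= [X in _ - X]exchange_big.
  by rewrite subrr mulr0.
rewrite big_split /= anti addr0 !sumrB; congr (_ - _ - _ - _).
- rewrite -mulr_sumr; congr (_ * _).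
  by rewrite -(pair_big xpredT xpredT (fun i j => H i j ^+ 2)) /= exchange_big.
- rewrite -mulr_sumr; congr (_ * _); rewrite expr2 big_distrlr /=.
  by rewrite -(pair_big xpredT xpredT (fun i j => L j * L i)) /= exchange_big.
- rewrite -(pair_big xpredT xpredT (fun i j => 2^-1 * zii i * vi j ^+ 2)) /=.
  rewrite -mulrA big_distrlr /= mulr_sumr.
  by apply: eq_bigr => i _; rewrite mulr_sumr; apply: eq_bigr => j _; rewrite mulrA.
- rewrite -(pair_big xpredT xpredT (fun i j => L j * (zi i * vi i))) /=.
  by rewrite big_distrlr /= exchange_big.
Qed.

Lemma cutoff_symmetry z v (r s : R) : r < s -> smooth z -> supported 0 r z -> smooth v ->
  \int[leb]_(x in eball 0 s) (z x * laplacian v x - v x * laplacian z x) = 0.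
Proof.
move=> rs sz Sz sv.
rewrite -(@Rintegral_divergence _ (fun i => i) (fun i x => z x * pderiv i v x - v x * pderiv i z x) 0 r s rs).
- apply: eq_Rintegral => x _; rewrite /laplacian !mulr_sumr -sumrB.
  apply: eq_bigr => i _; apply/esym/is_derive_pderivE.
  have Dz := smooth_is_derive i x sz; have Dv := smooth_is_derive i x sv.
  have Dz2 := smooth_is_derive i x (smooth_pderiv i sz).
  have Dv2 := smooth_is_derive i x (smooth_pderiv i sv).
  exact: (is_derive_symmetry Dz Dv Dz2 Dv2).
- move=> i; exact: (smoothB (smoothM sz (smooth_pderiv i sv)) (smoothM sv (smooth_pderiv i sz))).
- by move=> i y yr; rewrite (Sz y yr) (supported_pderiv i sz Sz yr) mul0r mulr0 subrr.
Qed.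

(** The Caccioppoli identity, obtained by testing the equation with [z * v]. *)
Lemma cutoff_energy z v (r s : R) : r < s -> smooth z -> supported 0 r z -> smooth v ->
  \int[leb]_(x in eball 0 s) (z x * grad_sq v x + z x * v x * laplacian v x
     - 2^-1 * v x ^+ 2 * laplacian z x) = 0.
Proof.
move=> rs sz Sz sv.
rewrite -(@Rintegral_divergence _ (fun i => i)
  (fun i x => z x * v x * pderiv i v x - 2^-1 * (v x * v x * pderiv i z x)) 0 r s rs).
- apply: eq_Rintegral => x _; rewrite /laplacian /grad_sq !mulr_sumr -!big_split -sumrB /=.
  apply: eq_bigr => i _; apply/esym/is_derive_pderivE.
  have Dz := smooth_is_derive i x sz; have Dv := smooth_is_derive i x sv.
  have Dz2 := smooth_is_derive i x (smooth_pderiv i sz).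
  have Dv2 := smooth_is_derive i x (smooth_pderiv i sv).
  exact: (is_derive_energy Dz Dv Dz2 Dv2).
- move=> i; have sz' := smooth_pderiv i sz; have sv' := smooth_pderiv i sv.
  exact: (smoothB (smoothM (smoothM sz sv) sv') (smoothZ 2^-1 (smoothM (smoothM sv sv) sz'))).
- by move=> i y yr; rewrite (Sz y yr) (supported_pderiv i sz Sz yr) !(mul0r, mulr0) subrr.
Qed.

(** A Bochner-type identity: the difference between [hess_sq v] and the square
    of the Laplacian is a divergence. After multiplication by the cutoff [z] and
    integration by parts, the remaining terms contain second derivatives of [v]
    only through its Laplacian, so that the Laplacian and the gradient control
    the Hessian. *)
Lemma cutoff_bochner z v (r s : R) : r < s -> smooth z -> supported 0 r z -> smooth v ->
  \int[leb]_(x in eball 0 s) (z x * hess_sq v x - z x * laplacian v x ^+ 2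
     - 2^-1 * laplacian z x * grad_sq v x
     - laplacian v x * \sum_i pderiv i z x * pderiv i v x) = 0.
Proof.
move=> rs sz Sz sv.
(* In the divergence of this field the third derivatives of [v] occur in
   terms that are antisymmetric in the two indices and cancel in the sum. *)
pose F (k : 'I_n * 'I_n) x := z x * pderiv k.2 v x * pderiv k.1 (pderiv k.2 v) x
  - z x * pderiv k.2 (pderiv k.2 v) x * pderiv k.1 v x
  - 2^-1 * (pderiv k.1 z x * (pderiv k.2 v x * pderiv k.2 v x)).
have sF k : smooth (F k).
  case: k => i j; rewrite /F /=; have sj := smooth_pderiv j sv; have si := smooth_pderiv i sv.
  have sij := smooth_pderiv i sj; have sjj := smooth_pderiv j sj; have sz' := smooth_pderiv i sz.
  exact: (smoothB (smoothB (smoothM (smoothM sz sj) sij) (smoothM (smoothM sz sjj) si))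
    (smoothZ 2^-1 (smoothM sz' (smoothM sj sj)))).
have SF k : supported 0 r (F k).
  by move=> y yr; exact: (bochner_field_eq0 _ _ _ _ _ (Sz y yr) (supported_pderiv k.1 sz Sz yr)).
apply: etrans (@Rintegral_divergence _ (fun k : 'I_n * 'I_n => k.1) F 0 r s rs sF SF).
apply: eq_Rintegral => x _.
  pose T (i j : 'I_n) := pderiv j v x * pderiv i (pderiv i (pderiv j v)) x.
  have DF k : pderiv k.1 (F k) x = z x * pderiv k.1 (pderiv k.2 v) x ^+ 2
      - z x * (pderiv k.2 (pderiv k.2 v) x * pderiv k.1 (pderiv k.1 v) x)
      - 2^-1 * pderiv k.1 (pderiv k.1 z) x * pderiv k.2 v x ^+ 2
      - pderiv k.2 (pderiv k.2 v) x * (pderiv k.1 z x * pderiv k.1 v x)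
      + z x * (T k.1 k.2 - T k.2 k.1).
    case: k => i j /=; rewrite /F /= /T.
    have sj := smooth_pderiv j sv; have si := smooth_pderiv i sv.
    have Dz := smooth_is_derive i x sz.
    have Dz2 := smooth_is_derive i x (smooth_pderiv i sz).
    have Dj := smooth_is_derive i x sj.
    have Di := smooth_is_derive i x si.
    have Dij := smooth_is_derive i x (smooth_pderiv i sj).
    have Djj := smooth_is_derive i x (smooth_pderiv j sj).
    have C1 : pderiv i (pderiv j (pderiv j v)) x = pderiv j (pderiv j (pderiv i v)) x.
      by rewrite (pderivC i j sj) (pderivC i j sv).
    rewrite -C1; apply: is_derive_pderivE.
    exact: (is_derive_bochner Dz Dz2 Di Dj Dij Djj).
  apply: etrans (esym (bochner_sum (z x) (fun i => pderiv i z x) (fun i => pderiv i v x)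
    (fun i => pderiv i (pderiv i z) x) (fun i => pderiv i (pderiv i v) x)
    (fun i j => pderiv i (pderiv j v) x) T)) _.
  by apply: eq_bigr => k _; exact: esym (DF k).
Qed.

End interior_estimates.

(** * Interior bounds on the gradient and the Hessian *)

Section interior_bounds.
Context (R : realType) (n : nat).
Local Notation V := 'rV[R]_n.
Local Notation leb := (lebesgue_rV R n).
Implicit Types (f g v z : V -> R) (x y : V).

Lemma smooth_bounded f (s : R) : smooth f -> exists2 M, 0 <= M &
  forall y, eball 0 s y -> `|f y| <= M.
Proof.
move=> sf; have [M M0 hM] := continuous_ecball_bound 0 s (smooth_continuous sf).
by exists M => // y; rewrite eballE => /ltW; exact: hM.
Qed.

Lemma smooth_bounded_grad f (s : R) : smooth f -> exists2 M, 0 <= M &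
  forall y, eball 0 s y -> forall i, `|pderiv i f y| <= M.
Proof.
move=> sf; have H i := cid2 (smooth_bounded s (smooth_pderiv i sf)).
exists (\sum_i s2val (H i)) => [|y yB i].
  by apply: sumr_ge0 => i _; exact: (s2valP (H i)).
apply: le_trans (s2valP' (H i) y yB) _; rewrite (bigD1 i)//= lerDl.
by apply: sumr_ge0 => j _; exact: (s2valP (H j)).
Qed.

Lemma le_Rintegral_divergence f D g (s M : R) : smooth f -> smooth D -> smooth g ->
  \int[leb]_(x in eball 0 s) D x = 0 ->
  (forall x, eball 0 s x -> f x <= D x + M * g x) ->
  \int[leb]_(x in eball 0 s) f x <= M * \int[leb]_(x in eball 0 s) g x.
Proof.
move=> sf sD sg D0 H; have mB := @measurable_eball R n 0 s.
have iD := @smooth_integrable R n D 0 s sD.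
have ig := @smooth_integrable R n g 0 s sg.
rewrite -(RintegralZl M mB ig) -[leRHS]add0r -D0 -(RintegralD mB iD (integrable_RZ M mB ig)).
apply: le_Rintegral => //; first exact: smooth_integrable.
by apply: integrable_RD => //; exact: integrable_RZ.
Qed.

Lemma sqint_add f g (s : R) : smooth f -> smooth g ->
  \int[leb]_(x in eball 0 s) (f x ^+ 2 + g x ^+ 2) = sqint (eball 0 s) f + sqint (eball 0 s) g.
Proof.
move=> sf sg; apply: RintegralD; first exact: measurable_eball.
  exact: (@smooth_integrable R n (fun x => f x ^+ 2) 0 s (smoothX2 sf)).
exact: (@smooth_integrable R n (fun x => g x ^+ 2) 0 s (smoothX2 sg)).
Qed.

Lemma energy_pointwise (z v l G Lz M : R) : 0 <= z -> `|z| <= M -> `|Lz| <= M ->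
  z * G <= (z * G + z * v * l - 2^-1 * v ^+ 2 * Lz) + M * (v ^+ 2 + l ^+ 2).
Proof.
move=> z0 zM; rewrite ler_norml => /andP[L1 L2].
have zM' : z <= M by rewrite -(ger0_norm z0).
have h1 := sqr_ge0 (v + l); have h2 := sqr_ge0 v; have h3 := sqr_ge0 l.
have : v ^+ 2 * Lz <= v ^+ 2 * M by rewrite ler_wpM2l.
have : z * (v ^+ 2 + l ^+ 2) <= M * (v ^+ 2 + l ^+ 2) by rewrite ler_wpM2r// addr_ge0.
have : 0 <= z * (v + l) ^+ 2 by rewrite mulr_ge0.
have : 0 <= M * l ^+ 2 by rewrite mulr_ge0// (le_trans z0).
lra.
Qed.

Lemma gradient_cutoff z (r s : R) : r < s -> smooth z -> supported 0 r z ->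
  (forall x, 0 <= z x) -> exists2 C, 0 <= C & forall v, smooth v ->
    \int[leb]_(x in eball 0 s) (z x * grad_sq v x) <=
      C * (sqint (eball 0 s) v + sqint (eball 0 s) (laplacian v)).
Proof.
move=> rs sz Sz z0.
have [M1 M10 hM1] := smooth_bounded s sz.
have sLz := smooth_laplacian sz; have [M2 M20 hM2] := smooth_bounded s sLz.
exists (M1 + M2) => [|v sv]; first exact: addr_ge0.
have sLv := smooth_laplacian sv; have sG := smooth_grad_sq sv.
rewrite -(sqint_add s sv sLv).
apply: (le_Rintegral_divergence (D := fun x => z x * grad_sq v x + z x * v x * laplacian v x
     - 2^-1 * v x ^+ 2 * laplacian z x)).
- exact: (smoothM sz sG).
- exact: (smoothB (smoothD (smoothM sz sG) (smoothM (smoothM sz sv) sLv))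
    (smoothM (smoothZ 2^-1 (smoothX2 sv)) sLz)).
- exact: (smoothD (smoothX2 sv) (smoothX2 sLv)).
- exact: cutoff_energy rs sz Sz sv.
- move=> x xB; apply: energy_pointwise; first exact: z0.
    by apply: le_trans (hM1 x xB) _; rewrite lerDl.
  by apply: le_trans (hM2 x xB) _; rewrite lerDr.
Qed.

Lemma bochner_pointwise (z1 z2 H L G Lz X M c : R) (m : nat) :
  0 <= M -> 0 < c -> 0 <= z2 -> 0 <= G ->
  `|z1| <= M -> `|Lz| <= M -> `|X| <= m%:R * (L ^+ 2) * M + M * G ->
  (z1 = 0 /\ Lz = 0 /\ X = 0) \/ c <= z2 ->
  z1 * H <= (z1 * H - z1 * L ^+ 2 - 2^-1 * Lz * G - X)
    + (M * (1 + m%:R) * L ^+ 2 + 2 * M / c * (z2 * G)).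
Proof.
move=> M0 c0 z20 G0 z1M; rewrite !ler_norml => /andP[L1 L2] /andP[X1 X2] hz.
have l2 := sqr_ge0 L; have m0 : 0 <= m%:R :> R by [].
case: hz => [[-> [-> ->]]|cz].
  rewrite !mul0r !mulr0 mul0r !subr0 add0r addr_ge0//.
    by apply: mulr_ge0 => //; apply: mulr_ge0 => //; exact: addr_ge0.
  by apply: mulr_ge0; [rewrite divr_ge0 ?(ltW c0)// mulr_ge0|exact: mulr_ge0].
have zL : z1 * L ^+ 2 <= M * L ^+ 2 by rewrite ler_wpM2r// (le_trans (ler_norm _)).
have LG : Lz * G <= M * G by rewrite ler_wpM2r.
have GG : M * G <= M / c * (z2 * G).
  rewrite -mulrA ler_wpM2l// mulrA ler_peMl// mulrC ler_pdivlMr// mul1r//.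
have MG : 0 <= M * G by exact: mulr_ge0.
have -> : 2 * M / c * (z2 * G) = 2 * (M / c * (z2 * G)) by ring.
have -> : M * (1 + m%:R) * L ^+ 2 = M * L ^+ 2 + m%:R * L ^+ 2 * M by ring.
lra.
Qed.

(** The Bochner identity bounds the Hessian by the Laplacian and the gradient;
    the gradient is in turn bounded by [gradient_cutoff] with a wider cutoff. *)
Lemma hessian_cutoff (r1 r2 s : R) : 0 <= r1 < r2 -> r2 < s ->
  exists2 C, 0 <= C & forall v, smooth v ->
    \int[leb]_(x in eball 0 s) (@rbump R n r1 x * hess_sq v x) <=
      C * (sqint (eball 0 s) v + sqint (eball 0 s) (laplacian v)).
Proof.
move=> /andP[r10 r12] r2s; have r20 := le_trans r10 (ltW r12).
have r1s := lt_trans r12 r2s.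
pose z1 : V -> R := @rbump R n r1; pose z2 : V -> R := @rbump R n r2.
have sz1 : smooth z1 := @smooth_bump R n r1; have sz2 : smooth z2 := @smooth_bump R n r2.
have Sz1 : supported 0 r1 z1 := @supported_bump R n r1 r10.
have Sz2 : supported 0 r2 z2 := @supported_bump R n r2 r20.
have sLz := smooth_laplacian sz1.
have [M1 M10 hM1] := smooth_bounded s sz1.
have [M2 M20 hM2] := smooth_bounded s sLz.
have [M3 M30 hM3] := smooth_bounded_grad s sz1.
(* The wider cutoff is bounded below on the support of the narrower one, so
   that it can absorb the gradient terms of the identity. *)
have [c c0 hc] : exists2 c, 0 < c & forall x : V, enorm x <= r1 -> c <= @rbump R n r2 x.
  by apply: bump_lower_bound; rewrite r10.
have [Cg Cg0 hCg] := gradient_cutoff r2s sz2 Sz2 (@bump_ge0 R n r2).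
pose M := M1 + M2 + M3.
have M0 : 0 <= M by rewrite !addr_ge0.
pose A := M * (1 + n%:R); pose B := 2 * M / c.
have A0 : 0 <= A by rewrite mulr_ge0// addr_ge0.
have B0 : 0 <= B by rewrite !mulr_ge0// invr_ge0 ltW.
exists (A + B * Cg) => [|v sv]; first by rewrite addr_ge0// mulr_ge0.
have sLv := smooth_laplacian sv; have sG := smooth_grad_sq sv; have sH := smooth_hess_sq sv.
have sX : smooth (fun x => \sum_i pderiv i z1 x * pderiv i v x).
  by apply: smooth_sum => i; exact: (smoothM (smooth_pderiv i sz1) (smooth_pderiv i sv)).
have s2G : smooth (fun x => z2 x * grad_sq v x) := smoothM sz2 sG.
have mB := @measurable_eball R n 0 s.
apply: (@le_trans _ _ (1 * \int[leb]_(x in eball 0 s) (A * laplacian v x ^+ 2 + B * (z2 x * grad_sq v x)))).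
  apply: (le_Rintegral_divergence (D := fun x => z1 x * hess_sq v x - z1 x * laplacian v x ^+ 2
     - 2^-1 * laplacian z1 x * grad_sq v x
     - laplacian v x * \sum_i pderiv i z1 x * pderiv i v x)).
  - exact: (smoothM sz1 sH).
  - exact: (smoothB (smoothB (smoothB (smoothM sz1 sH) (smoothM sz1 (smoothX2 sLv)))
      (smoothM (smoothZ 2^-1 sLz) sG)) (smoothM sLv sX)).
  - exact: (smoothD (smoothZ A (smoothX2 sLv)) (smoothZ B s2G)).
  - exact: cutoff_bochner r1s sz1 Sz1 sv.
  move=> x xB; rewrite mul1r; apply: bochner_pointwise => //.
  - exact: bump_ge0.
  - exact: grad_sq_ge0.
  - by apply: le_trans (hM1 x xB) _; rewrite /M -addrA lerDl addr_ge0.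
  - by apply: le_trans (hM2 x xB) _; rewrite /M [M1 + _]addrC -addrA lerDl addr_ge0.
  - rewrite mulr_sumr; apply: le_trans (ler_norm_sum _ _ _) _.
    apply: (@le_trans _ _ (\sum_i (laplacian v x ^+ 2 * M + M * pderiv i v x ^+ 2))); last first.
      rewrite big_split /= sumr_const card_ord -[_ *+ n]mulr_natl mulrA -mulr_sumr.
      exact: lexx.
    apply: ler_sum => i _; rewrite !normrM mulrCA mulrC.
    have hM : `|pderiv i z1 x| <= M.
      by apply: le_trans (hM3 x xB i) _; rewrite /M lerDr addr_ge0.
    apply: (@le_trans _ _ (`|laplacian v x| * `|pderiv i v x| * M)).
      by rewrite ler_wpM2l// mulr_ge0.
    rewrite [_ * M]mulrC [laplacian v x ^+ 2 * M]mulrC -mulrDr ler_wpM2l//.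
    rewrite -(real_normK (num_real (laplacian v x))) -(real_normK (num_real (pderiv i v x))).
    move: `|laplacian v x| `|pderiv i v x| => a b.
    have := sqr_ge0 (a - b); have := sqr_ge0 a; have := sqr_ge0 b; lra.
  have [xr|rx] := leP (enorm x) r1; first by right; exact: hc.
  left; have out : r1 < enorm (x - 0) by rewrite subr0.
  split; first exact: Sz1; split.
    by apply: big1 => i _; apply: (supported_pderiv i (smooth_pderiv i sz1) (supported_pderiv i sz1 Sz1)).
  by rewrite big1 ?mulr0// => i _; rewrite (supported_pderiv i sz1 Sz1 out) mul0r.
have iL : leb.-integrable (eball 0 s) (EFin \o (fun x => laplacian v x ^+ 2)).
  exact: (@smooth_integrable R n _ 0 s (smoothX2 sLv)).
have iG := @smooth_integrable R n _ 0 s s2G.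
rewrite mul1r (RintegralD mB (integrable_RZ A mB iL) (integrable_RZ B mB iG)).
rewrite (RintegralZl A mB iL) (RintegralZl B mB iG) -/(sqint _ _) mulrDl.
apply: lerD; first by rewrite ler_wpM2l// lerDr sqint_ge0.
by rewrite -[leRHS]mulrA; exact: (ler_wpM2l B0 (hCg v sv)).
Qed.

End interior_bounds.

(** * Interior bounds at all scales *)

Section scaled_interior_bounds.
Context (R : realType) (n : nat).
Local Notation V := 'rV[R]_n.
Local Notation leb := (lebesgue_rV R n).
Implicit Types (f g v z : V -> R) (x y : V).

Lemma Rintegral_eballS f x (r s : R) : r <= s -> smooth f -> (forall y, 0 <= f y) ->
  \int[leb]_(y in eball x r) f y <= \int[leb]_(y in eball x s) f y.
Proof.
move=> rs sf f0; have [mr ms] := (@measurable_eball R n x r, @measurable_eball R n x s).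
have fs := @smooth_integrable R n f x s sf.
rewrite /Rintegral; apply: fine_le.
- by apply: integrable_fin_num => //; exact: smooth_integrable.
- exact: integrable_fin_num.
apply: ge0_subset_integral => //; [exact: measurable_int fs| |exact: subset_eball].
by move=> y _; rewrite lee_fin.
Qed.

(** Green's identity [cutoff_symmetry] writes [c] times the mass of a cutoff
    as an integral of [v] and [laplacian v - c] against bounded functions. *)
Lemma laplacian_cst_bound (s : R) : 1 < s -> exists2 K, 0 <= K & forall v c, smooth v ->
  c ^+ 2 <= K * (sqint (eball 0 s) v + sqint (eball 0 s) (fun x => laplacian v x - c)).
Proof.
move=> s1; have s0 : 0 < s by apply: lt_trans s1.
pose z : V -> R := @rbump R n 1.
have sz : smooth z := @smooth_bump R n 1; have Sz : supported 0 1 z := @supported_bump R n 1 ler01.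
have sLz := smooth_laplacian sz; have mB := @measurable_eball R n 0 s.
have [M1 M10 hM1] := smooth_bounded s sz; have [M2 M20 hM2] := smooth_bounded s sLz.
pose I := \int[leb]_(x in eball 0 s) z x.
have I0 : 0 < I.
  apply: Rintegral_continuous_gt0 => //; first exact: smooth_continuous.
    exact: bump_ge0.
  by apply: bump_gt0; rewrite enorm0.
pose m := fine (leb (eball 0 s)); have m0 : 0 <= m by exact: fine_ge0.
pose M := M1 + M2; have M0 : 0 <= M by exact: addr_ge0.
exists (m * (2 * M ^+ 2) / I ^+ 2) => [|v c sv].
  by rewrite divr_ge0 ?sqr_ge0// mulr_ge0// mulr_ge0// sqr_ge0.
have sLv := smooth_laplacian sv; have sg := smoothB sLv (@smooth_cst R n c).
pose h x := v x * laplacian z x - z x * (laplacian v x - c).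
have sh : smooth h := smoothB (smoothM sv sLz) (smoothM sz sg).
have cI : c * I = \int[leb]_(x in eball 0 s) h x.
  have D0 := cutoff_symmetry s1 sz Sz sv.
  rewrite -[RHS]add0r -[X in X + _]D0 -RintegralD//; last 2 first.
  - exact: (smooth_integrable _ _ (smoothB (smoothM sz sLv) (smoothM sv sLz))).
  - exact: smooth_integrable.
  rewrite -RintegralZl//; last exact: smooth_integrable.
  apply: eq_Rintegral => x _; rewrite /h.
  by move: (z x) (v x) (laplacian z x) (laplacian v x) => a b d e; ring.
have : (c * I) ^+ 2 <= m * (2 * M ^+ 2 * (sqint (eball 0 s) v + sqint (eball 0 s) (fun x => laplacian v x - c))).
  rewrite cI; apply: le_trans (Rintegral_sqr_le mB (lebesgue_eball_lty _ _) (smooth_sq_integrable 0 s sh)) _.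
  rewrite ler_wpM2l// mulrDr; apply: sqint_le_comb => //; [exact: smooth_sq_integrable..|].
  move=> x xB; rewrite /h; have := hM1 x xB; have := hM2 x xB.
  move: (v x) (z x) (laplacian z x) (laplacian v x - c) => a b d e hd hb.
  have hb' : b ^+ 2 <= M ^+ 2.
    rewrite -(real_normK (num_real b)); apply: lerXn2r; rewrite ?nnegrE//.
    by apply: le_trans hb _; rewrite lerDl.
  have hd' : d ^+ 2 <= M ^+ 2.
    rewrite -(real_normK (num_real d)); apply: lerXn2r; rewrite ?nnegrE//.
    by apply: le_trans hd _; rewrite lerDr.
  have h1 := ler_wpM2l (sqr_ge0 a) hd'; have h2 := ler_wpM2l (sqr_ge0 e) hb'.
  have h3 := sqr_ge0 (a * d + b * e).
  lra.
rewrite exprMn => H; rewrite -[_ / _ * _]mulrA [_^-1 * _]mulrC !mulrA.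
by rewrite ler_pdivlMr ?exprn_gt0// (le_trans H)// !mulrA.
Qed.

Lemma sqint_cst A (c : R) : measurable A -> sqint A (fun=> c : R) = c ^+ 2 * fine (leb A).
Proof. by move=> mA; rewrite /sqint Rintegral_cst. Qed.

(** The bound is needed modulo a constant [c] in the Laplacian, since only mean
    oscillations of the right-hand side are controlled; the constant itself is
    bounded by [laplacian_cst_bound]. *)
Lemma hessian_unit (s : R) : 1 < s -> exists2 C, 0 <= C & forall v c, smooth v ->
  \int[leb]_(x in eball 0 1) hess_sq v x <=
    C * (sqint (eball 0 s) v + sqint (eball 0 s) (fun x => laplacian v x - c)).
Proof.
move=> s1; pose r1 := 1 + (s - 1) / 3; pose r2 := 1 + (s - 1) / 3 * 2.
have r12 : 0 <= r1 < r2 by rewrite /r1 /r2; apply/andP; split; lra.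
have r2s : r2 < s by rewrite /r2; lra.
have [C C0 hC] := @hessian_cutoff R n r1 r2 s r12 r2s.
have [K K0 hK] := laplacian_cst_bound s1.
have [c1 c10 hc1] : exists2 c, 0 < c & forall x : V, enorm x <= 1 -> c <= @rbump R n r1 x.
  by apply: bump_lower_bound; rewrite ler01 /r1; lra.
pose m := fine (leb (eball 0 s)); have m0 : 0 <= m by exact: fine_ge0.
have mB := @measurable_eball R n 0 s; have m1 := @measurable_eball R n 0 1.
exists (c1^-1 * (C * (2 + 2 * K * m))) => [|v c sv].
  by rewrite mulr_ge0 ?invr_ge0 ?(ltW c10)// mulr_ge0// addr_ge0// !mulr_ge0.
have sLv := smooth_laplacian sv; have sg := smoothB sLv (@smooth_cst R n c).
have sz := @smooth_bump R n r1; have sH := smooth_hess_sq sv.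
have szH := smoothM sz sH.
apply: (@le_trans _ _ (c1^-1 * \int[leb]_(x in eball 0 1) (@rbump R n r1 x * hess_sq v x))).
  rewrite -RintegralZl//; last exact: smooth_integrable.
  apply: le_Rintegral => //; [exact: smooth_integrable|exact: integrable_RZ m1 (smooth_integrable _ _ szH)|].
  move=> x; rewrite eballE subr0 => /ltW/hc1 h; rewrite mulrA ler_peMl ?hess_sq_ge0//.
  by rewrite mulrC ler_pdivlMr// mul1r.
rewrite -[leRHS]mulrA ler_wpM2l ?invr_ge0 ?(ltW c10)//.
apply: le_trans (Rintegral_eballS 0 (ltW s1) szH _) _.
  by move=> y; rewrite mulr_ge0 ?bump_ge0 ?hess_sq_ge0.
apply: le_trans (hC v sv) _; rewrite -[leRHS]mulrA ler_wpM2l//.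
set A := sqint _ v; set B := sqint _ (fun x => laplacian v x - c).
have A0 : 0 <= A by exact: sqint_ge0.
have B0 : 0 <= B by exact: sqint_ge0.
have : sqint (eball 0 s) (laplacian v) <= 2 * B + 2 * (c ^+ 2 * m).
  have := sqintD_le mB (smooth_sq_integrable 0 s sg) (sq_integrable_cst c mB (lebesgue_eball_lty 0 s)).
  have -> : sqint (eball (0 : V) s) (fun=> c) = c ^+ 2 * m.
    by rewrite (sqint_cst c mB).
  by have -> : (fun x => laplacian v x - c + c) = laplacian v by apply/funext => x; rewrite subrK.
have := ler_wpM2r m0 (hK v c sv); rewrite -/A -/B => h1 h2.
apply: le_trans (lerD (lexx A) h2) _.
have : K * (A + B) * m = K * m * (A + B) by ring.
by move=> E; rewrite E in h1; rewrite mulrDl; nra.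
Qed.

Lemma gradient_unit (s : R) : 1 < s -> exists2 C, 0 <= C & forall v, smooth v ->
  \int[leb]_(x in eball 0 1) grad_sq v x <=
    C * (sqint (eball 0 s) v + sqint (eball 0 s) (laplacian v)).
Proof.
move=> s1; pose r1 := 1 + (s - 1) / 2.
have r1s : r1 < s by rewrite /r1; lra.
have r10 : 0 <= r1 by rewrite /r1; lra.
have sz := @smooth_bump R n r1.
have [C C0 hC] := gradient_cutoff r1s sz (supported_bump r10) (@bump_ge0 R n r1).
have [c1 c10 hc1] : exists2 c, 0 < c & forall x : V, enorm x <= 1 -> c <= @rbump R n r1 x.
  by apply: bump_lower_bound; rewrite ler01 /r1; lra.
have m1 := @measurable_eball R n 0 1.
exists (c1^-1 * C) => [|v sv]; first by rewrite mulr_ge0 ?invr_ge0 ?(ltW c10).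
have sG := smooth_grad_sq sv; have szG := smoothM sz sG.
apply: (@le_trans _ _ (c1^-1 * \int[leb]_(x in eball 0 1) (@rbump R n r1 x * grad_sq v x))).
  rewrite -RintegralZl//; last exact: smooth_integrable.
  apply: le_Rintegral => //; [exact: smooth_integrable|exact: integrable_RZ m1 (smooth_integrable _ _ szG)|].
  move=> x; rewrite eballE subr0 => /ltW/hc1 h; rewrite mulrA ler_peMl ?grad_sq_ge0//.
  by rewrite mulrC ler_pdivlMr// mul1r.
rewrite -[leRHS]mulrA ler_wpM2l ?invr_ge0 ?(ltW c10)//.
apply: le_trans (Rintegral_eballS 0 (ltW s1) szG _) _; last exact: hC.
by move=> y; rewrite mulr_ge0 ?bump_ge0 ?grad_sq_ge0.
Qed.

Lemma Rintegral_eball_scale f x (r s : R) : 0 < r ->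
  leb.-integrable (eball x (r * s)) (EFin \o f) ->
  r ^+ n * \int[leb]_(y in eball 0 s) f (x + r *: y) = \int[leb]_(y in eball x (r * s)) f y.
Proof.
move=> r0 fi; have := Rintegral_quasi (exprn_gt0 n r0) (@measurable_fun_affine R n x r)
  (fun A => @lebesgue_rV_affine R n x r A r0) (@measurable_eball R n x (r * s)) fi.
by have := eball_affine x 0 s r0; rewrite scaler0 addr0 => ->.
Qed.

Lemma sqint_scale f x (r s : R) : 0 < r -> sq_integrable (eball x (r * s)) f ->
  sqint (eball 0 s) (fun y => f (x + r *: y)) = (r ^+ n)^-1 * sqint (eball x (r * s)) f.
Proof.
move=> r0 [_ f2]; rewrite /sqint -(Rintegral_eball_scale r0 f2).
by rewrite mulKf// expf_neq0// gt_eqF.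
Qed.

Lemma pderiv2_affine i j v x (r : R) : smooth v ->
  pderiv j (pderiv i (fun y => v (x + r *: y))) =
  (fun y => r ^+ 2 * pderiv j (pderiv i v) (x + r *: y)).
Proof.
move=> sv; have si := smooth_pderiv i sv; have sj := smooth_pderiv j si.
rewrite (smooth_pderiv_affine i x r sv) (smooth_pderivZ j r (smooth_affine x r si)).
by rewrite (smooth_pderiv_affine j x r si); apply/funext => y; rewrite mulrA expr2.
Qed.

Lemma laplacian_affine v x (r : R) : smooth v ->
  laplacian (fun y => v (x + r *: y)) = (fun y => r ^+ 2 * laplacian v (x + r *: y)).
Proof.
move=> sv; apply/funext => y; rewrite /laplacian mulr_sumr; apply: eq_bigr => i _.
exact: (congr1 (fun f => f y) (pderiv2_affine i i x r sv)).
Qed.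

Lemma hess_sq_affine v x (r : R) y : smooth v ->
  hess_sq (fun y => v (x + r *: y)) y = r ^+ 4 * hess_sq v (x + r *: y).
Proof.
move=> sv; rewrite /hess_sq mulr_sumr; apply: eq_bigr => i _; rewrite mulr_sumr.
apply: eq_bigr => j _; have -> := congr1 (fun f => f y) (pderiv2_affine i j x r sv).
by rewrite exprMn -exprM.
Qed.

Lemma grad_sq_affine v x (r : R) y : smooth v ->
  grad_sq (fun y => v (x + r *: y)) y = r ^+ 2 * grad_sq v (x + r *: y).
Proof.
move=> sv; rewrite /grad_sq mulr_sumr; apply: eq_bigr => i _.
have -> := congr1 (fun f => f y) (smooth_pderiv_affine i x r sv).
by rewrite exprMn.
Qed.

(** The powers of [r] come from rescaling [hessian_unit]. *)
Lemma hessian_bound (s : R) : 1 < s -> exists2 C, 0 <= C & forall v c x (r : R),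
  smooth v -> 0 < r ->
  \int[leb]_(y in eball x r) hess_sq v y <=
    C * (r ^- 4 * sqint (eball x (r * s)) v +
         sqint (eball x (r * s)) (fun y => laplacian v y - c)).
Proof.
move=> s1; have [C C0 hC] := hessian_unit s1; exists C => // v c x r sv r0.
have sLv := smooth_laplacian sv; have sg := smoothB sLv (@smooth_cst R n c).
have r4 : 0 < r ^+ 4 by rewrite exprn_gt0.
have rn : 0 < r ^+ n by rewrite exprn_gt0.
have mB := @measurable_eball R n 0 s.
have := hC _ (r ^+ 2 * c) (smooth_affine x r sv).
rewrite (laplacian_affine x r sv) (sqint_scale r0 (smooth_sq_integrable x (r * s) sv)).
have -> : (fun y => r ^+ 2 * laplacian v (x + r *: y) - r ^+ 2 * c) =
    (fun y => r ^+ 2 * (laplacian v (x + r *: y) - c)) by apply/funext => y; rewrite mulrBr.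
rewrite (sqintZ (r ^+ 2) mB (smooth_sq_integrable 0 s (smooth_affine x r sg))) -exprM.
rewrite (sqint_scale r0 (smooth_sq_integrable x (r * s) sg)).
have E : \int[leb]_(y in eball x r) hess_sq v y =
    r ^+ n / r ^+ 4 * \int[leb]_(y in eball 0 1) hess_sq (fun y => v (x + r *: y)) y.
  have sH := smooth_hess_sq sv.
  have -> : \int[leb]_(y in eball 0 1) hess_sq (fun y => v (x + r *: y)) y =
      \int[leb]_(y in eball 0 1) (r ^+ 4 * hess_sq v (x + r *: y)).
    by apply: eq_Rintegral => y _; exact: hess_sq_affine.
  rewrite RintegralZl//; [|exact: measurable_eball|exact: smooth_integrable (smooth_affine x r sH)].
  rewrite -{1}[r]mulr1 -(Rintegral_eball_scale r0 (@smooth_integrable R n _ x (r * 1) sH)).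
  by rewrite mulrA divfK ?gt_eqF.
move=> H; rewrite E; apply: le_trans (ler_wpM2l _ H) _; first by rewrite divr_ge0 ?ltW.
move: (sqint _ _) (sqint _ _) => a b; rewrite le_eqVlt; apply/orP; left; apply/eqP.
by field; rewrite !gt_eqF.
Qed.

Lemma gradient_bound (s : R) : 1 < s -> exists2 C, 0 <= C & forall v x (r : R),
  smooth v -> 0 < r ->
  \int[leb]_(y in eball x r) grad_sq v y <=
    C * (r ^- 2 * sqint (eball x (r * s)) v + r ^+ 2 * sqint (eball x (r * s)) (laplacian v)).
Proof.
move=> s1; have [C C0 hC] := gradient_unit s1; exists C => // v x r sv r0.
have sLv := smooth_laplacian sv.
have r2 : 0 < r ^+ 2 by rewrite exprn_gt0.
have rn : 0 < r ^+ n by rewrite exprn_gt0.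
have mB := @measurable_eball R n 0 s.
have := hC _ (smooth_affine x r sv).
rewrite (laplacian_affine x r sv) (sqint_scale r0 (smooth_sq_integrable x (r * s) sv)).
rewrite (sqintZ (r ^+ 2) mB (smooth_sq_integrable 0 s (smooth_affine x r sLv))).
rewrite (sqint_scale r0 (smooth_sq_integrable x (r * s) sLv)).
have E : \int[leb]_(y in eball x r) grad_sq v y =
    r ^+ n / r ^+ 2 * \int[leb]_(y in eball 0 1) grad_sq (fun y => v (x + r *: y)) y.
  have sG := smooth_grad_sq sv.
  have -> : \int[leb]_(y in eball 0 1) grad_sq (fun y => v (x + r *: y)) y =
      \int[leb]_(y in eball 0 1) (r ^+ 2 * grad_sq v (x + r *: y)).
    by apply: eq_Rintegral => y _; exact: grad_sq_affine.
  rewrite RintegralZl//; [|exact: measurable_eball|exact: smooth_integrable (smooth_affine x r sG)].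
  rewrite -{1}[r]mulr1 -(Rintegral_eball_scale r0 (@smooth_integrable R n _ x (r * 1) sG)).
  by rewrite mulrA divfK ?gt_eqF.
move=> H; rewrite E; apply: le_trans (ler_wpM2l _ H) _; first by rewrite divr_ge0 ?ltW.
move: (sqint _ _) (sqint _ _) => a b; rewrite le_eqVlt; apply/orP; left; apply/eqP.
by field; rewrite !gt_eqF.
Qed.

End scaled_interior_bounds.

(** * Correlations with a smooth kernel *)

Section fubini_rV.
Context (R : realType) (n : nat).
Local Notation V := 'rV[R]_n.
Local Notation leb := (lebesgue_rV R n).

Lemma Fubini_bounded (A B : set V) (f : V * V -> R) (M : R) :
  measurable A -> measurable B -> (leb A < +oo)%E -> (leb B < +oo)%E ->
  measurable_fun setT f -> (forall x y, A x -> B y -> `|f (x, y)| <= M) ->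
  \int[leb]_(x in A) \int[leb]_(y in B) f (x, y) =
  \int[leb]_(y in B) \int[leb]_(x in A) f (x, y).
Proof.
move=> mA mB Aoo Boo mf bf.
have mAB : measurable (A `*` B) by exact: measurableX.
pose g : V * V -> \bar R := (EFin \o f) \_ (A `*` B).
have gi : (leb \x leb)%E.-integrable setT g.
  rewrite -integrable_mkcond//; apply: measurable_bounded_integrable => //.
  - have H : ((leb \x leb) (A `*` B) < +oo)%E.
      by rewrite product_measure1E// lte_mul_pinfty// ge0_fin_numE.
    exact: H.
  - exact: measurable_funTS.
  - exists M; split => [|N MN [x y] [/= Ax By]]; first exact: num_real.
    by apply: le_trans (ltW MN); exact: bf.
have fA y : B y -> leb.-integrable A (EFin \o (fun x => f (x, y))).
  move=> By; apply: measurable_bounded_integrable => //.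
    by apply: measurable_funTS; apply: measurableT_comp => //; exact: measurable_fun_pair.
  by exists M; split => [|N MN x Ax]; [exact: num_real|apply: le_trans (ltW MN); exact: bf].
have fB x : A x -> leb.-integrable B (EFin \o (fun y => f (x, y))).
  move=> Ax; apply: measurable_bounded_integrable => //.
    by apply: measurable_funTS; apply: measurableT_comp => //; exact: measurable_fun_pair.
  by exists M; split => [|N MN y By]; [exact: num_real|apply: le_trans (ltW MN); exact: bf].
have := Fubini gi.
have -> : (\int[leb]_x \int[leb]_y g (x, y) =
    \int[leb]_(x in A) (\int[leb]_(y in B) f (x, y))%:E)%E.
  rewrite [RHS]integral_mkcond; apply: eq_integral => x _.
  rewrite /patch; case: ifPn => xA.
    rewrite /Rintegral fineK; last by apply: integrable_fin_num => //; apply: fB; rewrite inE in xA.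
    rewrite [RHS]integral_mkcond; apply: eq_integral => y _; rewrite /g !patchE.
    by rewrite in_setX /= xA.
  by apply: integral0_eq => y _; rewrite /g patchE in_setX /= (negbTE xA).
have -> : (\int[leb]_y \int[leb]_x g (x, y) =
    \int[leb]_(y in B) (\int[leb]_(x in A) f (x, y))%:E)%E.
  rewrite [RHS]integral_mkcond; apply: eq_integral => y _.
  rewrite /patch; case: ifPn => yB.
    rewrite /Rintegral fineK; last by apply: integrable_fin_num => //; apply: fA; rewrite inE in yB.
    rewrite [RHS]integral_mkcond; apply: eq_integral => x _; rewrite /g !patchE.
    by rewrite in_setX /= yB andbT.
  by apply: integral0_eq => x _; rewrite /g patchE in_setX /= (negbTE yB) andbF.
by move=> E; congr fine.
Qed.

End fubini_rV.

Section correlation.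
Context (R : realType) (n : nat).
Local Notation V := 'rV[R]_n.
Local Notation leb := (lebesgue_rV R n).
Local Notation e_ i := (delta_mx ord0 i : V).
Implicit Types (a k : V -> R) (x y z : V).

(** The value [s = 1] gives a correlation and [s = -1] a convolution: the
    former serves in duality arguments, the latter in mollification. *)
Definition correlation (A : set V) a (s : R) k z : R :=
  \int[leb]_(x in A) (a x * k (s *: x + z)).

Lemma is_derive_delta_line (F : V -> R) z (v : V) (d : R) :
  is_derive (0 : R) (1 : R) (fun t : R => F (t *: v + z)) d -> is_derive z v F d.
Proof.
move=> [Dg dE].
have E : (fun h : R => h^-1 *: (((fun t : R => F (t *: v + z)) \o shift (0 : R)) (h *: (1 : R)) - F ((0 : R) *: v + z))) =
         (fun h : R => h^-1 *: ((F \o shift z) (h *: v) - F z)).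
  by apply/funext => h /=; rewrite addr0 scale0r add0r [_%:A]mulr1.
by move: Dg dE; rewrite /derivable /derive E => ? ?; exact: DeriveDef.
Qed.

Lemma smooth_lipschitz k (r : R) : smooth k -> exists2 M, 0 <= M &
  forall p w : V, enorm p + enorm w < r -> `|k (p + w) - k p| <= n%:R * `|w| * M.
Proof.
move=> sk; have [M M0 hM] := smooth_bounded_grad r sk; exists M => // p w pw.
have [t t1 E] := @MVT_line _ _ k p w 1 (fun y => @ex_derive _ _ _ _ _ _ _ (smooth_is_dirderiv y w sk)).
have -> : k (p + w) - k p = dirderiv w k (p + t *: w).
  by rewrite -[w in LHS]scale1r E mul1r (@derive_val _ _ _ _ _ _ _ (smooth_is_dirderiv _ w sk)).
apply: dirderiv_bound => // i; apply: hM; rewrite eballE subr0.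
apply: le_lt_trans (ler_enormD _ _) (le_lt_trans _ pw); rewrite lerD2l enormZ.
by rewrite normr1 in t1; rewrite ler_piMl ?enorm_ge0.
Qed.

Lemma enorm_affine_lt (s r : R) x z : 0 <= r -> enorm x <= r ->
  enorm (s *: x + z) <= `|s| * r + enorm z.
Proof.
by move=> r0 xr; apply: le_trans (ler_enormD _ _) _; rewrite enormZ lerD2r ler_wpM2l.
Qed.

Lemma correlation_integrand A a (s : R) k (r : R) z : measurable A -> A `<=` eball 0 r ->
  leb.-integrable A (EFin \o a) -> smooth k ->
  leb.-integrable A (EFin \o (fun x => a x * k (s *: x + z))).
Proof.
move=> mA Ar ia sk.
have [M M0 hM] := smooth_bounded (`|s| * r + enorm z + 1) sk.
have ma : measurable_fun A a by apply/measurable_EFinP; exact: measurable_int ia.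
apply: (le_integrable mA _ _ (integrable_RZ M mA (integrable_norm ia))).
  apply/measurable_EFinP; apply: measurable_funM => //.
  apply: measurable_funTS; apply: continuous_measurable_rV.
  have -> : (fun x => k (s *: x + z)) = (fun x => k (z + s *: x)).
    by apply/funext => x; rewrite addrC.
  exact: (@continuous_affine_rV R n k z s (smooth_continuous sk)).
move=> x Ax /=; rewrite lee_fin normrM normrM normr_id (ger0_norm M0) mulrC.
apply: ler_wpM2r => //; apply: hM; rewrite eballE subr0.
have := Ar x Ax; rewrite eballE subr0 => /ltW xr.
by apply: le_lt_trans (enorm_affine_lt s z (le_trans (enorm_ge0 x) xr) xr) _; rewrite ltrDl.
Qed.

Lemma is_derive_correlation A a (s : R) k (r : R) i z : measurable A -> A `<=` eball 0 r ->
  leb.-integrable A (EFin \o a) -> smooth k ->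
  is_derive z (e_ i) (correlation A a s k) (correlation A a s (pderiv i k) z).
Proof.
move=> mA Ar ia sk; apply: is_derive_delta_line.
have [M M0 hM] := smooth_bounded_grad (`|s| * r + enorm z + 2) sk.
have -> : correlation A a s (pderiv i k) z =
    \int[leb]_(x in A) (a x * pderiv i k (s *: x + ((0 : R) *: e_ i + z))).
  by apply: eq_Rintegral => x _; rewrite scale0r add0r.
apply: (@is_derive_integral R n A (fun t x => a x * k (s *: x + (t *: e_ i + z)))
  (fun t x => a x * pderiv i k (s *: x + (t *: e_ i + z))) (fun x => M * `|a x|) 0 mA).
- by move=> t; exact: correlation_integrand Ar ia sk.
- exact: integrable_RZ mA (integrable_norm ia).
- move=> t x _ _.
  have -> : (fun t : R => a x * k (s *: x + (t *: e_ i + z))) =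
      (fun t : R => a x * k (s *: x + z + t *: e_ i)).
    by apply/funext => u; rewrite [_ *: _ + z]addrC addrA.
  rewrite [t *: _ + z]addrC addrA.
  exact: (is_deriveZ (a x) (is_derive_line (smooth_is_derive i (s *: x + z + t *: e_ i) sk))).
- move=> t x; rewrite subr0 => t1 Ax; rewrite normrM mulrC ler_wpM2r//.
  apply: hM; rewrite eballE subr0.
  have := Ar x Ax; rewrite eballE subr0 => /ltW xr.
  apply: le_lt_trans (enorm_affine_lt s _ (le_trans (enorm_ge0 x) xr) xr) _.
  rewrite -addrA ltrD2l; apply: le_lt_trans (ler_enormD _ _) _; rewrite enorm_delta.
  by lra.
Qed.

Lemma continuous_correlation A a (s : R) k (r : R) : measurable A -> A `<=` eball 0 r ->
  leb.-integrable A (EFin \o a) -> smooth k -> continuous (correlation A a s k).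
Proof.
move=> mA Ar ia sk; apply/continuous_rVP => z e e0.
have [M M0 hM] := smooth_lipschitz (`|s| * r + enorm z + 1) sk.
have [d d0 hd] := @enorm_lt_ball R n 1 ltr01.
pose N := \int[leb]_(x in A) `|a x|.
have N0 : 0 <= N by apply: Rintegral_ge0.
pose D := n%:R * M * N; have D0 : 0 <= D by rewrite !mulr_ge0.
have D1 : 0 < D + 1 by rewrite ltr_wpDl.
exists (Num.min d (e / (D + 1))) => [|y]; first by rewrite lt_min d0 divr_gt0.
rewrite lt_min => /andP[yd ye].
have i1 := correlation_integrand s z mA Ar ia sk.
have i2 := correlation_integrand s y mA Ar ia sk.
rewrite /correlation -RintegralB//.
apply: le_lt_trans (le_normr_Rintegral mA (integrable_RB mA i2 i1)) _.
apply: (@le_lt_trans _ _ (n%:R * `|y - z| * M * N)).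
  rewrite -RintegralZl//; last exact: integrable_norm ia.
  apply: le_Rintegral => //.
  - exact: integrable_norm (integrable_RB mA i2 i1).
  - exact: integrable_RZ mA (integrable_norm ia).
  move=> x Ax; rewrite -mulrBr normrM mulrC ler_wpM2r//.
  have -> : s *: x + y = (s *: x + z) + (y - z) by rewrite -addrA [z + _]addrC subrK.
  apply: hM; have := Ar x Ax; rewrite eballE subr0 => /ltW xr.
  by apply: ler_ltD (hd _ _ yd); exact: enorm_affine_lt (le_trans (enorm_ge0 x) xr) xr.
have -> : n%:R * `|y - z| * M * N = `|y - z| * D by rewrite /D; ring.
apply: (@le_lt_trans _ _ (`|y - z| * (D + 1))); first by rewrite ler_wpM2l// lerDl.
by rewrite -ltr_pdivlMr.
Qed.

Lemma pderiv_correlation A a (s : R) k (r : R) i : measurable A -> A `<=` eball 0 r ->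
  leb.-integrable A (EFin \o a) -> smooth k ->
  pderiv i (correlation A a s k) = correlation A a s (pderiv i k).
Proof.
move=> mA Ar ia sk; apply/funext => z.
exact: is_derive_pderivE (is_derive_correlation s i z mA Ar ia sk).
Qed.

(** Derivatives fall on the smooth factor [k], so the correlations with [a]
    form a class stable under partial derivatives. *)
Lemma smooth_correlation A a (s : R) k (r : R) : measurable A -> A `<=` eball 0 r ->
  leb.-integrable A (EFin \o a) -> smooth k -> smooth (correlation A a s k).
Proof.
move=> mA Ar ia sk.
apply: (@smooth_coind R n (fun F => exists2 k', smooth k' & F = correlation A a s k')).
  move=> _ [k' sk' ->]; split; first exact: continuous_correlation Ar ia sk'.
  move=> i; split; first by move=> x; have [] := is_derive_correlation s i x mA Ar ia sk'.
  by exists (pderiv i k'); [exact: smooth_pderiv|exact: pderiv_correlation Ar ia sk'].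
by exists k.
Qed.

Lemma laplacian_correlation A a (s : R) k (r : R) : measurable A -> A `<=` eball 0 r ->
  leb.-integrable A (EFin \o a) -> smooth k ->
  laplacian (correlation A a s k) = correlation A a s (laplacian k).
Proof.
move=> mA Ar ia sk; apply/funext => z; rewrite /laplacian /correlation.
transitivity (\sum_i correlation A a s (pderiv i (pderiv i k)) z).
  apply: eq_bigr => i _; rewrite (pderiv_correlation s i mA Ar ia sk).
  by rewrite (pderiv_correlation s i mA Ar ia (smooth_pderiv i sk)).
rewrite -Rintegral_sum//; last first.
  by move=> i; exact: correlation_integrand Ar ia (smooth_pderiv i (smooth_pderiv i sk)).
by apply: eq_Rintegral => x _; rewrite mulr_sumr.
Qed.

End correlation.

(** * Quadratic functions and the mean value property *)

Section quadratic_functions.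
Context (R : realType) (n : nat).
Local Notation V := 'rV[R]_n.
Implicit Types (f g v P : V -> R) (x y : V).

(** Quadratic polynomials, described through their second derivatives rather
    than through coefficients: the estimates only use that the Hessian and
    the Laplacian are constant. *)
Definition quadratic P := smooth P /\
  exists m : 'I_n -> 'I_n -> R, forall i j, pderiv j (pderiv i P) = (fun=> m i j).

Lemma quadraticD P Q : quadratic P -> quadratic Q -> quadratic (fun x => P x + Q x).
Proof.
move=> [sP [m mP]] [sQ [l lQ]]; split; first exact: smoothD.
exists (fun i j => m i j + l i j) => i j; rewrite (smooth_pderivD i sP sQ).
by rewrite (smooth_pderivD j (smooth_pderiv i sP) (smooth_pderiv i sQ)) mP lQ.
Qed.

Lemma quadraticZ (c : R) P : quadratic P -> quadratic (fun x => c * P x).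
Proof.
move=> [sP [m mP]]; split; first exact: smoothZ.
exists (fun i j => c * m i j) => i j; rewrite (smooth_pderivZ i c sP).
by rewrite (smooth_pderivZ j c (smooth_pderiv i sP)) mP.
Qed.

Lemma quadratic_cst (c : R) : quadratic (fun=> c).
Proof.
by split; [exact: smooth_cst|exists (fun _ _ => 0) => i j; rewrite !pderiv_cst].
Qed.

Lemma quadratic_sum (I : Type) (r : seq I) (F : I -> V -> R) :
  (forall i, quadratic (F i)) -> quadratic (fun x => \sum_(i <- r) F i x).
Proof.
move=> qF; elim: r => [|i r IH].
  rewrite (_ : (fun _ => _) = fun=> 0); first exact: quadratic_cst.
  by apply/funext => x; rewrite big_nil.
rewrite (_ : (fun _ => _) = fun x => F i x + \sum_(j <- r) F j x); first exact: (quadraticD (qF i) IH).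
by apply/funext => x; rewrite big_cons.
Qed.

Lemma quadratic_coord i : quadratic (fun x => x ord0 i).
Proof.
split; first exact: smooth_coord.
by exists (fun _ _ => 0) => j k; rewrite pderiv_coord pderiv_cst.
Qed.

Lemma quadratic_coordM i j : quadratic (fun x => x ord0 i * x ord0 j).
Proof.
have si := @smooth_coord R n i; have sj := @smooth_coord R n j.
split; first exact: smoothM.
exists (fun k l => (k == j)%:R * (l == i)%:R + (k == i)%:R * (l == j)%:R) => k l.
rewrite (smooth_pderivM k si sj) !pderiv_coord.
have -> : (fun x : V => x ord0 i * (k == j)%:R + x ord0 j * (k == i)%:R) =
   (fun x : V => (k == j)%:R * x ord0 i + (k == i)%:R * x ord0 j).
  by apply/funext => x; rewrite mulrC [X in _ + X]mulrC.
rewrite (smooth_pderivD l (smoothZ _ si) (smoothZ _ sj)).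
by rewrite (smooth_pderivZ l _ si) (smooth_pderivZ l _ sj) !pderiv_coord.
Qed.

Lemma quadratic_affine P (a : V) (s : R) : quadratic P -> quadratic (fun x => P (a + s *: x)).
Proof.
move=> [sP [m mP]]; split; first exact: smooth_affine.
exists (fun i j => s ^+ 2 * m i j) => i j.
by rewrite (pderiv2_affine i j a s sP) mP.
Qed.

Lemma quadratic_laplacian P : quadratic P -> exists c, laplacian P = (fun=> c).
Proof.
move=> [_ [m mP]]; exists (\sum_i m i i); apply/funext => x.
by apply: eq_bigr => i _; rewrite mP.
Qed.

Lemma laplacianB f g : smooth f -> smooth g ->
  laplacian (fun x => f x - g x) = (fun x => laplacian f x - laplacian g x).
Proof.
move=> sf sg; apply/funext => x; rewrite /laplacian -sumrB; apply: eq_bigr => i _.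
rewrite (smooth_pderivB i sf sg).
exact: (congr1 (fun h => h x) (smooth_pderivB i (smooth_pderiv i sf) (smooth_pderiv i sg))).
Qed.

End quadratic_functions.

Section mean_value.
Context (R : realType) (n : nat).
Local Notation V := 'rV[R]_n.
Local Notation leb := (lebesgue_rV R n).
Implicit Types (f g v H P : V -> R) (x y z : V).

Let q : V -> R := @rbump R n 2^-1.
Let rho : V -> R := @bump_slope R n 2^-1.
Let B : set V := eball 0 1.
Let A : set V := eball 0 2^-1.

Definition bump_mass : R := \int[leb]_(y in eball 0 1) @rbump R n 2^-1 y.
Definition slope_mass : R := \int[leb]_(y in eball 0 1) @bump_slope R n 2^-1 y.

Let half_lt1 : 2^-1 < 1 :> R. Proof. lra. Qed.
Let half_ge0 : 0 <= 2^-1 :> R. Proof. lra. Qed.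
Let sq : smooth q. Proof. exact: smooth_bump. Qed.
Let srho : smooth rho. Proof. exact: smooth_bump_slope. Qed.
Let mB : measurable B. Proof. exact: measurable_eball. Qed.
Let mA : measurable A. Proof. exact: measurable_eball. Qed.

Lemma bump_mass_gt0 : 0 < bump_mass.
Proof.
apply: Rintegral_continuous_gt0 => //; first exact: smooth_continuous.
  exact: bump_ge0.
by apply: bump_gt0; rewrite enorm0.
Qed.

Lemma slope_mass_gt0 : 0 < slope_mass.
Proof.
apply: Rintegral_continuous_gt0 => //; first exact: smooth_continuous.
  by move=> x; exact: bump_slope_ge0.
by apply: bump_slope_gt0; rewrite enorm0.
Qed.

Let radial H (s : R) : R := \int[leb]_(y in B) (rho y * H (0 + s *: y)).

Lemma is_derive_radial H (s : R) : smooth H ->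
  is_derive s (1 : R) (radial H) (\int[leb]_(y in B) (rho y * dirderiv y H (0 + s *: y))).
Proof.
move=> sH.
have [M1 M10 hM1] := smooth_bounded 1 srho.
have [M M0 hM] := smooth_bounded_grad (`|s| + 1) sH.
apply: (@is_derive_integral R n B (fun t y => rho y * H (0 + t *: y))
  (fun t y => rho y * dirderiv y H (0 + t *: y)) (fun=> M1 * (n%:R * M)) s mB).
- move=> t; apply: (smooth_integrable _ _ (smoothM srho (smooth_affine 0 t sH))).
- exact: (smooth_integrable _ _ (@smooth_cst R n _)).
- move=> t y _ _.
  exact: (is_deriveZ (rho y) (smooth_is_derive_line 0 y t sH)).
- move=> t y ts By; rewrite normrM; apply: ler_pM => //; first exact: hM1.
  have y1 : enorm y < 1 by have := By; rewrite /B eballE subr0.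
  have h i : `|pderiv i H (0 + t *: y)| <= M.
    apply: hM; rewrite eballE subr0 add0r enormZ.
    apply: (@le_lt_trans _ _ `|t|); first by rewrite ler_piMr// ltW.
    have := ler_normD (t - s) s; rewrite subrK => h; apply: le_lt_trans h _.
    by rewrite addrC ltrD2l.
  apply: le_trans (@dirderiv_bound R n H y _ M M0 h) _; rewrite ler_wpM2r//.
  by rewrite ler_piMr// (le_trans (normr_le_enorm y))// ltW.
Qed.

(** The radial derivative of [H] is turned into its Laplacian by the divergence theorem,
    because [rho y *: y] is minus the gradient of [q]. *)
Lemma radial_derivE H (s : R) : smooth H ->
  \int[leb]_(y in B) (rho y * dirderiv y H (0 + s *: y)) =
  s * \int[leb]_(y in B) (q y * laplacian H (0 + s *: y)).
Proof.
move=> sH; have sL := smooth_laplacian sH.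
have sp i : smooth (fun y => pderiv i H (0 + s *: y)) := smooth_affine 0 s (smooth_pderiv i sH).
have := @Rintegral_divergence R n _ (fun i => i) (fun i y => q y * pderiv i H (0 + s *: y)) 0 2^-1 1 half_lt1
  (fun i => smoothM sq (sp i)).
have -> : (fun y => \sum_k pderiv k (fun y => q y * pderiv k H (0 + s *: y)) y) =
  (fun y => s * (q y * laplacian H (0 + s *: y)) - rho y * dirderiv y H (0 + s *: y)).
  apply/funext => y; rewrite /laplacian /dirderiv !mulr_sumr -sumrB; apply: eq_bigr => i _.
  have -> := congr1 (fun f => f y) (smooth_pderivM i sq (sp i)).
  have -> := congr1 (fun f => f y) (smooth_pderiv_affine i 0 s (smooth_pderiv i sH)).
  have -> : pderiv i q y = - (y ord0 i * rho y) by rewrite /q pderiv_bump.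
  move: (pderiv i H _) (pderiv i (pderiv i H) _) (q y) (rho y) => a b c d.
  by ring.
move=> /(_ _)/wrap[]; first by move=> i y yr; rewrite /q (supported_bump half_ge0 yr) mul0r.
have i1 := @smooth_integrable R n _ 0 1 (smoothM sq (smooth_affine 0 s sL)).
have i2 : leb.-integrable B (EFin \o (fun y => rho y * dirderiv y H (0 + s *: y))).
  apply: (@smooth_integrable R n _ 0 1); apply: (smoothM srho).
  apply: smooth_sum => i; exact: (smoothM (@smooth_coord R n i) (sp i)).
rewrite RintegralB//; last exact: integrable_RZ mB i1.
by rewrite (RintegralZl s mB i1) => /eqP; rewrite subr_eq0 => /eqP.
Qed.

(** A mean value property with a smooth kernel: the averages
    [radial H s] interpolate between [slope_mass * H 0] and the average of [H],
    and by [radial_derivE] their derivative in [s] is [s] times an average of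
    the Laplacian. If the Laplacian is the constant [c], integrating [s] from 0
    to 1 gives [c * bump_mass / 2]. *)
Lemma mean_value H (c M : R) : smooth H ->
  (forall z, enorm z < 2^-1 -> `|laplacian H z - c| <= M) ->
  `|\int[leb]_(y in B) (rho y * H y) - slope_mass * H 0 - c * bump_mass / 2| <= M * bump_mass.
Proof.
move=> sH bL; have sL := smooth_laplacian sH.
have iq := @smooth_integrable R n q 0 1 sq.
pose g (s : R) := radial H s - c * bump_mass / 2 * s ^+ 2.
have Dg (s : R) : is_derive s (1 : R) g
    (s * \int[leb]_(y in B) (q y * laplacian H (0 + s *: y)) - c * bump_mass / 2 * (s *+ 2)).
  apply: is_deriveB; first by rewrite -(radial_derivE s sH); exact: is_derive_radial.
  have := is_derive_poly ((c * bump_mass / 2) *: 'X^2) s.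
  rewrite derivZ derivXn hornerZ hornerMn hornerXn expr1.
  by congr is_derive; apply/funext => t; rewrite hornerZ hornerXn.
have bg (s : R) : 0 <= s <= 1 ->
    `|s * \int[leb]_(y in B) (q y * laplacian H (0 + s *: y)) - c * bump_mass / 2 * (s *+ 2)|
      <= M * bump_mass.
  move=> /andP[s0 s1].
  have iqL := @smooth_integrable R n _ 0 1 (smoothM sq (smooth_affine 0 s sL)).
  have -> : s * \int[leb]_(y in B) (q y * laplacian H (0 + s *: y)) - c * bump_mass / 2 * (s *+ 2)
      = s * \int[leb]_(y in B) (q y * (laplacian H (0 + s *: y) - c)).
    have -> : (fun y => q y * (laplacian H (0 + s *: y) - c)) =
        (fun y => q y * laplacian H (0 + s *: y) - c * q y).
      by apply/funext => y; rewrite mulrBr [c * _]mulrC.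
    rewrite RintegralB//; last exact: integrable_RZ mB iq.
    rewrite (RintegralZl c mB iq) -/bump_mass mulr2n.
    by move: bump_mass (Rintegral _ _ _) => b r; field.
  have M0 : 0 <= M by apply: le_trans (normr_ge0 _) (bL 0 _); rewrite enorm0.
  have i1 := @smooth_integrable R n _ 0 1
    (smoothM sq (smoothB (smooth_affine 0 s sL) (@smooth_cst R n c))).
  rewrite normrM (ger0_norm s0); apply: (@le_trans _ _ (1 * (M * bump_mass))); last by rewrite mul1r.
  apply: ler_pM => //; apply: le_trans (le_normr_Rintegral mB i1) _.
  rewrite -(RintegralZl M mB iq); apply: le_Rintegral => //.
  - exact: integrable_norm.
  - exact: integrable_RZ mB iq.
  - move=> y By; have [y1|y1] := ltP (enorm y) 2^-1; last first.
      by rewrite /q (bump_out half_ge0 y1) mul0r mulr0 normr0.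
    rewrite normrM ger0_norm ?bump_ge0// mulrC ler_wpM2r ?bump_ge0//.
    apply: bL; rewrite add0r enormZ (ger0_norm s0); apply: le_lt_trans y1.
    by rewrite ler_piMl ?enorm_ge0.
have := MVT_bound ler01 Dg bg.
rewrite mulr1 /g expr1n expr0n /= mulr1 mulr0 subr0.
have -> : radial H 1 = \int[leb]_(y in B) (rho y * H y).
  by apply: eq_Rintegral => y _; rewrite scale1r add0r.
have -> : radial H 0 = slope_mass * H 0.
  rewrite -RintegralZr//; last exact: (@smooth_integrable R n rho).
  by apply: eq_Rintegral => y _; rewrite scale0r addr0.
by rewrite addrAC.
Qed.

(** The error in the mean value property of [v] at [x] when the Laplacian is
    compared with the constant [c]. *)
Definition mean_defect v (c : R) x : R :=
  correlation (eball 0 1) (@bump_slope R n 2^-1) 1 v x - slope_mass * v x - c * bump_mass / 2.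

Let irho : leb.-integrable B (EFin \o rho). Proof. exact: smooth_integrable. Qed.

Lemma smooth_mean_defect v c : smooth v -> smooth (mean_defect v c).
Proof.
move=> sv; have s1 := smooth_correlation 1 mB (@subset_refl _ B) irho sv.
exact: (smoothB (smoothB s1 (smoothZ _ sv)) (@smooth_cst R n _)).
Qed.

Lemma sqint_translate g z : smooth g -> enorm z < 2^-1 ->
  sqint A (fun x => g (1 *: x + z)) <= sqint B g.
Proof.
move=> sg z1.
have -> : (fun x => g (1 *: x + z)) = (fun x => g (z + 1 *: x)).
  by apply/funext => x; rewrite addrC.
rewrite /A (sqint_scale ltr01 (smooth_sq_integrable z _ sg)) expr1n invr1 !mul1r.
apply: sqintS => //; [exact: measurable_eball| |exact: smooth_sq_integrable].
by apply: sub_eball; rewrite subr0; lra.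
Qed.

Lemma pairing_translate_le w g z (a : R) : 0 < a -> smooth w -> smooth g -> enorm z < 2^-1 ->
  `|\int[leb]_(x in A) (w x * g (1 *: x + z))| <= a / 2 * sqint A w + a^-1 / 2 * sqint B g.
Proof.
move=> a0 sw sg z1; have h := sqint_translate sg z1.
have sz : smooth (fun x => g (1 *: x + z)).
  have -> : (fun x => g (1 *: x + z)) = (fun x => g (z + 1 *: x)).
    by apply/funext => x; rewrite addrC.
  exact: smooth_affine.
apply: le_trans (Rintegral_prod_le mA a0 (smooth_sq_integrable 0 2^-1 sw) (smooth_sq_integrable 0 2^-1 sz)) _.
by rewrite lerD2l; apply: ler_wpM2l h; rewrite divr_ge0// invr_ge0 ltW.
Qed.

(** By Fubini's theorem, the pairing of the defect of [v] with itself is the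
    defect at the origin of the correlation of [v] with that defect. *)
Lemma pairing_mean_value v c : smooth v ->
  let w := mean_defect v c in
  sqint A w = \int[leb]_(y in B) (rho y * correlation A w 1 v y)
    - slope_mass * correlation A w 1 v 0 - c * (\int[leb]_(x in A) w x) * bump_mass / 2.
Proof.
move=> sv w; have sw : smooth w := smooth_mean_defect c sv.
have sK := smooth_correlation 1 mB (@subset_refl _ B) irho sv.
have iw := @smooth_integrable R n w 0 2^-1 sw.
have E : \int[leb]_(y in B) (rho y * correlation A w 1 v y) =
    \int[leb]_(x in A) (w x * correlation B rho 1 v x).
  have [M1 M10 hM1] := smooth_bounded 2^-1 sw.
  have [M2 M20 hM2] := smooth_bounded 1 srho.
  have [M3 M30 hM3] := smooth_bounded 2 sv.
  pose F (p : V * V) := w p.1 * (rho p.2 * v (1 *: p.2 + p.1)).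
  have mF : measurable_fun setT F.
    apply: measurable_funM.
      by apply: (measurableT_comp (continuous_measurable_rV (smooth_continuous sw))); exact: measurable_fst.
    apply: measurable_funM.
      by apply: (measurableT_comp (continuous_measurable_rV (smooth_continuous srho))); exact: measurable_snd.
    apply: (measurableT_comp (continuous_measurable_rV (smooth_continuous sv))).
    apply: measurable_fun_rV => // i.
    have -> : (fun t : V * V => (1 *: t.2 + t.1) ord0 i) = (fun t : V * V => t.2 ord0 i + t.1 ord0 i).
      by apply/funext => t; rewrite !mxE mul1r.
    apply: measurable_funD.
      by apply: (measurableT_comp (@measurable_coor R n i)); exact: measurable_snd.
    by apply: (measurableT_comp (@measurable_coor R n i)); exact: measurable_fst.
  have bF x y : A x -> B y -> `|F (x, y)| <= M1 * (M2 * M3).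
    move=> Ax By; rewrite normrM; apply: ler_pM => //; first exact: hM1.
    rewrite normrM; apply: ler_pM => //; first exact: hM2.
    apply: hM3; have := Ax; have := By; rewrite /A /B !eballE !subr0 scale1r => yB xA.
    by have := ler_enormD y x; lra.
  rewrite /correlation; symmetry.
  transitivity (\int[leb]_(x in A) \int[leb]_(y in B) (w x * (rho y * v (1 *: y + x)))).
    by apply: eq_Rintegral => x _; rewrite RintegralZl//; exact: correlation_integrand (@subset_refl _ B) irho sv.
  rewrite (Fubini_bounded mA mB (lebesgue_eball_lty _ _) (lebesgue_eball_lty _ _) mF bF).
  apply: eq_Rintegral => y _ /=; rewrite /F /=.
  rewrite -RintegralZl//; last exact: correlation_integrand (@subset_refl _ A) iw sv.
  by apply: eq_Rintegral => x _; rewrite [1 *: x + y]addrC !scale1r [in LHS]mulrCA addrC.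
have i1 := @smooth_integrable R n _ 0 2^-1 (smoothM sw sK).
have i2 := @smooth_integrable R n _ 0 2^-1 (smoothM sw sv).
have -> : correlation A w 1 v 0 = \int[leb]_(x in A) (w x * v x).
  by apply: eq_Rintegral => x _; rewrite scale1r addr0.
rewrite E -(RintegralZl slope_mass mA i2).
have -> : c * (\int[leb]_(x in A) w x) * bump_mass / 2 = \int[leb]_(x in A) (c * bump_mass / 2 * w x).
  by rewrite (RintegralZl _ mA iw); move: (Rintegral _ _ _) bump_mass => r b; field.
have i3 := integrable_RZ slope_mass mA i2; have i4 := integrable_RZ (c * bump_mass / 2) mA iw.
rewrite -(RintegralB mA i1 i3) -(RintegralB mA (integrable_RB mA i1 i3) i4).
apply: eq_Rintegral => x _; rewrite {1}expr2 {2}/w /mean_defect -/rho -/B.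
by move: (w x) (correlation _ _ _ _ _) (v x) slope_mass bump_mass => a1 a2 a3 a4 a5; field.
Qed.

(** A duality argument turns the pointwise estimate [mean_value] into an [L^2]
    estimate: the Laplacian of the correlation of [v] with its defect [w] is the
    correlation of [w] with [laplacian v], and by Young's inequality its
    distance to a constant is bounded uniformly by the [L^2] norms of [w] and
    [laplacian v - c]. *)
Lemma sqint_mean_defect v c : smooth v ->
  sqint A (mean_defect v c) <= bump_mass ^+ 2 * sqint B (fun x => laplacian v x - c).
Proof.
move=> sv; have sL := smooth_laplacian sv.
pose w := mean_defect v c; have sw : smooth w := smooth_mean_defect c sv.
have iw := @smooth_integrable R n w 0 2^-1 sw.
have q0 := bump_mass_gt0.
(* With this weight Young's inequality leaves [X / 2] on the right. *)
pose a := bump_mass^-1; have a0 : 0 < a by rewrite invr_gt0.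
have sg := smoothB sL (@smooth_cst R n c).
set Y := sqint B _; pose X := sqint A w.
have sH := smooth_correlation 1 mA (@subset_refl _ A) iw sv.
have := @mean_value _ (c * \int[leb]_(x in A) w x) (a / 2 * X + a^-1 / 2 * Y) sH.
move=> /(_ _)/wrap[].
  move=> z z1; rewrite (laplacian_correlation 1 mA (@subset_refl _ A) iw sv).
  have -> : correlation A w 1 (laplacian v) z - c * \int[leb]_(x in A) w x =
      \int[leb]_(x in A) (w x * (laplacian v (1 *: x + z) - c)).
    rewrite /correlation -(RintegralZl c mA iw) -RintegralB//; last 2 first.
    - exact: correlation_integrand (@subset_refl _ A) iw sL.
    - exact: integrable_RZ mA iw.
    apply: eq_Rintegral => x _.
    by move: (w x) (laplacian v _) => r1 r2; ring.
  exact: (pairing_translate_le a0 sw sg z1).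
have := pairing_mean_value c sv; rewrite /= -/w => <-; rewrite -/X => hX.
have X0 : 0 <= X by exact: sqint_ge0.
rewrite ger0_norm// in hX.
have E : (a / 2 * X + a^-1 / 2 * Y) * bump_mass = X / 2 + bump_mass ^+ 2 * Y / 2.
  by rewrite /a; field; rewrite gt_eqF.
by rewrite E in hX; rewrite -/X; lra.
Qed.

End mean_value.

(** * Quadratic approximation *)

Section contraction.
Context (R : realType) (n : nat).
Local Notation V := 'rV[R]_n.
Local Notation leb := (lebesgue_rV R n).
Implicit Types (f g v P k : V -> R) (x y z : V).

Let B : set V := eball 0 1.
Let mB : measurable B. Proof. exact: measurable_eball. Qed.

Lemma supported_bounded k (r : R) : smooth k -> supported 0 r k ->
  exists2 M, 0 <= M & forall y, `|k y| <= M.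
Proof.
move=> sk Sk; have [M M0 hM] := smooth_bounded (r + 1) sk; exists M => // y.
have [yr|ry] := leP (enorm y) r; first by apply: hM; rewrite eballE subr0; lra.
by rewrite Sk ?normr0// subr0.
Qed.

Lemma supported_third_bounded k (r : R) : smooth k -> supported 0 r k ->
  exists2 M, 0 <= M & forall i j l y, `|pderiv l (pderiv j (pderiv i k)) y| <= M.
Proof.
move=> sk Sk.
have H (t : 'I_n * 'I_n * 'I_n) : exists2 M, 0 <= M &
    forall y, `|pderiv t.2 (pderiv t.1.2 (pderiv t.1.1 k)) y| <= M.
  have s1 := smooth_pderiv t.1.1 sk; have s2 := smooth_pderiv t.1.2 s1.
  have S2 := supported_pderiv t.1.2 s1 (supported_pderiv t.1.1 sk Sk).
  exact: (supported_bounded (smooth_pderiv t.2 s2) (supported_pderiv t.2 s2 S2)).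
have H' t := cid2 (H t); exists (\sum_t s2val (H' t)) => [|i j l y].
  by apply: sumr_ge0 => t _; exact: (s2valP (H' t)).
apply: le_trans (s2valP' (H' (i, j, l)) y) _; rewrite (bigD1 (i, j, l))//= lerDl.
by apply: sumr_ge0 => t _; exact: (s2valP (H' t)).
Qed.

Lemma correlation_shift k v x (r : R) : smooth k -> supported 0 r k -> smooth v ->
  r + enorm x < 1 ->
  correlation B k 1 v x = \int[leb]_(y in B) (v y * k (y - x)).
Proof.
move=> sk Sk sv rx.
have r1 : r < 1 by apply: le_lt_trans rx; rewrite lerDl enorm_ge0.
pose F y := k y * v (1 *: y + x).
have sF : smooth F.
  have -> : F = (fun y => k y * v (x + 1 *: y)) by apply/funext => y; rewrite /F addrC.
  exact: (smoothM sk (smooth_affine x 1 sv)).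
have SF : supported 0 r F by move=> y yr; rewrite /F (Sk y yr) mul0r.
rewrite /correlation -[LHS](supported_Rintegral r1 SF (@subsetT _ _)).
rewrite -(Rintegral_shift (- x) (supported_integrable (smooth_continuous sF) SF)).
have E : (fun y => F (- x + 1 *: y)) = (fun y => v y * k (y - x)).
  by apply/funext => y; rewrite /F !scale1r addrC subrK mulrC.
rewrite E; apply: (supported_Rintegral rx) => // y yr.
rewrite Sk ?mulr0// subr0; rewrite subr0 in yr.
by have := ler_enormD (y - x) x; rewrite subrK; lra.
Qed.

(** The second Taylor polynomial of [k (y - x)] in the variable [x]. *)
Let taylor2 k x y := k y + dirderiv (- x) k y + 2^-1 * dirderiv (- x) (dirderiv (- x) k) y.

Lemma taylor2E k x y : smooth k -> taylor2 k x y =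
  k y + \sum_i x ord0 i * (- pderiv i k y)
  + \sum_i \sum_j x ord0 i * x ord0 j * (2^-1 * pderiv j (pderiv i k) y).
Proof.
move=> sk; rewrite /taylor2; congr (_ + _ + _).
  by apply: eq_bigr => i _; rewrite mxE mulNr mulrN.
rewrite {1}/dirderiv mulr_sumr; apply: eq_bigr => i _.
rewrite (pderiv_dirderiv (- x) i sk) /dirderiv !mulr_sumr; apply: eq_bigr => j _.
by rewrite !mxE; move: (pderiv j _ y) => d; ring.
Qed.

Lemma quadratic_taylor2 k v : smooth k -> smooth v ->
  quadratic (fun x => \int[leb]_(y in B) (v y * taylor2 k x y)).
Proof.
move=> sk sv; have si i := smooth_pderiv i sk; have sij i j := smooth_pderiv j (si i).
have i0 := @smooth_integrable R n _ 0 1 (smoothM sv sk).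
have i1 i := @smooth_integrable R n _ 0 1 (smoothM sv (smoothZ (-1) (si i))).
have i2 i j := @smooth_integrable R n _ 0 1 (smoothM sv (smoothZ 2^-1 (sij i j))).
have -> : (fun x => \int[leb]_(y in B) (v y * taylor2 k x y)) = (fun x =>
    \int[leb]_(y in B) (v y * k y)
    + \sum_i (\int[leb]_(y in B) (v y * (-1 * pderiv i k y))) * x ord0 i
    + \sum_i \sum_j (\int[leb]_(y in B) (v y * (2^-1 * pderiv j (pderiv i k) y))) * (x ord0 i * x ord0 j)).
  apply/funext => x.
  have E1 : \sum_i (\int[leb]_(y in B) (v y * (-1 * pderiv i k y))) * x ord0 i =
      \int[leb]_(y in B) (\sum_i x ord0 i * (v y * (-1 * pderiv i k y))).
    rewrite (Rintegral_sum mB (fun i => integrable_RZ (x ord0 i) mB (i1 i))).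
    by apply: eq_bigr => i _; rewrite (RintegralZl _ mB (i1 i)) mulrC.
  have j2 i := integrable_fin_sum mB (fun j => integrable_RZ (x ord0 i * x ord0 j) mB (i2 i j)).
  have E2 : \sum_i \sum_j (\int[leb]_(y in B) (v y * (2^-1 * pderiv j (pderiv i k) y))) * (x ord0 i * x ord0 j) =
      \int[leb]_(y in B) (\sum_i \sum_j x ord0 i * x ord0 j * (v y * (2^-1 * pderiv j (pderiv i k) y))).
    rewrite (Rintegral_sum mB j2); apply: eq_bigr => i _.
    rewrite (Rintegral_sum mB (fun j => integrable_RZ (x ord0 i * x ord0 j) mB (i2 i j))).
    by apply: eq_bigr => j _; rewrite (RintegralZl _ mB (i2 i j)) mulrC.
  have j1 := integrable_fin_sum mB (fun i => integrable_RZ (x ord0 i) mB (i1 i)).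
  rewrite E1 E2 -(RintegralD mB i0 j1) -(RintegralD mB (integrable_RD mB i0 j1) (integrable_fin_sum mB j2)).
  apply: eq_Rintegral => y _; rewrite (taylor2E x y sk) !mulrDr; congr (_ + _ + _).
    by rewrite mulr_sumr; apply: eq_bigr => i _; rewrite mulN1r mulrCA.
  by rewrite mulr_sumr; apply: eq_bigr => i _; rewrite mulr_sumr; apply: eq_bigr => j _; rewrite mulrCA.
apply: quadraticD; first apply: quadraticD; first exact: quadratic_cst.
  by apply: quadratic_sum => i; apply: quadraticZ; exact: quadratic_coord.
apply: quadratic_sum => i; apply: quadratic_sum => j; apply: quadraticZ; exact: quadratic_coordM.
Qed.

Lemma correlation_taylor2 k v x (r M : R) : smooth k -> supported 0 r k -> smooth v ->
  r + enorm x < 1 -> 0 <= M ->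
  (forall i j l y, `|pderiv l (pderiv j (pderiv i k)) y| <= M) ->
  `|correlation B k 1 v x - \int[leb]_(y in B) (v y * taylor2 k x y)| <=
    (n%:R * enorm x) ^+ 3 * M * \int[leb]_(y in B) `|v y|.
Proof.
move=> sk Sk sv rx M0 bM; rewrite (correlation_shift sk Sk sv rx).
have skx : smooth (fun y => k (y - x)).
  have -> : (fun y => k (y - x)) = (fun y => k (- x + 1 *: y)).
    by apply/funext => y; rewrite scale1r addrC.
  exact: smooth_affine.
have st : smooth (taylor2 k x).
  have s1 := smooth_dirderiv (- x) sk; have s2 := smooth_dirderiv (- x) s1.
  exact: (smoothD (smoothD sk s1) (smoothZ 2^-1 s2)).
have i1 := @smooth_integrable R n _ 0 1 (smoothM sv skx).
have i2 := @smooth_integrable R n _ 0 1 (smoothM sv st).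
have iv := integrable_norm (@smooth_integrable R n _ 0 1 sv).
rewrite -(RintegralB mB i1 i2); apply: le_trans (le_normr_Rintegral mB (integrable_RB mB i1 i2)) _.
rewrite -(RintegralZl _ mB iv); apply: le_Rintegral => //.
- exact: integrable_norm (integrable_RB mB i1 i2).
- exact: integrable_RZ mB iv.
move=> y _; rewrite -mulrBr normrM mulrC ler_wpM2r//.
apply: le_trans (taylor3 y (- x) sk M0 bM) _; rewrite ler_wpM2r//.
rewrite lerXn2r ?nnegrE ?mulr_ge0 ?enorm_ge0// ler_wpM2l//.
by rewrite normrN normr_le_enorm.
Qed.

(** The third-order Taylor remainder is of size [th ^+ 3] on a ball of radius
    [th]; squaring and integrating over that ball gives [th ^+ (n + 6)]. *)
Lemma sqint_correlation_taylor2 k v (r M th : R) : smooth k -> supported 0 r k -> smooth v ->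
  0 < th -> r + th <= 1 -> 0 <= M ->
  (forall i j l y, `|pderiv l (pderiv j (pderiv i k)) y| <= M) ->
  sqint (eball 0 th) (fun x => correlation B k 1 v x - \int[leb]_(y in B) (v y * taylor2 k x y)) <=
    n%:R ^+ 6 * M ^+ 2 * fine (leb B) * unit_ball_volume R n * (th ^+ (n + 6) * sqint B v).
Proof.
move=> sk Sk sv th0 rt M0 bM.
have ik := @smooth_integrable R n k 0 1 sk; have mth := @measurable_eball R n 0 th.
have sc := smooth_correlation 1 mB (@subset_refl _ B) ik sv.
have [sT _] := quadratic_taylor2 sk sv.
pose D := (n%:R * th) ^+ 3 * M * \int[leb]_(y in B) `|v y|.
have I0 : 0 <= \int[leb]_(y in B) `|v y| by apply: Rintegral_ge0.
have D0 : 0 <= D.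
  exact: (mulr_ge0 (mulr_ge0 (exprn_ge0 3 (mulr_ge0 (ler0n _ _) (ltW th0))) M0) I0).
have [_ i2] := smooth_sq_integrable 0 th (smoothB sc sT).
have [_ iD] := smooth_sq_integrable 0 th (@smooth_cst R n D).
apply: (@le_trans _ _ (sqint (eball (0 : V) th) (fun=> D))).
  apply: le_Rintegral => // x; rewrite eballE subr0 => xt.
  have x1 : r + enorm x < 1 by apply: lt_le_trans rt; rewrite ltrD2l.
  rewrite -[leLHS](real_normK (num_real _)); apply: lerXn2r; rewrite ?nnegrE//.
  apply: le_trans (correlation_taylor2 sk Sk sv x1 M0 bM) _.
  apply: ler_wpM2r => //; apply: ler_wpM2r => //.
  by rewrite lerXn2r ?nnegrE ?mulr_ge0 ?enorm_ge0 ?(ltW th0)// ler_wpM2l// ltW.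
rewrite (sqint_cst D mth) (lebesgue_eball _ th0) /= /D.
have := Rintegral_norm_sqr_le mB (lebesgue_eball_lty _ _) (smooth_sq_integrable 0 1 sv).
move: (Rintegral _ _ _) (fine _) (sqint _ _) (unit_ball_volume_gt0 R n) => I m S.
move: (unit_ball_volume R n) => w w0 hI.
have -> : ((n%:R * th) ^+ 3 * M * I) ^+ 2 * (th ^+ n * w) =
   n%:R ^+ 6 * M ^+ 2 * w * th ^+ (n + 6) * I ^+ 2 by rewrite exprD; ring.
have -> : n%:R ^+ 6 * M ^+ 2 * m * w * (th ^+ (n + 6) * S) =
   n%:R ^+ 6 * M ^+ 2 * w * th ^+ (n + 6) * (m * S) by ring.
by apply: ler_wpM2l hI; rewrite !mulr_ge0 ?sqr_ge0 ?exprn_ge0// ltW.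
Qed.

(** Up to its [mean_defect], which is controlled by the oscillation of the
    Laplacian, [v] is a smooth average of itself. All derivatives of that
    average are controlled by the [L^2] norm of [v], so its Taylor polynomial
    of degree two approximates [v] on small balls. *)
Lemma quadratic_approximation_unit : exists2 C, 0 <= C & forall (th : R) v c,
  0 < th <= 2^-1 -> smooth v -> exists2 P, quadratic P &
  sqint (eball 0 th) (fun x => v x - P x) <=
    C * (th ^+ (n + 6) * sqint B v + sqint B (fun x => laplacian v x - c)).
Proof.
pose k := @bump_slope R n 2^-1.
have h0 : 0 <= 2^-1 :> R by lra.
have sk : smooth k := @smooth_bump_slope R n _; have Sk : supported 0 2^-1 k := supported_bump_slope h0.
have [M M0 bM] := supported_third_bounded sk Sk.
pose K := n%:R ^+ 6 * M ^+ 2 * fine (leb B) * unit_ball_volume R n.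
have w0 := ltW (unit_ball_volume_gt0 R n).
have K0 : 0 <= K by rewrite !mulr_ge0 ?exprn_ge0 ?sqr_ge0// fine_ge0.
pose c0 := slope_mass R n; have c00 : 0 < c0 := @slope_mass_gt0 R n.
pose q1 := bump_mass R n.
have C20 : 0 <= 2 * (K + q1 ^+ 2) by rewrite mulr_ge0// addr_ge0// sqr_ge0.
exists (c0^-1 ^+ 2 * (2 * (K + q1 ^+ 2))) => [|th v c /andP[th0 th1] sv].
  by rewrite mulr_ge0// sqr_ge0.
pose T x := \int[leb]_(y in B) (v y * taylor2 k x y).
have qT : quadratic T := quadratic_taylor2 sk sv.
exists (fun x => c0^-1 * (T x + - (c * q1 / 2))).
  exact: (quadraticZ _ (quadraticD qT (@quadratic_cst R n _))).
have ik := @smooth_integrable R n k 0 1 sk; have mth := @measurable_eball R n 0 th.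
have sc := smooth_correlation 1 mB (@subset_refl _ B) ik sv.
have sw := smooth_mean_defect c sv.
pose w := mean_defect v c.
have E : (fun x => v x - c0^-1 * (T x + - (c * q1 / 2))) =
    (fun x => c0^-1 * ((correlation B k 1 v x - T x) - w x)).
  apply/funext => x; rewrite /w /mean_defect -/k -/B -/c0 -/q1.
  by move: (correlation _ _ _ _ _) (T x) (v x) => a1 a2 a3; field; rewrite gt_eqF.
have [sT _] := qT; have s1 := smoothB sc sT.
rewrite E (sqintZ _ mth (smooth_sq_integrable 0 th (smoothB s1 sw))) -[leRHS]mulrA.
apply: ler_wpM2l; first exact: sqr_ge0.
apply: le_trans (sqintB_le mth (smooth_sq_integrable 0 th s1) (smooth_sq_integrable 0 th sw)) _.
have h1 : sqint (eball 0 th) (fun x => correlation B k 1 v x - T x) <= K * (th ^+ (n + 6) * sqint B v).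
  by apply: (sqint_correlation_taylor2 (r := 2^-1)) => //; lra.
have h2 : sqint (eball 0 th) w <= q1 ^+ 2 * sqint B (fun x => laplacian v x - c).
  apply: le_trans (sqint_mean_defect c sv); apply: sqintS => //.
  - exact: measurable_eball.
  - exact: subset_eball.
  - exact: smooth_sq_integrable.
apply: le_trans (lerD (ler_wpM2l _ h1) (ler_wpM2l _ h2)) _ => //.
have : 0 <= th ^+ (n + 6) * sqint B v by rewrite mulr_ge0 ?exprn_ge0 ?sqint_ge0// ltW.
have := sqint_ge0 B (fun x => laplacian v x - c).
move: (_ ^+ (n + 6) * _) (sqint B _) => a b b0 a0.
have := mulr_ge0 K0 b0; have := mulr_ge0 (sqr_ge0 q1) a0.
by move: (q1 ^+ 2) => q2 e1 e2; nra.
Qed.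

(** The gain [th ^+ (n + 6)] beats the factor [th ^+ (n + 4)] by which the
    squared [L^2] norm of a quadratic monomial scales; this is what makes the
    approximation improve under iteration. *)
Lemma quadratic_approximation : exists2 C, 0 <= C & forall (th : R) v c x0 (r : R),
  0 < th <= 2^-1 -> 0 < r -> smooth v -> exists2 P, quadratic P &
  sqint (eball x0 (th * r)) (fun x => v x - P x) <=
    C * (th ^+ (n + 6) * sqint (eball x0 r) v
         + r ^+ 4 * sqint (eball x0 r) (fun x => laplacian v x - c)).
Proof.
have [C C0 hC] := quadratic_approximation_unit; exists C => // th v c x0 r th1 r0 sv.
have sL := smooth_laplacian sv; have sg := smoothB sL (@smooth_cst R n c).
have [P qP] := hC th _ (r ^+ 2 * c) th1 (smooth_affine x0 r sv).
have rn : 0 < r ^+ n by rewrite exprn_gt0.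
rewrite (laplacian_affine x0 r sv).
have -> : (fun y => r ^+ 2 * laplacian v (x0 + r *: y) - r ^+ 2 * c) =
    (fun y => r ^+ 2 * (laplacian v (x0 + r *: y) - c)) by apply/funext => y; rewrite mulrBr.
have S1 : sq_integrable (eball x0 (r * 1)) v := smooth_sq_integrable _ _ sv.
have S2 : sq_integrable (eball x0 (r * 1)) (fun y => laplacian v y - c) := smooth_sq_integrable _ _ sg.
rewrite (sqintZ (r ^+ 2) mB (smooth_sq_integrable 0 1 (smooth_affine x0 r sg))) -exprM.
rewrite /B (sqint_scale r0 S1) (sqint_scale r0 S2) mulr1.
pose Q y := P (- (r^-1 *: x0) + r^-1 *: y).
have qQ : quadratic Q := quadratic_affine _ _ qP.
have [sQ _] := qQ.
have -> : (fun x => v (x0 + r *: x) - P x) = (fun x => v (x0 + r *: x) - Q (x0 + r *: x)).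
  apply/funext => x; rewrite /Q scalerDr scalerA mulVf ?gt_eqF// scale1r addrA.
  by rewrite [- _ + _]addrC subrr add0r.
have S3 : sq_integrable (eball x0 (r * th)) (fun x => v x - Q x) := smooth_sq_integrable _ _ (smoothB sv sQ).
rewrite (sqint_scale r0 S3) [th * r]mulrC => H; exists Q => //.
rewrite -(ler_pM2l (_ : 0 < (r ^+ n)^-1)) ?invr_gt0//; apply: le_trans H _.
move: (sqint (eball x0 r) v) => a; move: (sqint (eball x0 r) _) => b.
rewrite le_eqVlt; apply/orP; left; apply/eqP.
by ring.
Qed.

End contraction.

(** * Density of Lipschitz functions *)

Section lipschitz_density.
Context (R : realType) (n : nat).
Local Notation V := 'rV[R]_n.
Local Notation leb := (lebesgue_rV R n).
Implicit Types (f g w d : V -> R) (x y : V) (A B S : set V).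

Definition lipschitz_rV f := exists2 L : R, 0 <= L & forall x y, `|f x - f y| <= L * `|x - y|.

Lemma lipschitz_rVD f g : lipschitz_rV f -> lipschitz_rV g -> lipschitz_rV (fun x => f x + g x).
Proof.
move=> [L L0 hL] [M M0 hM]; exists (L + M) => [|x y]; first exact: addr_ge0.
by rewrite opprD addrACA mulrDl (le_trans (ler_normD _ _))// lerD.
Qed.

Lemma lipschitz_rVZ (c : R) f : lipschitz_rV f -> lipschitz_rV (fun x => c * f x).
Proof.
move=> [L L0 hL]; exists (`|c| * L) => [|x y]; first exact: mulr_ge0.
by rewrite -mulrBr normrM -mulrA ler_wpM2l.
Qed.

Lemma lipschitz_rV_cst (c : R) : lipschitz_rV (fun=> c).
Proof. by exists 0 => // x y; rewrite subrr normr0 mul0r. Qed.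

Lemma lipschitz_rV_coord i (a : R) : lipschitz_rV (fun x => x ord0 i - a).
Proof.
exists 1 => // x y; rewrite opprB addrA subrK mul1r.
by have := normr_coord_le (x - y) i; rewrite !mxE.
Qed.

Lemma lipschitz_rV_min f g : lipschitz_rV f -> lipschitz_rV g ->
  lipschitz_rV (fun x => Num.min (f x) (g x)).
Proof.
move=> [L L0 hL] [M M0 hM]; exists (L + M) => [|x y]; first exact: addr_ge0.
have := hL x y; have := hM x y; rewrite mulrDl !ler_norml.
have : 0 <= L * `|x - y| by rewrite mulr_ge0.
have : 0 <= M * `|x - y| by rewrite mulr_ge0.
case: (leP (f x) (g x)); case: (leP (f y) (g y)) => h1 h2 h3 h4 /andP[h5 h6] /andP[h7 h8];
  by apply/andP; split; lra.
Qed.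

Lemma lipschitz_rV_max0 f : lipschitz_rV f -> lipschitz_rV (fun x => Num.max 0 (f x)).
Proof.
move=> [L L0 hL]; exists L => // x y; have := hL x y; rewrite !ler_norml.
have : 0 <= L * `|x - y| by rewrite mulr_ge0.
case: (leP 0 (f x)); case: (leP 0 (f y)) => h1 h2 h3 /andP[h5 h6];
  by apply/andP; split; lra.
Qed.

Lemma lipschitz_rV_continuous f : lipschitz_rV f -> continuous f.
Proof.
move=> [L L0 hL]; apply/continuous_rVP => x e e0; have L1 : 0 < L + 1 by rewrite ltr_wpDl.
exists (e / (L + 1)) => [|y yx]; first by rewrite divr_gt0.
apply: le_lt_trans (hL y x) _; apply: (@le_lt_trans _ _ ((L + 1) * `|y - x|)).
  by rewrite ler_wpM2r// lerDl.
by rewrite mulrC -ltr_pdivlMr.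
Qed.

Lemma sqint_dominated B (w_ : nat -> V -> R) w h (e : R) : measurable B ->
  (forall k, measurable_fun B (w_ k)) -> measurable_fun B w ->
  leb.-integrable B (EFin \o h) ->
  (forall k x, B x -> (w_ k x - w x) ^+ 2 <= h x) ->
  (forall x, B x -> (fun k => w_ k x) @ \oo --> w x) ->
  0 < e -> exists k, sqint B (fun x => w x - w_ k x) < e.
Proof.
move=> mB mw_ mw ih hb cw e0.
have ms k : measurable_fun B (fun x => ((w_ k x - w x) ^+ 2)%:E).
  by apply/measurable_EFinP; apply: measurable_funX; exact: measurable_funB.
have f_f : {ae leb, forall x, B x -> (fun k => ((w_ k x - w x) ^+ 2)%:E) @ \oo --> (0 : \bar R)%E}.
  apply: aeW => x Bx; apply: cvg_EFin; first exact: nearW.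
  have h1 : (fun k => w_ k x - w x) @ \oo --> 0.
    by rewrite -(subrr (w x)); apply: cvgB; [exact: cw|exact: cvg_cst].
  rewrite (_ : _ \o _ = (fun k => (w_ k x - w x) * (w_ k x - w x))); last first.
    by apply/funext => k /=; rewrite expr2.
  by rewrite -(mulr0 0); exact: cvgM.
have f_h : {ae leb, forall x (k : nat), B x -> (`|((w_ k x - w x) ^+ 2)%:E| <= (EFin \o h) x)%E}.
  by apply: aeW => x k Bx /=; rewrite lee_fin ger0_norm ?sqr_ge0// hb.
have [_ + _] := dominated_convergence mB
  ms (@measurable_cst _ _ _ _ B (0 : \bar R)%E) f_f ih f_h.
move=> /fine_cvgP[_ /cvgrPdist_lt/(_ e e0)[N _ /(_ N (leqnn N))]] /=.
rewrite sub0r normrN => H; exists N; apply: le_lt_trans H; apply: le_trans (ler_norm _) _.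
rewrite le_eqVlt; apply/orP; left; apply/eqP; congr (`|fine _|); apply: eq_integral => x _.
by rewrite subr0 ger0_norm ?sqr_ge0// -sqrrN opprB.
Qed.

Section approximable.
Variables (B : set V) (x0 : V) (r0 : R).
Hypotheses (mB : measurable B) (Br : B `<=` eball x0 r0).

Let Boo : (leb B < +oo)%E.
Proof.
apply: le_lt_trans (lebesgue_eball_lty x0 r0); apply: le_measure => //; rewrite ?inE//.
exact: measurable_eball.
Qed.

Lemma lipschitz_sq_integrable g : lipschitz_rV g -> sq_integrable B g.
Proof. by move=> /lipschitz_rV_continuous cg; exact: sq_integrable_continuous cg mB Br. Qed.

Definition lipschitz_approximable w := sq_integrable B w /\
  forall e : R, 0 < e -> exists2 g, lipschitz_rV g & sqint B (fun x => w x - g x) <= e.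

Lemma lipschitz_approximable_self g : lipschitz_rV g -> lipschitz_approximable g.
Proof.
move=> Lg; split; first exact: lipschitz_sq_integrable.
move=> e e0; exists g => //; rewrite (_ : (fun _ => _) = fun=> 0).
  by rewrite sqint_cst// expr0n mul0r ltW.
by apply/funext => x; rewrite subrr.
Qed.

Lemma lipschitz_approximableD w1 w2 : lipschitz_approximable w1 -> lipschitz_approximable w2 ->
  lipschitz_approximable (fun x => w1 x + w2 x).
Proof.
move=> [S1 h1] [S2 h2]; split; first exact: sq_integrableD.
move=> e e0; have e4 : 0 < e / 4 by rewrite divr_gt0.
have [g1 L1 H1] := h1 _ e4; have [g2 L2 H2] := h2 _ e4.
exists (fun x => g1 x + g2 x); first exact: lipschitz_rVD.
rewrite (_ : (fun _ => _) = fun x => (w1 x - g1 x) + (w2 x - g2 x)); last first.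
  by apply/funext => x; rewrite opprD addrACA.
apply: le_trans (sqintD_le mB (sq_integrableB mB S1 (lipschitz_sq_integrable L1))
  (sq_integrableB mB S2 (lipschitz_sq_integrable L2))) _.
by lra.
Qed.

Lemma lipschitz_approximableZ (c : R) w : lipschitz_approximable w ->
  lipschitz_approximable (fun x => c * w x).
Proof.
move=> [Sw h]; split; first exact: sq_integrableZ.
move=> e e0; have c1 : 0 < c ^+ 2 + 1 by rewrite ltr_wpDl ?sqr_ge0.
have [g Lg H] := h _ (divr_gt0 e0 c1); exists (fun x => c * g x); first exact: lipschitz_rVZ.
rewrite (_ : (fun _ => _) = fun x => c * (w x - g x)); last by apply/funext => x; rewrite mulrBr.
rewrite (sqintZ c mB (sq_integrableB mB Sw (lipschitz_sq_integrable Lg))).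
have := sqint_ge0 B (fun x => w x - g x); rewrite ler_pdivlMr// in H.
by move: (sqint _ _) H => s H s0; rewrite mulrC; lra.
Qed.

Lemma lipschitz_approximable_lim w : sq_integrable B w ->
  (forall e : R, 0 < e -> exists2 g, lipschitz_approximable g & sqint B (fun x => w x - g x) < e) ->
  lipschitz_approximable w.
Proof.
move=> Sw h; split => // e e0; have e4 : 0 < e / 4 by rewrite divr_gt0.
have [g [Sg hg] H1] := h _ e4; have [g' Lg' H2] := hg _ e4; exists g' => //.
have := sqint_triangle mB Sw Sg (lipschitz_sq_integrable Lg'); lra.
Qed.

Let mi S : measurable S -> measurable_fun B (\1_S : V -> R).
Proof. by move=> mS; exact: measurable_indic. Qed.

(** These sets are stable under intersection and generate the Borel sets, and
    their indicators are increasing limits of Lipschitz functions: they are the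
    starting point of a Dynkin argument. *)
Definition positivity_set S := exists2 d, lipschitz_rV d & S = [set x | 0 < d x].

Lemma measurable_positivity_sets : @measurable _ V = <<s positivity_set >>.
Proof.
apply/seteqP; split => S.
  move=> mS.
  suff : measurable_fun setT (id : g_sigma_algebraType positivity_set -> V).
    by move=> /(_ measurableT S mS); rewrite setTI.
  apply: measurable_fun_rV => // i.
  apply: (measurability _ (RGenOInfty.measurableE R)) => _ [_ [a ->] <-].
  apply: sub_sigma_algebra; exists (fun x => x ord0 i - a); first exact: lipschitz_rV_coord.
  by rewrite setTI; apply/seteqP; split => x /=; rewrite in_itv/= andbT subr_gt0.
apply: smallest_sub; first exact: sigma_algebra_measurable.
move=> _ [d Ld ->].
have := @continuous_measurable_rV R n d (lipschitz_rV_continuous Ld) measurableT _ (@measurable_itv R `]0, +oo[).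
by rewrite setTI; congr measurable; apply/seteqP; split => x /=; rewrite in_itv/= andbT.
Qed.

Lemma sq_integrable_indic S : measurable S -> sq_integrable B (\1_S : V -> R).
Proof.
move=> mS; split; first exact: measurable_indic.
apply: measurable_bounded_integrable => //.
  by apply: measurable_funX; exact: measurable_indic.
exists 1; split => // M /ltW M1 x _ /=; rewrite indicE; case: (_ \in _); rewrite /= ?expr1n ?expr0n ?normr1 ?normr0//.
by rewrite (le_trans ler01).
Qed.

Lemma lipschitz_approximable_positivity d : lipschitz_rV d ->
  measurable [set x | 0 < d x] -> lipschitz_approximable (\1_[set x | 0 < d x] : V -> R).
Proof.
move=> Ld mS; set S := [set x | _] in mS *.
apply: lipschitz_approximable_lim; first exact: sq_integrable_indic.
(* These Lipschitz functions increase to the indicator of the set. *)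
move=> e e0; pose g (k : nat) x := Num.min 1 (k%:R * Num.max 0 (d x)).
have Lg k : lipschitz_rV (g k).
  apply: lipschitz_rV_min; first exact: lipschitz_rV_cst.
  by apply: lipschitz_rVZ; exact: lipschitz_rV_max0.
have h k x : B x -> (g k x - \1_S x) ^+ 2 <= 1.
  have g1 : g k x <= 1 by rewrite /g ge_min lexx.
  have g0 : 0 <= g k x by rewrite /g le_min ler01 mulr_ge0// le_max lexx.
  by move=> _; rewrite indicE; case: (x \in S) => /=; rewrite ?mulr1n ?mulr0n; nra.
have c x : B x -> (fun k => g k x) @ \oo --> (\1_S x : R).
  move=> _; rewrite indicE; have [xS|xS] := boolP (x \in S).
    have dx : 0 < d x by move: xS; rewrite inE.
    apply: cvg_near_cst; exists (Num.trunc (d x)^-1).+1 => // k /= hk.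
    rewrite /g (max_r (ltW dx)) min_l// -ler_pdivrMr// mul1r ltW//.
    by apply: lt_le_trans (truncnS_gt _) _; rewrite ler_nat.
  have dx : d x <= 0 by move: xS; rewrite notin_setE /S /= => /negP; rewrite -leNgt.
  by rewrite /g (max_l dx); apply: cvg_near_cst; apply: nearW => k; rewrite mulr0 min_r.
have mg k : measurable_fun B (g k).
  by apply: measurable_funTS; apply: continuous_measurable_rV; exact: lipschitz_rV_continuous.
have i1 := sq_integrable_integrable mB Boo (sq_integrable_cst 1 mB Boo).
have [k hk] := sqint_dominated mB mg (mi mS) i1 h c e0.
by exists (g k) => //; exact: lipschitz_approximable_self.
Qed.

Lemma lipschitz_approximable_indic S : measurable S -> lipschitz_approximable (\1_S : V -> R).
Proof.
move=> mS; have := mS; rewrite measurable_positivity_sets => mS'.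
apply: (@dynkin_induction _ V positivity_set (fun S => lipschitz_approximable \1_S)) => //.
- exact: measurable_positivity_sets.
- move=> _ _ [d1 L1 ->] [d2 L2 ->]; exists (fun x => Num.min (d1 x) (d2 x)).
    exact: lipschitz_rV_min.
  by apply/seteqP; split => x /=; rewrite lt_min => /andP.
- by rewrite indicT; apply: lipschitz_approximable_self; exact: lipschitz_rV_cst.
- move=> T GT; have mT : measurable T by rewrite measurable_positivity_sets; exact: sub_sigma_algebra.
  by move: GT mT => [d Ld ->]; exact: lipschitz_approximable_positivity.
- move=> T mT aT; rewrite indicC.
  have := lipschitz_approximableD (lipschitz_approximable_self (lipschitz_rV_cst 1)) (lipschitz_approximableZ (-1) aT).
  by congr lipschitz_approximable; apply/funext => x /=; rewrite indicE; case: (x \in T) => /=; lra.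
- move=> F mF tF aF; apply: lipschitz_approximable_lim.
    by apply: sq_integrable_indic; exact: bigcup_measurable.
  move=> e e0; pose g (k : nat) x := \sum_(i < k) (\1_(F i) x : R).
  have ag k : lipschitz_approximable (g k).
    rewrite /g; elim: k => [|k IH].
      rewrite (_ : (fun _ => _) = fun=> 0); last by apply/funext => x; rewrite big_ord0.
      by apply: lipschitz_approximable_self; exact: lipschitz_rV_cst.
    rewrite (_ : (fun _ => _) = fun x => \sum_(i < k) (\1_(F i) x : R) + \1_(F k) x).
      exact: lipschitz_approximableD.
    by apply/funext => x; rewrite big_ord_recr.
  have gE k x i : F i x -> g k x = (i < k)%:R.
    move=> Fix; have Fj j : j != i -> \1_(F j) x = 0 :> R.
      move=> ji; rewrite indicE memNset// => Fjx; move/eqP: ji; apply.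
      by apply: (tF j i) => //; exists x.
    rewrite /g; have [ik|ki] := ltnP i k.
      rewrite (bigD1 (Ordinal ik))//= big1; last first.
        by move=> j ji; apply: Fj; apply: contra ji => /eqP ji; apply/eqP/val_inj.
      by rewrite addr0 indicE mem_set.
    by rewrite big1// => j _; apply: Fj; rewrite neq_ltn (leq_trans (ltn_ord j) ki).
  have g0 k x : ~ (\bigcup_k F k) x -> g k x = 0.
    by move=> nF; rewrite /g big1// => j _; rewrite indicE memNset// => Fj; apply: nF; exists j.
  have h k x : B x -> (g k x - \1_(\bigcup_k F k) x) ^+ 2 <= 1.
    move=> _; rewrite indicE; have [xF|xF] := boolP (x \in _).
      move: xF; rewrite inE => -[i _ /(gE k) ->]; case: (i < k)%N => /=.
        by rewrite subrr expr0n.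
      by rewrite sub0r sqrrN expr1n.
    by rewrite g0; [rewrite subrr expr0n|move: xF; rewrite notin_setE].
  have c x : B x -> (fun k => g k x) @ \oo --> (\1_(\bigcup_k F k) x : R).
    move=> _; rewrite indicE; have [xF|xF] := boolP (x \in _).
      move: xF; rewrite inE => -[i _ Fix].
      apply: cvg_near_cst; exists i.+1 => // k /= ik.
      by rewrite (gE k x i Fix) ik.
    apply: cvg_near_cst; apply: nearW => k; rewrite g0//.
    by move: xF; rewrite notin_setE.
  have mg k : measurable_fun B (g k) by have [[]] := ag k.
  have i1 := sq_integrable_integrable mB Boo (sq_integrable_cst 1 mB Boo).
  have mU : measurable (\bigcup_k F k) by exact: bigcup_measurable.
  have [k hk] := sqint_dominated mB mg (mi mU) i1 h c e0.
  by exists (g k).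
Qed.

Lemma lipschitz_approximable_sum (m : nat) (F : 'I_m -> V -> R) :
  (forall i, lipschitz_approximable (F i)) -> lipschitz_approximable (fun x => \sum_i F i x).
Proof.
move=> aF; elim: (index_enum _) => [|i s IH].
  rewrite (_ : (fun _ => _) = fun=> 0); last by apply/funext => x; rewrite big_nil.
  by apply: lipschitz_approximable_self; exact: lipschitz_rV_cst.
rewrite (_ : (fun _ => _) = fun x => F i x + \sum_(j <- s) F j x); first exact: lipschitz_approximableD.
by apply/funext => x; rewrite big_cons.
Qed.

Import HBNNSimple.

Lemma lipschitz_approximable_nnsfun (f : {nnsfun V >-> R}) : lipschitz_approximable f.
Proof.
rewrite (funext (fimfunEord f)).
apply: lipschitz_approximable_sum => i; apply: lipschitz_approximableZ.
apply: lipschitz_approximable_indic.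
by rewrite -[X in measurable X]setTI; exact: measurable_funPT.
Qed.

(** Approximable functions form a closed subspace of [L^2]; it contains the
    indicators of measurable sets, hence simple functions, hence nonnegative
    functions by dominated convergence. *)
Lemma lipschitz_dense w : sq_integrable B w -> lipschitz_approximable w.
Proof.
have pos v : sq_integrable B v -> (forall x, B x -> 0 <= v x) -> lipschitz_approximable v.
  move=> Sv v0; have [mv v2] := Sv.
  have mv' : measurable_fun B (EFin \o v) by exact/measurable_EFinP.
  pose s (k : nat) := nnsfun_approx mB mv' k.
  have v0' x : B x -> (0 <= (EFin \o v) x)%E by move=> Bx; rewrite lee_fin v0.
  have c x : B x -> (fun k => s k x) @ \oo --> v x.
    by move=> Bx; have /fine_cvgP[] := cvg_nnsfun_approx mB mv' v0' Bx.
  apply: lipschitz_approximable_lim => // e e0.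
  have h k x : B x -> (s k x - v x) ^+ 2 <= v x ^+ 2.
    move=> Bx; have s0 : 0 <= s k x by exact: fun_ge0.
    have sv : s k x <= v x.
      have nd : nondecreasing_seq (fun k => s k x).
        by move=> a b ab; exact: (lefP _ _ (nd_nnsfun_approx mB mv' ab)).
      by rewrite -(cvg_lim (@Rhausdorff R) (c x Bx)); apply: nondecreasing_cvgn_le nd _ _; apply/cvg_ex; exists (v x); exact: c.
    by have := v0 x Bx; nra.
  have ms k : measurable_fun B (s k) by exact: measurable_funTS.
  have [k hk] := sqint_dominated mB ms mv v2 h c e0.
  by exists (s k) => //; exact: lipschitz_approximable_nnsfun.
move=> Sw; have [mw w2] := Sw.
have mp v : sq_integrable B v -> sq_integrable B (fun x => Num.max 0 (v x)).
  move=> [mv v2]; have mm : measurable_fun B (fun x => Num.max 0 (v x)) by exact: measurable_maxr.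
  split => //; apply: (le_integrable mB _ _ v2).
    by apply/measurable_EFinP; exact: measurable_funX.
  by move=> x _ /=; rewrite lee_fin !ger0_norm ?sqr_ge0//; case: (leP 0 (v x)) => ?; nra.
have p (v : V -> R) x : B x -> 0 <= Num.max 0 (v x) by rewrite le_max lexx.
have a1 := pos _ (mp _ Sw) (p w).
have a2 := pos _ (mp _ (sq_integrableZ (-1) mB Sw)) (p (fun x => -1 * w x)).
have := lipschitz_approximableD a1 (lipschitz_approximableZ (-1) a2).
congr lipschitz_approximable; apply/funext => x.
by case: (leP 0 (w x)); case: (leP 0 (-1 * w x)) => h1 h2; lra.
Qed.

End approximable.
End lipschitz_density.

(** * Mollification *)

Section mollification.
Context (R : realType) (n : nat).
Local Notation V := 'rV[R]_n.
Local Notation leb := (lebesgue_rV R n).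
Implicit Types (f g w h k : V -> R) (x y z : V) (A B : set V).

Definition mollifier (e : R) z : R := (\int[leb]_y @rbump R n e y)^-1 * @rbump R n e z.

Definition mollify B w (e : R) : V -> R := correlation B w (-1) (mollifier e).

Lemma smooth_mollifier (e : R) : smooth (mollifier e).
Proof. exact: (smoothZ _ (@smooth_bump R n e)). Qed.

Lemma supported_mollifier (e : R) : 0 <= e -> supported 0 e (mollifier e).
Proof. by move=> e0 y ye; rewrite /mollifier (supported_bump e0 ye) mulr0. Qed.

Lemma mollifier_ge0 (e : R) z : 0 <= mollifier e z.
Proof.
by rewrite mulr_ge0 ?bump_ge0// invr_ge0 Rintegral_ge0// => y _; exact: bump_ge0.
Qed.

Lemma mollifierN (e : R) z : mollifier e (- z) = mollifier e z.
Proof. by rewrite /mollifier bumpN. Qed.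

Lemma Rintegral_mollifier (e : R) : 0 < e -> \int[leb]_z mollifier e z = 1.
Proof.
move=> e0; have S := @supported_bump R n e (ltW e0).
have sb := @smooth_bump R n e; have ib := supported_integrable (smooth_continuous sb) S.
rewrite /mollifier (RintegralZl _ measurableT ib) mulVf// gt_eqF//.
have ee : e < e + 1 by rewrite ltrDl.
rewrite (supported_Rintegral ee S (@subsetT _ _)).
apply: Rintegral_continuous_gt0; [by rewrite addr_gt0|exact: smooth_continuous|exact: bump_ge0|].
by apply: bump_gt0; rewrite enorm0.
Qed.

Lemma smooth_mollifier_shift (e : R) z : smooth (fun x => mollifier e (z + 1 *: x)).
Proof. exact: smooth_affine (smooth_mollifier e). Qed.

Lemma supported_mollifier_shift (e : R) z : 0 <= e ->
  supported (- z) e (fun x => mollifier e (z + 1 *: x)).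
Proof.
move=> e0 y; rewrite opprK => ye; apply: (supported_mollifier e0).
by rewrite subr0 scale1r addrC.
Qed.

Lemma Rintegral_mollifier_shift (e : R) z : 0 < e ->
  \int[leb]_x mollifier e (z + 1 *: x) = 1.
Proof.
move=> e0; rewrite Rintegral_shift ?Rintegral_mollifier//.
exact: (supported_integrable (smooth_continuous (smooth_mollifier e)) (supported_mollifier (ltW e0))).
Qed.

Lemma Rintegral_mollifier_shift_le (e : R) z A : 0 < e -> measurable A ->
  \int[leb]_(x in A) mollifier e (z + 1 *: x) <= 1.
Proof.
move=> e0 mA.
have i1 := supported_integrable (smooth_continuous (smooth_mollifier_shift e z)) (@supported_mollifier_shift e z (ltW e0)).
apply: (@le_trans _ _ (\int[leb]_x mollifier e (z + 1 *: x))); last first.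
  by rewrite Rintegral_mollifier_shift.
apply: fine_le.
- by apply: integrable_fin_num => //; exact: integrableS i1.
- exact: integrable_fin_num.
apply: ge0_subset_integral => //; first exact: measurable_int i1.
by move=> x _; rewrite lee_fin mollifier_ge0.
Qed.

Let mollifier_flip (e : R) x y : mollifier e (-1 *: y + x) = mollifier e (- x + 1 *: y).
Proof. by rewrite -mollifierN opprD scaleN1r opprK addrC scale1r. Qed.

Lemma Rintegral_mollifier_le (e : R) B x : 0 < e -> measurable B ->
  \int[leb]_(y in B) mollifier e (-1 *: y + x) <= 1.
Proof.
move=> e0 mB; under eq_Rintegral do rewrite mollifier_flip.
exact: Rintegral_mollifier_shift_le.
Qed.

Lemma Rintegral_mollifier_eq1 (e s : R) B x : 0 < e -> e < s -> eball x s `<=` B ->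
  \int[leb]_(y in B) mollifier e (-1 *: y + x) = 1.
Proof.
move=> e0 es sB; under eq_Rintegral do rewrite mollifier_flip.
have S : supported x e (fun y => mollifier e (- x + 1 *: y)).
  by have := @supported_mollifier_shift e (- x) (ltW e0); rewrite opprK.
by rewrite (supported_Rintegral es S sB) -(supported_Rintegral es S (@subsetT _ _)) Rintegral_mollifier_shift.
Qed.

(** Averaging against a kernel of total mass at most 1 does not increase the
    [L^1] norm. *)
Lemma Tonelli_correlation A B h (s : R) k (rA rB : R) :
  measurable A -> A `<=` eball 0 rA -> measurable B -> B `<=` eball 0 rB ->
  leb.-integrable B (EFin \o h) -> (forall y, B y -> 0 <= h y) ->
  smooth k -> (forall z, 0 <= k z) ->
  (forall y, B y -> \int[leb]_(x in A) k (s *: y + x) <= 1) ->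
  \int[leb]_(x in A) correlation B h s k x <= \int[leb]_(y in B) h y.
Proof.
move=> mA Ar mB Br ih h0 sk k0 k1.
have mh : measurable_fun B h by apply/measurable_EFinP; exact: measurable_int ih.
have mh' : measurable_fun setT (h \_ B) by apply/(measurable_restrictT _ mB).
pose G (p : V * V) : \bar R := (\1_A p.1 * ((h \_ B) p.2 * k (s *: p.2 + p.1)))%:E.
have h'0 y : 0 <= (h \_ B) y by rewrite patchE; case: ifPn => // /[!inE] /h0.
have G0 p : (0 <= G p)%E by rewrite lee_fin mulr_ge0// ?mulr_ge0// indicE ler0n.
have mG : measurable_fun setT G.
  apply/measurable_EFinP; apply: measurable_funM.
    have m1A : measurable_fun setT (\1_A : V -> R) by exact: measurable_indic.
    exact: (measurableT_comp m1A measurable_fst).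
  apply: measurable_funM; first exact: (measurableT_comp mh' measurable_snd).
  apply: (measurableT_comp (continuous_measurable_rV (smooth_continuous sk))).
  apply: measurable_fun_rV => // i.
  have -> : (fun t : V * V => (s *: t.2 + t.1) ord0 i) = (fun t : V * V => s * t.2 ord0 i + t.1 ord0 i).
    by apply/funext => t; rewrite !mxE.
  apply: measurable_funD.
    apply: measurable_funM => //; apply: (measurableT_comp (@measurable_coor R n i)); exact: measurable_snd.
  by apply: (measurableT_comp (@measurable_coor R n i)); exact: measurable_fst.
have F := fubini_tonelli (m1 := leb) (m2 := leb) G mG G0.
have ic x := correlation_integrand s x mB Br ih sk.
have sc := smooth_correlation s mB Br ih sk.
have iAc : leb.-integrable A (EFin \o correlation B h s k).
  exact: continuous_integrable (smooth_continuous sc) mA Ar.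
have E1 : (\int[leb]_x \int[leb]_y G (x, y) = \int[leb]_(x in A) (correlation B h s k x)%:E)%E.
  rewrite [RHS]integral_mkcond; apply: eq_integral => x _.
  rewrite patchE; case: ifPn => xA; last first.
    by apply: integral0_eq => y _; rewrite /G /= indicE (negbTE xA) mul0r.
  rewrite /correlation /Rintegral fineK; last exact: integrable_fin_num (ic x).
  rewrite [RHS]integral_mkcond; apply: eq_integral => y _.
  by rewrite /G /= indicE xA mul1r !patchE; case: ifPn => // _; rewrite mul0r.
have ik y : leb.-integrable A (EFin \o (fun x => k (s *: y + x))).
  have sky : smooth (fun x => k (s *: y + 1 *: x)) by exact: smooth_affine.
  have -> : (fun x => k (s *: y + x)) = (fun x => k (s *: y + 1 *: x)).
    by apply/funext => x; rewrite scale1r.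
  exact: continuous_integrable (smooth_continuous sky) mA Ar.
have E2 : (\int[leb]_y \int[leb]_x G (x, y) =
    \int[leb]_(y in B) (h y * \int[leb]_(x in A) k (s *: y + x))%:E)%E.
  rewrite [RHS]integral_mkcond; apply: eq_integral => y _.
  rewrite patchE; case: ifPn => yB; last first.
    by apply: integral0_eq => x _; rewrite /G /= patchE (negbTE yB) mul0r mulr0.
  rewrite -(RintegralZl _ mA (ik y)) /Rintegral fineK; last first.
    exact: integrable_fin_num (integrable_RZ _ mA (ik y)).
  rewrite [RHS]integral_mkcond; apply: eq_integral => x _.
  by rewrite /G /= indicE !patchE yB; case: ifPn => _; rewrite ?mul1r ?mul0r.
apply: fine_le; [exact: integrable_fin_num|exact: integrable_fin_num|].
rewrite -E1 F E2; apply: ge0_le_integral; first exact: mB.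
- by move=> y By; rewrite lee_fin mulr_ge0 ?h0// Rintegral_ge0.
- have i1 := continuous_integrable (smooth_continuous (@smooth_cst R n 1)) mA Ar.
  have sK := smooth_affine 0 s (smooth_correlation 1 mA Ar i1 sk).
  apply/measurable_EFinP; apply: measurable_funM => //; apply: measurable_funTS.
  have -> : (fun y => \int[leb]_(x in A) k (s *: y + x)) =
      (fun y => correlation A (fun=> 1) 1 k (0 + s *: y)).
    by apply/funext => y; apply: eq_Rintegral => x _; rewrite mul1r scale1r add0r addrC.
  exact: continuous_measurable_rV (smooth_continuous sK).
- exact/measurable_EFinP.
- by move=> y By; rewrite lee_fin ler_piMr ?h0// k1.
Qed.

(** Jensen's inequality for a kernel of mass at most 1, by expanding the
    integral of the square [(w y - t) ^+ 2] with [t] the mollified value. *)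
Lemma mollify_sqr_le B w (e r : R) x : 0 < e -> measurable B -> B `<=` eball 0 r ->
  sq_integrable B w ->
  mollify B w e x ^+ 2 <= correlation B (fun y => w y ^+ 2) (-1) (mollifier e) x.
Proof.
move=> e0 mB Br Sw; have [mw w2] := Sw; have sk := smooth_mollifier e.
have Boo : (leb B < +oo)%E.
  apply: le_lt_trans (lebesgue_eball_lty 0 r); apply: le_measure => //; rewrite ?inE//.
  exact: measurable_eball.
have iw := sq_integrable_integrable mB Boo Sw.
have S1 := sq_integrable_cst 1 mB Boo; have i1 := sq_integrable_integrable mB Boo S1.
have j1 := correlation_integrand (-1) x mB Br i1 sk.
have jw := correlation_integrand (-1) x mB Br iw sk.
have j2 := correlation_integrand (-1) x mB Br w2 sk.
set t := mollify B w e x; set T := correlation _ _ _ _ _.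
have m1 := Rintegral_mollifier_le x e0 mB.
have : 0 <= \int[leb]_(y in B) ((w y - t) ^+ 2 * mollifier e (-1 *: y + x)).
  by apply: Rintegral_ge0 => y _; rewrite mulr_ge0 ?sqr_ge0 ?mollifier_ge0.
have -> : (fun y => (w y - t) ^+ 2 * mollifier e (-1 *: y + x)) =
    (fun y => w y ^+ 2 * mollifier e (-1 *: y + x) - 2 * t * (w y * mollifier e (-1 *: y + x))
      + t ^+ 2 * (1 * mollifier e (-1 *: y + x))).
  by apply/funext => y; ring.
rewrite (RintegralD mB (integrable_RB mB j2 (integrable_RZ _ mB jw)) (integrable_RZ _ mB j1)).
rewrite (RintegralB mB j2 (integrable_RZ _ mB jw)) (RintegralZl _ mB jw) (RintegralZl _ mB j1).
rewrite -/T -[\int[leb]_(y in B) (w y * _)]/t.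
have -> : (fun y => 1 * mollifier e (-1 *: y + x)) = (fun y => mollifier e (-1 *: y + x)).
  by apply/funext => y; rewrite mul1r.
have := ler_wpM2l (sqr_ge0 t) m1.
move: (Rintegral _ _ _) => m; rewrite mulr1 => h1 h2; have : 2 * t * t = 2 * t ^+ 2 by ring.
move=> E; rewrite E in h2.
by have : 0 <= T - 2 * t ^+ 2 + t ^+ 2 * m by []; lra.
Qed.

Lemma smooth_mollify B w (e r : R) : measurable B -> B `<=` eball 0 r ->
  leb.-integrable B (EFin \o w) -> smooth (mollify B w e).
Proof. by move=> mB Br iw; exact: smooth_correlation mB Br iw (smooth_mollifier e). Qed.

Lemma sqint_mollify_le A B w (e rA rB : R) : 0 < e -> measurable A -> A `<=` eball 0 rA ->
  measurable B -> B `<=` eball 0 rB -> sq_integrable B w ->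
  sqint A (mollify B w e) <= sqint B w.
Proof.
move=> e0 mA Ar mB Br Sw; have [mw w2] := Sw; have sk := smooth_mollifier e.
have Boo : (leb B < +oo)%E.
  apply: le_lt_trans (lebesgue_eball_lty 0 rB); apply: le_measure => //; rewrite ?inE//.
  exact: measurable_eball.
have sm := smooth_mollify e mB Br (sq_integrable_integrable mB Boo Sw).
have [_ iA] := sq_integrable_continuous (smooth_continuous sm) mA Ar.
have sc := smooth_correlation (-1) mB Br w2 sk.
have iAc := continuous_integrable (smooth_continuous sc) mA Ar.
apply: le_trans (le_Rintegral mA iA iAc (fun x _ => mollify_sqr_le x e0 mB Br Sw)) _.
apply: (Tonelli_correlation mA Ar mB Br w2) => //.
- by move=> y _; exact: sqr_ge0.
- exact: mollifier_ge0.
move=> y By; apply: le_trans (Rintegral_mollifier_shift_le (-1 *: y) e0 mA).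
by rewrite le_eqVlt; apply/orP; left; apply/eqP; apply: eq_Rintegral => x _; rewrite scale1r.
Qed.

Lemma mollifyB B f g (e r : R) x : measurable B -> B `<=` eball 0 r ->
  leb.-integrable B (EFin \o f) -> leb.-integrable B (EFin \o g) ->
  mollify B (fun y => f y - g y) e x = mollify B f e x - mollify B g e x.
Proof.
move=> mB Br fi gi; have sk := smooth_mollifier e.
have jf := correlation_integrand (-1) x mB Br fi sk.
have jg := correlation_integrand (-1) x mB Br gi sk.
by rewrite /mollify /correlation -(RintegralB mB jf jg); apply: eq_Rintegral => y _; rewrite mulrBl.
Qed.

Lemma mollify_lipschitz B g (L e s r : R) x : measurable B -> B `<=` eball 0 r ->
  0 <= L -> (forall x y, `|g x - g y| <= L * `|x - y|) ->
  0 < e -> e < s -> eball x s `<=` B -> `|mollify B g e x - g x| <= L * e.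
Proof.
move=> mB Br L0 hL e0 es sB; have sk := smooth_mollifier e.
have Lg : lipschitz_rV g by exists L.
have ig := continuous_integrable (lipschitz_rV_continuous Lg) mB Br.
have i1 := continuous_integrable (smooth_continuous (@smooth_cst R n 1)) mB Br.
have jg := correlation_integrand (-1) x mB Br ig sk.
have j1 := correlation_integrand (-1) x mB Br i1 sk.
have M1 : \int[leb]_(y in B) (1 * mollifier e (-1 *: y + x)) = 1.
  by rewrite -[RHS](Rintegral_mollifier_eq1 e0 es sB); apply: eq_Rintegral => y _; rewrite mul1r.
have -> : mollify B g e x - g x = \int[leb]_(y in B)
    (g y * mollifier e (-1 *: y + x) - g x * (1 * mollifier e (-1 *: y + x))).
  by rewrite (RintegralB mB jg (integrable_RZ _ mB j1)) (RintegralZl _ mB j1) M1 mulr1.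
have jd := integrable_RB mB jg (integrable_RZ (g x) mB j1).
apply: le_trans (le_normr_Rintegral mB jd) _.
rewrite -[leRHS]mulr1 -[X in _ <= _ * X]M1 -(RintegralZl _ mB j1).
apply: le_Rintegral => //; [exact: integrable_norm|exact: integrable_RZ|].
move=> y By; rewrite mul1r -mulrBl normrM (ger0_norm (mollifier_ge0 _ _)).
have [ye|ye] := leP (enorm (x - y)) e; last first.
  rewrite (supported_mollifier (ltW e0)) ?mulr0// subr0 scaleN1r addrC.
  exact: ye.
rewrite ler_wpM2r ?mollifier_ge0//; apply: le_trans (hL _ _) _; rewrite ler_wpM2l//.
by rewrite distrC (le_trans (normr_le_enorm _)).
Qed.

(** Convergence holds uniformly for Lipschitz functions, which are dense, and
    mollification does not increase the [L^2] norm. *)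
Lemma mollify_cvg w (r r1 e : R) : r < r1 -> sq_integrable (eball 0 r1) w -> 0 < e ->
  exists2 d, 0 < d & forall t : R, 0 < t < d ->
    sqint (eball 0 r) (fun x => mollify (eball 0 r1) w t x - w x) <= e.
Proof.
move=> rr Sw e0; pose A : set V := eball 0 r; pose B : set V := eball 0 r1.
have mA : measurable A := @measurable_eball R n 0 r; have mB : measurable B := @measurable_eball R n 0 r1.
have Boo := @lebesgue_eball_lty R n 0 r1.
have AB : A `<=` B by apply: subset_eball; exact: ltW.
have e12 : 0 < e / 12 by rewrite divr_gt0.
have [_ /(_ _ e12)[g Lg Hg]] := lipschitz_dense mB (@subset_refl _ B) Sw.
have Sg := lipschitz_sq_integrable mB (@subset_refl _ B) Lg.
have [L L0 hL] := Lg.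
pose m := fine (leb A); have m0 : 0 <= m by exact: fine_ge0.
pose D := 8 * (L ^+ 2 * m) + 1.
have D0 : 0 < D by rewrite ltr_wpDl// mulr_ge0// mulr_ge0// sqr_ge0.
exists (Num.min (r1 - r) (Num.min 1 (e / D))) => [|t /andP[t0]].
  by rewrite !lt_min subr_gt0 rr ltr01 divr_gt0.
rewrite !lt_min => /and3P[t1 t2 t3].
have iw := sq_integrable_integrable mB Boo Sw; have ig := sq_integrable_integrable mB Boo Sg.
have Swm := smooth_sq_integrable 0 r (smooth_mollify t mB (@subset_refl _ B) iw).
have Sgm := smooth_sq_integrable 0 r (smooth_mollify t mB (@subset_refl _ B) ig).
have SgA := sq_integrableS mA mB AB Sg; have SwA := sq_integrableS mA mB AB Sw.
have h1 : sqint A (fun x => mollify B w t x - mollify B g t x) <= e / 12.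
  apply: le_trans Hg; apply: le_trans (sqint_mollify_le t0 mA (@subset_refl _ A) mB (@subset_refl _ B) (sq_integrableB mB Sw Sg)).
  by rewrite le_eqVlt; apply/orP; left; apply/eqP; apply: eq_sqint => x _; rewrite (mollifyB t x mB (@subset_refl _ B) iw ig).
have h2 : sqint A (fun x => g x - w x) <= e / 12.
  apply: le_trans Hg; apply: le_trans (sqintS mA mB AB (sq_integrableB mB Sw Sg)).
  by rewrite le_eqVlt; apply/orP; left; apply/eqP; apply: eq_Rintegral => x _; rewrite -sqrrN opprB.
have h3 : sqint A (fun x => mollify B g t x - g x) <= e / 8.
  apply: (@le_trans _ _ (sqint A (fun=> L * t))).
    have [_ i1] := sq_integrableB mA Sgm SgA.
    have [_ i2] := sq_integrable_cst (L * t) mA (lebesgue_eball_lty _ _).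
    apply: le_Rintegral => // x Ax; rewrite -[leLHS](real_normK (num_real _)).
    apply: lerXn2r; rewrite ?nnegrE ?mulr_ge0 ?(ltW t0)//.
    apply: (mollify_lipschitz mB (@subset_refl _ B) L0 hL t0 t1).
    by apply: sub_eball; have := Ax; rewrite /A eballE subr0; lra.
  rewrite (sqint_cst _ mA) -/m exprMn.
  have tt : t ^+ 2 <= t by rewrite expr2 ler_piMl ?ltW.
  have tD : t * D <= e by rewrite ltr_pdivlMr in t3 => //; exact: ltW.
  have k0 : 0 <= L ^+ 2 * m by rewrite mulr_ge0 ?sqr_ge0.
  have k1 := ler_wpM2l k0 tt; rewrite /D in tD.
  have -> : L ^+ 2 * t ^+ 2 * m = L ^+ 2 * m * t ^+ 2 by ring.
  apply: le_trans k1 _; rewrite ler_pdivlMr//.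
  have : L ^+ 2 * m * t * 8 = t * (8 * (L ^+ 2 * m)) by ring.
  by move=> ->; rewrite mulrDr mulr1 in tD; lra.
have h4 := sqint_triangle mA Sgm SgA SwA.
apply: le_trans (sqint_triangle mA Swm Sgm SwA) _; lra.
Qed.

End mollification.

(** * Smooth approximation of weak solutions *)

Section local_integrability.
Context (R : realType) (n : nat).
Local Notation V := 'rV[R]_n.
Local Notation leb := (lebesgue_rV R n).
Implicit Types (f g u v phi : V -> R) (x y z : V) (K : set V).

Let B1 : set V := eball 0 1.
Let mB1 : measurable B1. Proof. exact: measurable_eball. Qed.

Lemma measurable_compact_rV K : compact K -> measurable K.
Proof.
move=> cK; rewrite -[K]setCK; apply: measurableC; apply: open_measurable_rV.
by apply: closed_openC; apply: compact_closed => //; exact: norm_hausdorff.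
Qed.

Lemma Lloc_eball (p r : R) f : r < 1 -> Lloc B1 p f ->
  measurable_fun (eball 0 r) f /\ (\int[leb]_(x in eball 0 r) (`|f x| `^ p)%:E < +oo)%E.
Proof.
move=> r1 [mf If]; have mr := @measurable_eball R n 0 r.
have rB : eball 0 r `<=` B1 by apply: subset_eball; exact: ltW.
split; first exact: measurable_funS mf.
have cK := @compact_ecball R n 0 r.
have KB : [set y : V | enorm (y - 0) <= r] `<=` B1.
  by move=> y /= yr; rewrite /B1 eballE; exact: le_lt_trans r1.
apply: le_lt_trans (If _ cK KB); apply: ge0_subset_integral => //.
- exact: measurable_compact_rV.
- apply/measurable_EFinP; apply: (measurableT_comp (f := fun t : R => t `^ p)).
    exact: measurable_powR.
  by apply: measurableT_comp => //; apply: measurable_funS mf => //; exact: measurable_compact_rV.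
- by move=> y; rewrite eballE => /ltW.
Qed.

Lemma Lloc2_sq_integrable (r : R) f : r < 1 -> Lloc B1 2 f -> sq_integrable (eball 0 r) f.
Proof.
move=> r1 /(Lloc_eball r1)[mf If]; split => //; apply/integrableP; split.
  by apply/measurable_EFinP; exact: measurable_funX.
move: If; congr (_ < _)%E; apply: eq_integral => x _.
by rewrite powR_mulrn// real_normK ?num_real//= ger0_norm ?sqr_ge0.
Qed.

Lemma sq_integrable_Lloc1 f : measurable_fun B1 f ->
  (forall r : R, r < 1 -> sq_integrable (eball 0 r) f) -> Lloc B1 1 f.
Proof.
move=> mf Sf; split => // K cK KB.
have [s /andP[_ s1] Ks] := compact_sub_eball ltr01 cK KB.
pose r := (s + 1) / 2; have r1 : r < 1 by rewrite /r; lra.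
have sr : s < r by rewrite /r; lra.
have mr := @measurable_eball R n 0 r.
have Kr : K `<=` eball 0 r by move=> y /Ks ys; rewrite eballE; exact: le_lt_trans sr.
have /integrableP[mfr Ifr] := sq_integrable_integrable mr (lebesgue_eball_lty _ _) (Sf r r1).
apply: le_lt_trans Ifr; rewrite (eq_integral (fun x => `|(EFin \o f) x|%E)); last first.
  by move=> x _; rewrite powRr1.
apply: ge0_subset_integral => //; first exact: measurable_compact_rV.
exact: measurableT_comp.
Qed.

Lemma Rintegral_vanish (A B : set V) f : A `<=` B -> (forall x, B x -> ~ A x -> f x = 0) ->
  \int[leb]_(x in B) f x = \int[leb]_(x in A) f x.
Proof.
move=> AB f0; rewrite [LHS]Rintegral_mkcond [RHS]Rintegral_mkcond; congr Rintegral.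
apply/funext => x; rewrite !patchE; case: ifPn => xB; case: ifPn => xA //.
  by apply: f0; [rewrite inE in xB|rewrite notin_setE in xA].
by exfalso; move: xB; rewrite notin_setE; apply; apply: AB; rewrite inE in xA.
Qed.

Lemma supported_test_function z (e : R) phi : enorm z + e < 1 -> smooth phi ->
  supported z e phi -> test_function B1 phi.
Proof.
move=> ze sp Sp; split => //; exists [set y | enorm (y - z) <= e]; split.
- exact: compact_ecball.
- move=> y /= ye; rewrite /B1 eballE subr0; apply: le_lt_trans ze.
  by rewrite -{1}(subrK z y) addrC; apply: le_trans (ler_enormD _ _) _; rewrite lerD2l.
- by move=> y /negP; rewrite -ltNge; exact: Sp.
Qed.

Lemma test_function_supported phi : test_function B1 phi ->
  smooth phi /\ exists2 s : R, s < 1 & supported 0 s phi.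
Proof.
move=> [sp [K [cK KB K0]]]; split => //.
have [s /andP[_ s1] Ks] := compact_sub_eball ltr01 cK KB; exists s => // y ys.
by apply: K0 => /Ks; rewrite leNgt ys.
Qed.

End local_integrability.

Section smooth_approximation.
Context (R : realType) (n : nat).
Local Notation V := 'rV[R]_n.
Local Notation leb := (lebesgue_rV R n).
Implicit Types (f g u v phi : V -> R) (x y z : V) (Du : 'I_n -> V -> R).

Let B1 : set V := eball 0 1.

(** Reflected and translated mollifiers, seen as test functions: testing a weak
    equation with them computes a mollification at [z]. *)
Let T (e : R) z x : R := mollifier e (z + -1 *: x).

Lemma smooth_test_mollifier (e : R) z : smooth (T e z).
Proof. exact: smooth_affine (@smooth_mollifier R n e). Qed.

Lemma supported_test_mollifier (e : R) z : 0 <= e -> supported z e (T e z).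
Proof.
move=> e0 y ye; apply: (supported_mollifier e0); rewrite subr0 scaleN1r.
by rewrite -opprB enormN.
Qed.

Section at_scale.
Variables (r r1 e : R) (z : V).
Hypotheses (e0 : 0 < e) (r11 : r1 < 1) (er : r + e <= r1) (zr : eball 0 r z).

Let B : set V := eball 0 r1.
Let mB : measurable B. Proof. exact: measurable_eball. Qed.
Let BB1 : B `<=` B1. Proof. by apply: subset_eball; exact: ltW. Qed.

Let zr' : enorm z < r. Proof. by move: zr; rewrite eballE subr0. Qed.

Lemma test_mollifier_vanish k x : supported z e k -> ~ B x -> k x = 0.
Proof.
move=> Sk nx; apply: Sk; rewrite ltNge; apply/negP => xz; apply: nx; rewrite /B eballE subr0.
have := ler_enormD (x - z) z; rewrite subrK; have := zr'; have := er; move: xz; lra.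
Qed.

Lemma Rintegral_test_mollifier u k : supported z e k ->
  \int[leb]_(x in B1) (u x * k x) = \int[leb]_(x in B) (u x * k x).
Proof. by move=> Sk; apply: Rintegral_vanish => // x _ nx; rewrite (test_mollifier_vanish Sk nx) mulr0. Qed.

Lemma test_mollifier_function : test_function B1 (T e z).
Proof.
by apply: (supported_test_function (z := z) (e := e)); [have := zr'; have := er; have := r11; lra|exact: smooth_test_mollifier|exact: supported_test_mollifier (ltW e0)].
Qed.

Let ST : supported z e (T e z).
Proof. exact: supported_test_mollifier (ltW e0). Qed.

Lemma pderiv_test_mollifier i :
  pderiv i (T e z) = (fun x => -1 * pderiv i (mollifier e) (z + -1 *: x)).
Proof. exact: smooth_pderiv_affine (@smooth_mollifier R n e). Qed.

Lemma pderiv_mollify u u' i : leb.-integrable B (EFin \o u) ->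
  weak_pderiv B1 i u u' -> pderiv i (mollify B u e) z = mollify B u' e z.
Proof.
move=> iu [_ _ /(_ _ test_mollifier_function)]; have sk := @smooth_mollifier R n e.
rewrite /mollify (pderiv_correlation (-1) i mB (@subset_refl _ B) iu sk).
rewrite (Rintegral_test_mollifier u' ST).
rewrite (Rintegral_test_mollifier u (supported_pderiv i (smooth_test_mollifier e z) ST)).
have j1 := correlation_integrand (-1) z mB (@subset_refl _ B) iu (smooth_pderiv i sk).
have -> : \int[leb]_(x in B) (u x * pderiv i (T e z) x) =
    - \int[leb]_(x in B) (u x * pderiv i (mollifier e) (-1 *: x + z)).
  rewrite -[RHS]mulN1r -(RintegralZl _ mB j1); apply: eq_Rintegral => x _.
  by rewrite pderiv_test_mollifier addrC mulrCA.
move=> /oppr_inj H; apply: etrans H _; apply: eq_Rintegral => x _.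
by rewrite /T addrC.
Qed.

Lemma laplacian_mollify u f Du : leb.-integrable B (EFin \o u) ->
  (forall i, weak_pderiv B1 i u (Du i)) ->
  (forall phi, test_function B1 phi ->
    \sum_i \int[leb]_(x in B1) (Du i x * pderiv i phi x) = - \int[leb]_(x in B1) (f x * phi x)) ->
  laplacian (mollify B u e) z = mollify B f e z.
Proof.
move=> iu wu wf; have sk := @smooth_mollifier R n e.
have sT := smooth_test_mollifier e z.
have := wf _ test_mollifier_function; rewrite (Rintegral_test_mollifier f ST).
have -> : \sum_i \int[leb]_(x in B1) (Du i x * pderiv i (T e z) x) =
    - \sum_i correlation B u (-1) (pderiv i (pderiv i (mollifier e))) z.
  rewrite -sumrN; apply: eq_bigr => i _.
  have SdT := supported_pderiv i sT ST; have sdT := smooth_pderiv i sT.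
  have tdT : test_function B1 (pderiv i (T e z)).
    by apply: (supported_test_function (z := z) (e := e)) => //; have := zr'; have := er; have := r11; lra.
  have [_ _ /(_ _ tdT) H] := wu i; apply: oppr_inj; rewrite opprK; apply: etrans (esym H) _.
  rewrite (Rintegral_test_mollifier u (supported_pderiv i sdT SdT)).
  apply: eq_Rintegral => x _.
  apply: etrans (congr1 (fun g => u x * g x) (pderiv2_affine i i z (-1) sk)) _.
  have aux (k : V -> R) : u x * ((-1) ^+ 2 * k (z + -1 *: x)) = u x * k (-1 *: x + z).
    by rewrite sqrrN expr1n mul1r addrC.
  exact: aux.
move=> /oppr_inj E; rewrite /laplacian /mollify.
transitivity (\sum_i correlation B u (-1) (pderiv i (pderiv i (mollifier e))) z).
  apply: eq_bigr => i _; rewrite (pderiv_correlation (-1) i mB (@subset_refl _ B) iu sk).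
  by rewrite (pderiv_correlation (-1) i mB (@subset_refl _ B) iu (smooth_pderiv i sk)).
by rewrite E; apply: eq_Rintegral => x _; rewrite /T addrC.
Qed.

End at_scale.

Lemma common_threshold (P : 'I_n -> R -> Prop) :
  (forall i, exists2 d, 0 < d & forall t : R, 0 < t < d -> P i t) ->
  exists2 d, 0 < d & forall i (t : R), 0 < t < d -> P i t.
Proof.
move=> H; have H' i := cid2 (H i).
exists (\big[Num.min/1]_i s2val (H' i)) => [|i t /andP[t0 tm]].
  by elim/big_ind: _ => // [a b a0 b0|i _]; [rewrite lt_min a0|exact: (s2valP (H' i))].
apply: (s2valP' (H' i)); rewrite t0 /=; apply: lt_le_trans tm _.
exact: bigmin_le_cond.
Qed.

(** Mollifying the weak equation shows that the mollified solution solves the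
    equation with mollified right-hand side in the classical sense. *)
Lemma smooth_approximation u f Du (r e : R) : W12loc B1 u Du ->
  (forall phi, test_function B1 phi ->
    \sum_i \int[leb]_(x in B1) (Du i x * pderiv i phi x) = - \int[leb]_(x in B1) (f x * phi x)) ->
  (forall s : R, s < 1 -> sq_integrable (eball 0 s) f) -> r < 1 -> 0 < e ->
  exists v, [/\ smooth v, sqint (eball 0 r) (fun x => v x - u x) <= e,
    sqint (eball 0 r) (fun x => laplacian v x - f x) <= e &
    forall i, sqint (eball 0 r) (fun x => pderiv i v x - Du i x) <= e].
Proof.
move=> [Lu LD] wf Sf r1 e0; pose s := (r + 1) / 2.
have rs : r < s by rewrite /s; lra.
have s1 : s < 1 by rewrite /s; lra.
have Su := Lloc2_sq_integrable s1 Lu.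
have SD i := Lloc2_sq_integrable s1 (LD i).1.
have wu i : weak_pderiv B1 i u (Du i) := (LD i).2.
have ms := @measurable_eball R n 0 s.
have iu := sq_integrable_integrable ms (lebesgue_eball_lty _ _) Su.
have [d1 d10 h1] := mollify_cvg rs Su e0.
have [d2 d20 h2] := mollify_cvg rs (Sf s s1) e0.
have [d3 d30 h3] := common_threshold (fun i => mollify_cvg rs (SD i) e0).
pose t := Num.min (s - r) (Num.min d1 (Num.min d2 d3)) / 2.
have t0 : 0 < t by rewrite divr_gt0// !lt_min subr_gt0 rs d10 d20 d30.
have : t < Num.min (s - r) (Num.min d1 (Num.min d2 d3)).
  by rewrite /t ltr_pdivrMr// ltr_pMr ?ltr1n// !lt_min subr_gt0 rs d10 d20 d30.
rewrite !lt_min => /and4P[ts t1 t2 t3].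
have rt : r + t <= s by lra.
exists (mollify (eball 0 s) u t); split.
- exact: (smooth_mollify t ms (@subset_refl _ _) iu).
- by apply: h1; rewrite t0.
- apply: le_trans (h2 t _); last by rewrite t0.
  rewrite le_eqVlt; apply/orP; left; apply/eqP; apply: eq_sqint => x xr; congr (_ - _).
  exact: (laplacian_mollify t0 s1 rt xr iu wu wf).
- move=> i; apply: le_trans (h3 i t _); last by rewrite t0.
  rewrite le_eqVlt; apply/orP; left; apply/eqP; apply: eq_sqint => x xr; congr (_ - _).
  exact: (pderiv_mollify t0 s1 rt xr iu (wu i)).
Qed.

End smooth_approximation.

(** * Completeness of L^2 *)

Section riesz_fischer.
Context (R : realType) (n : nat).
Local Notation V := 'rV[R]_n.
Local Notation leb := (lebesgue_rV R n).
Implicit Types (g : nat -> V -> R) (B : set V).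

Lemma limn_einf_le_cst (u : (\bar R)^nat) (c : \bar R) : (forall k, (u k <= c)%E) -> (limn_einf u <= c)%E.
Proof.
move=> uc; rewrite limn_einf_lim; apply: lime_le; first exact: is_cvg_einfs.
by apply: nearW => k; apply: le_trans (uc k); apply: ereal_inf_lbound; exists k => /=.
Qed.

Lemma cvgn_of_summable (u : R^nat) : (\sum_(k <oo) `|u k.+1 - u k|%:E)%E \is a fin_num -> cvgn u.
Proof.
move=> Sf; have : cvgn (series (telescope u)).
  apply: normed_cvg; apply: nondecreasing_is_cvgn.
    by apply/nondecreasing_seqP => k; rewrite /normed_series_of /series /= !big_mkord big_ord_recr /= lerDl.
  exists (fine (\sum_(k <oo) `|u k.+1 - u k|%:E)%E) => _ [m _ <-].
  rewrite -lee_fin fineK// /series /=.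
  have h0 k : (0 <= k)%N -> xpredT k -> (0 <= `|u k.+1 - u k|%:E)%E by rewrite lee_fin.
  by have := @nneseries_lim_ge R (fun k => `|u k.+1 - u k|%:E) xpredT 0 m h0; rewrite sumEFin.
rewrite telescopeK => /cvg_ex[l cl]; apply/cvg_ex; exists (l + u 0).
apply: cvg_trans (cvgD cl (cvg_cst (u 0))); apply: near_eq_cvg; apply: nearW => k /=.
by rewrite subrK.
Qed.

Lemma geometric_nneseries_lty (D : R) : (\sum_(k <oo) (D * (2 ^+ k)^-1)%:E < +oo)%E.
Proof.
have := @cvg_geometric_eseries_half R (2 * D) 0 => /cvg_lim H.
rewrite (eq_eseriesr (g := fun k => (2 * D / (2 ^ (k + 1))%:R)%:E)); last first.
  move=> k _; rewrite natrX exprD expr1; congr (_%:E).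
  by field; rewrite expf_neq0.
by rewrite [X in (X < _)%E]H// ltry.
Qed.

(** The series of the increments has a finite integral, hence converges almost
    everywhere. *)
Lemma summable_ae B g (D : R) : measurable B ->
  (forall k, leb.-integrable B (EFin \o g k)) ->
  (forall k, \int[leb]_(x in B) `|g k.+1 x - g k x| <= D * (2 ^+ k)^-1) ->
  {ae leb, forall x, B x -> cvgn (fun k => g k x)}.
Proof.
move=> mB ig bg; pose a k x := (`|g k.+1 x - g k x|%:E : \bar R).
have ia k : leb.-integrable B (a k) := integrable_norm (integrable_RB mB (ig k.+1) (ig k)).
have ma k : measurable_fun B (a k) := measurable_int _ (ia k).
have a0 k x : B x -> (0 <= a k x)%E by rewrite lee_fin.
have : leb.-integrable B (fun x => \sum_(k <oo) a k x)%E.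
  apply/integrableP; split.
    exact: (ge0_emeasurable_sum (P := xpredT) (fun k x Bx _ => a0 k x Bx) (fun k _ => ma k)).
  rewrite (eq_integral (fun x => \sum_(k <oo) a k x)%E); last first.
    by move=> x; rewrite inE => Bx; rewrite gee0_abs// nneseries_ge0// => k _ _; exact: a0.
  rewrite integral_nneseries//; apply: le_lt_trans (geometric_nneseries_lty D).
  apply: lee_nneseries => [k _ _|k _]; first by apply: integral_ge0 => x Bx; exact: a0.
  by rewrite -[leLHS]fineK ?lee_fin; [exact: bg|exact: integrable_fin_num].
move=> /(integrable_ae mB); apply: filterS => x h Bx; apply: cvgn_of_summable; exact: h.
Qed.

Lemma norm_integral_le B (f : V -> R) (C q : R) : measurable B -> (leb B < +oo)%E ->
  sq_integrable B f -> 0 <= C -> 0 <= q -> sqint B f <= C * q ^+ 2 ->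
  \int[leb]_(x in B) `|f x| <= (fine (leb B) * C + 1) * q.
Proof.
move=> mB Boo Sf C0 q0 hf; have m0 : 0 <= fine (leb B) by exact: fine_ge0.
have D0 : 0 <= fine (leb B) * C by exact: mulr_ge0.
rewrite -(@ler_pXn2r _ 2)// ?nnegrE; [|by apply: Rintegral_ge0|by rewrite mulr_ge0// addr_ge0].
apply: le_trans (Rintegral_norm_sqr_le mB Boo Sf) _; apply: le_trans (ler_wpM2l m0 hf) _.
rewrite mulrA exprMn ler_wpM2r ?sqr_ge0//.
by move: (_ * C) D0 => d d0; rewrite sqrrD expr1n mulr1; have := sqr_ge0 d; lra.
Qed.

(** The geometric rate of the Cauchy condition gives convergence almost
    everywhere on each ball, and Fatou's lemma turns it into convergence in
    [L^2]. Taking the pointwise upper limit yields a single function for all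
    balls. *)
Lemma riesz_fischer g : (forall k, measurable_fun setT (g k)) ->
  (forall k (r : R), sq_integrable (eball 0 r) (g k)) ->
  (forall r : R, r < 1 -> exists K, exists2 C, 0 <= C &
    forall k l, (K <= k <= l)%N -> sqint (eball 0 r) (fun x => g l x - g k x) <= C * (2 ^- k) ^+ 2) ->
  exists2 G : V -> R, measurable_fun setT G & forall r : R, r < 1 ->
    sq_integrable (eball 0 r) G /\
    forall e : R, 0 < e -> exists K, forall k, (K <= k)%N ->
      sqint (eball 0 r) (fun x => g k x - G x) <= e.
Proof.
move=> mg Sg Cg; pose G x := fine (limn_esup (fun k => (g k x)%:E)).
have mG : measurable_fun setT G.
  apply: (measurableT_comp (fine_measurable measurableT)).
  by apply: measurable_fun_limn_esup => k; exact/measurable_EFinP.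
exists G => // r r1; pose B : set V := eball 0 r.
have mB : measurable B := @measurable_eball R n 0 r.
have Boo := @lebesgue_eball_lty R n 0 r.
have [K [C C0 hC]] := Cg r r1.
have gG : {ae leb, forall x, B x -> (fun k => g k x) @ \oo --> G x}.
  have ig k : leb.-integrable B (EFin \o g (k + K)%N) by exact: sq_integrable_integrable (Sg _ _).
  have h k : \int[leb]_(x in B) `|g (k.+1 + K)%N x - g (k + K)%N x| <=
      (fine (leb B) * C + 1) * (2 ^+ k)^-1.
    have Sd := sq_integrableB mB (Sg (k.+1 + K)%N r) (Sg (k + K)%N r).
    have q0 : 0 <= (2 ^+ k)^-1 :> R by rewrite invr_ge0 exprn_ge0.
    apply: (norm_integral_le mB Boo Sd C0 q0).
    apply: le_trans (hC (k + K)%N (k.+1 + K)%N _) _; first by rewrite leq_addl leq_add2r leqnSn.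
    apply: ler_wpM2l => //; rewrite lerXn2r ?nnegrE ?invr_ge0 ?exprn_ge0//.
    by rewrite lef_pV2 ?posrE ?exprn_gt0// ler_weXn2l ?leq_addr// ler1n.
  have := summable_ae mB ig h; apply: filterS => x cx Bx.
  have [l gl] : exists l : R, (fun k => g k x) @ \oo --> l.
    by have /cvg_ex[l gl] := cx Bx; exists l; rewrite -(cvg_shiftn K).
  have gl' : (fun k => (g k x)%:E) @ \oo --> l%:E by apply: cvg_EFin => //; exact: nearW.
  by rewrite /G (cvg_limn_einf_sup gl').2.
have Gk k : (K <= k)%N -> (\int[leb]_(x in B) ((g k x - G x) ^+ 2)%:E <= (C * (2 ^- k) ^+ 2)%:E)%E.
  move=> Kk; pose f l x := (((g (l + k)%N x - g k x) ^+ 2)%:E : \bar R).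
  have mf l : measurable_fun B (f l).
    by apply/measurable_EFinP; apply: measurable_funX; apply: measurable_funB; exact: measurable_funTS.
  have f0 l x : B x -> (0 <= f l x)%E by rewrite lee_fin sqr_ge0.
  have := fatou leb mB mf f0.
  have -> : (\int[leb]_(x in B) limn_einf (f^~ x) = \int[leb]_(x in B) ((g k x - G x) ^+ 2)%:E)%E.
    apply: ge0_ae_eq_integral => //.
    - by rewrite /limn_einf; apply: measurableT_comp => //; apply: measurable_fun_limn_esup => l; exact: measurableT_comp.
    - by apply/measurable_EFinP; apply: measurable_funX; apply: measurable_funB; exact: measurable_funTS.
    - move=> x Bx; rewrite limn_einf_lim; apply: lime_ge; first exact: is_cvg_einfs.
      by apply: nearW => l; apply: le_ereal_inf_tmp => _ [m _ <-]; exact: f0.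
    - by move=> x _; rewrite lee_fin sqr_ge0.
    move: gG; apply: filterS => x gx Bx.
    have fx : (fun l => f l x) @ \oo --> ((g k x - G x) ^+ 2)%:E.
      apply: cvg_EFin; first exact: nearW.
      have h1 : (fun l => g (l + k)%N x - g k x) @ \oo --> G x - g k x.
        have gx' := gx Bx; rewrite -(cvg_shiftn k) in gx'.
        by apply: cvgB; [exact: gx'|exact: cvg_cst].
      rewrite -sqrrN opprB expr2 (_ : _ \o _ = (fun l => (g (l + k)%N x - g k x) * (g (l + k)%N x - g k x))); last first.
        by apply/funext => l /=; rewrite expr2.
      exact: cvgM.
    by rewrite (cvg_limn_einf_sup fx).1.
  move=> /le_trans; apply; apply: limn_einf_le_cst => l.
  have [_ i2] := sq_integrableB mB (Sg (l + k)%N r) (Sg k r).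
  rewrite -[leLHS]fineK ?lee_fin; last exact: integrable_fin_num.
  by apply: hC; rewrite Kk leq_addl.
have SGk k : (K <= k)%N -> sq_integrable B (fun x => g k x - G x).
  move=> /Gk h; split; first by apply: measurable_funB; exact: measurable_funTS.
  apply/integrableP; split.
    by apply/measurable_EFinP; apply: measurable_funX; apply: measurable_funB; exact: measurable_funTS.
  rewrite (eq_integral (fun x => ((g k x - G x) ^+ 2)%:E)); last first.
    by move=> x _ /=; rewrite ger0_norm ?sqr_ge0.
  by apply: le_lt_trans h _; rewrite ltry.
split.
  have := sq_integrableB mB (Sg K r) (SGk K (leqnn K)).
  by congr sq_integrable; apply/funext => x; rewrite opprB addrC subrK.
move=> e e0; exists (maxn K (Num.trunc (C / e)).+1) => k; rewrite geq_max => /andP[Kk ek].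
have [_ ik] := SGk k Kk; have := Gk k Kk.
rewrite -[X in (X <= _)%E]fineK ?lee_fin; last exact: integrable_fin_num.
move=> h; apply: le_trans h _.
have k1 : C <= e * 2 ^+ k.
  rewrite -ler_pdivrMl// mulrC; apply: ltW; apply: lt_le_trans (truncnS_gt _) _.
  by rewrite -natrX ler_nat; apply: leq_trans ek _; apply: ltnW; exact: ltn_expl.
have p0 : 0 < 2 ^+ k :> R by rewrite exprn_gt0.
have p1 : 2 ^- k <= 1 :> R by rewrite invf_le1// exprn_ege1// ler1n.
apply: (@le_trans _ _ (C * 2 ^- k)).
  by rewrite ler_wpM2l// expr2 ler_piMl// invr_ge0 ltW.
by rewrite ler_pdivrMr.
Qed.

End riesz_fischer.

(** * Second derivatives of weak solutions *)

Section second_derivatives.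
Context (R : realType) (n : nat).
Local Notation V := 'rV[R]_n.
Local Notation leb := (lebesgue_rV R n).
Implicit Types (f g u v phi : V -> R) (x y z : V) (Du : 'I_n -> V -> R) (A : set V).

Let B1 : set V := eball 0 1.

(** An integration by parts formula passes to [L^2] limits. *)
Lemma pairing_limit A (a b p q : V -> R) : measurable A ->
  sq_integrable A a -> sq_integrable A b -> sq_integrable A p -> sq_integrable A q ->
  (forall e : R, 0 < e -> exists a' b', [/\ sq_integrable A a', sq_integrable A b',
    sqint A (fun x => a' x - a x) <= e, sqint A (fun x => b' x - b x) <= e &
    \int[leb]_(x in A) (a' x * p x) + \int[leb]_(x in A) (b' x * q x) = 0]) ->
  \int[leb]_(x in A) (a x * p x) = - \int[leb]_(x in A) (b x * q x).
Proof.
move=> mA Sa Sb Sp Sq H; apply/eqP; rewrite -addr_eq0 -normr_le0; apply/ler_addgt0Pr => t t0.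
rewrite add0r; pose N := sqint A p + sqint A q; have N0 : 0 <= N by rewrite addr_ge0 ?sqint_ge0.
pose c := (N + 1) / t; have c0 : 0 < c by rewrite divr_gt0// ltr_wpDl.
have [a' [b' [Sa' Sb' ha hb E]]] := H (t / (2 * c)) (divr_gt0 t0 (mulr_gt0 (ltr0Sn _ _) c0)).
have Da := sq_integrableB mA Sa' Sa; have Db := sq_integrableB mA Sb' Sb.
have ia := sq_integrable_prod mA Sa Sp; have ia' := sq_integrable_prod mA Sa' Sp.
have ib := sq_integrable_prod mA Sb Sq; have ib' := sq_integrable_prod mA Sb' Sq.
have Ea : \int[leb]_(x in A) ((a' x - a x) * p x) =
    \int[leb]_(x in A) (a' x * p x) - \int[leb]_(x in A) (a x * p x).
  by rewrite -RintegralB//; apply: eq_Rintegral => x _; rewrite mulrBl.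
have Eb : \int[leb]_(x in A) ((b' x - b x) * q x) =
    \int[leb]_(x in A) (b' x * q x) - \int[leb]_(x in A) (b x * q x).
  by rewrite -RintegralB//; apply: eq_Rintegral => x _; rewrite mulrBl.
have ka := Rintegral_prod_le mA c0 Da Sp; have kb := Rintegral_prod_le mA c0 Db Sq.
rewrite Ea in ka; rewrite Eb in kb.
have c20 : 0 <= c / 2 by rewrite divr_ge0// ltW.
have la := ler_wpM2l c20 ha; have lb := ler_wpM2l c20 hb.
have e1 : c / 2 * (t / (2 * c)) = t / 4 by field; rewrite gt_eqF.
have e2 : c^-1 / 2 * sqint A p + c^-1 / 2 * sqint A q <= t / 2.
  rewrite -mulrDr -/N /c invf_div.
  have -> : t / (N + 1) / 2 * N = t / 2 * (N / (N + 1)).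
    by field; rewrite gt_eqF// ltr_wpDl.
  apply: ler_piMr; first by rewrite divr_ge0// ltW.
  by rewrite ler_pdivrMr ?mul1r ?lerDl// ltr_wpDl.
rewrite e1 in la lb.
move: E ka kb la lb e2; rewrite !ler_norml.
move: (Rintegral _ _ (fun x => a' x * p x)) (Rintegral _ _ (fun x => a x * p x)) => I1 I2.
move: (Rintegral _ _ (fun x => b' x * q x)) (Rintegral _ _ (fun x => b x * q x)) => J1 J2.
move: (c / 2 * _) (c / 2 * _) (c^-1 / 2 * _) (c^-1 / 2 * _) => m1 m2 m3 m4.
move=> E /andP[h1 h2] /andP[h3 h4] h5 h6 h7; apply/andP; split; lra.
Qed.

Lemma ler_entry_sum2 (F : 'I_n -> 'I_n -> R) i j : (forall k l, 0 <= F k l) ->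
  F i j <= \sum_k \sum_l F k l.
Proof.
move=> F0; rewrite (bigD1 i)//= (bigD1 j)//= -addrA lerDl addr_ge0//.
  by apply: sumr_ge0 => l _.
by apply: sumr_ge0 => k _; apply: sumr_ge0 => l _.
Qed.

Lemma sqint_hessian_le v i j x (r : R) : smooth v ->
  sqint (eball x r) (pderiv j (pderiv i v)) <= \int[leb]_(y in eball x r) hess_sq v y.
Proof.
move=> sv; have mB := @measurable_eball R n x r.
have [_ i1] := smooth_sq_integrable x r (smooth_pderiv j (smooth_pderiv i sv)).
have i2 := smooth_integrable x r (smooth_hess_sq sv).
apply: le_Rintegral => // y _.
exact: (@ler_entry_sum2 (fun k l => pderiv l (pderiv k v) y ^+ 2) i j (fun k l => sqr_ge0 _)).
Qed.

(** The interior Hessian bound, applied to the difference of two smooth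
    approximations of the same solution. *)
Lemma hessian_cauchy v w u f i j (r s C e1 e2 : R) :
  0 < r -> smooth v -> smooth w ->
  (forall v, smooth v -> \int[leb]_(y in eball 0 r) hess_sq v y <=
    C * (r ^- 4 * sqint (eball 0 s) v + sqint (eball 0 s) (laplacian v))) -> 0 <= C ->
  sq_integrable (eball 0 s) u -> sq_integrable (eball 0 s) f ->
  sqint (eball 0 s) (fun x => v x - u x) <= e1 -> sqint (eball 0 s) (fun x => w x - u x) <= e2 ->
  sqint (eball 0 s) (fun x => laplacian v x - f x) <= e1 ->
  sqint (eball 0 s) (fun x => laplacian w x - f x) <= e2 ->
  sqint (eball 0 r) (fun x => pderiv j (pderiv i v) x - pderiv j (pderiv i w) x) <=
    C * (r ^- 4 + 1) * (2 * (e1 + e2)).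
Proof.
move=> r0 sv sw hC C0 Su Sf h1 h2 h3 h4.
have ms := @measurable_eball R n 0 s.
have sd := smoothB sv sw.
have E : (fun x => pderiv j (pderiv i v) x - pderiv j (pderiv i w) x) =
    pderiv j (pderiv i (fun x => v x - w x)).
  by rewrite (smooth_pderivB i sv sw) (smooth_pderivB j (smooth_pderiv i sv) (smooth_pderiv i sw)).
rewrite E; apply: le_trans (sqint_hessian_le i j 0 r sd) _; apply: le_trans (hC _ sd) _.
rewrite (laplacianB sv sw) -mulrA; apply: ler_wpM2l => //; rewrite [leRHS]mulrDl mul1r.
have k (a b c : V -> R) : sq_integrable (eball 0 s) a -> sq_integrable (eball 0 s) b ->
    sq_integrable (eball 0 s) c -> sqint (eball 0 s) (fun x => a x - c x) <= e1 ->
    sqint (eball 0 s) (fun x => b x - c x) <= e2 ->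
    sqint (eball 0 s) (fun x => a x - b x) <= 2 * (e1 + e2).
  move=> Sa Sb Sc ha hb; apply: le_trans (sqint_triangle ms Sa Sc Sb) _.
  have -> : sqint (eball 0 s) (fun x => c x - b x) = sqint (eball 0 s) (fun x => b x - c x).
    by apply: eq_Rintegral => x _; rewrite -sqrrN opprB.
  by rewrite mulrDr; apply: lerD; apply: ler_wpM2l.
apply: lerD.
  apply: ler_wpM2l; first by rewrite invr_ge0 exprn_ge0// ltW.
  by apply: (k v w u) => //; exact: smooth_sq_integrable.
by apply: (k _ _ f) => //; apply: smooth_sq_integrable; exact: smooth_laplacian.
Qed.

(** Smooth approximations are close to the solution only on balls strictly
    inside the unit ball; these radii exhaust it. *)
Let radius (k : nat) : R := 1 - 2 ^- k.+1.

Let radius_lt1 k : radius k < 1.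
Proof. by rewrite /radius ltrBlDr ltrDl invr_gt0 exprn_gt0. Qed.

Let exists_radius (r : R) : r < 1 -> exists K, forall k, (K <= k)%N -> r <= radius k.
Proof.
move=> r1; have d0 : 0 < 1 - r by rewrite subr_gt0.
exists (Num.trunc (1 - r)^-1).+1 => k Kk; rewrite /radius.
have : (1 - r)^-1 <= 2 ^+ k.+1.
  apply: le_trans (ltW (truncnS_gt _)) _; rewrite -natrX ler_nat.
  by apply: leq_trans Kk _; apply: leq_trans (leqnSn k) _; apply: ltnW; exact: ltn_expl.
move=> h; have : 2 ^- k.+1 <= 1 - r by rewrite -[leRHS]invrK lef_pV2// ?posrE ?exprn_gt0// invr_gt0.
by lra.
Qed.

Let exists_power (e : R) : 0 < e -> exists K, forall k, (K <= k)%N -> (2 ^- k) ^+ 2 <= e.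
Proof.
move=> e0; exists (Num.trunc e^-1).+1 => k Kk.
have h : e^-1 <= 2 ^+ k.
  apply: le_trans (ltW (truncnS_gt _)) _; rewrite -natrX ler_nat.
  by apply: leq_trans Kk _; apply: ltnW; exact: ltn_expl.
have h1 : 2 ^- k <= e by rewrite -[leRHS]invrK lef_pV2// ?posrE ?exprn_gt0// invr_gt0.
apply: le_trans h1; rewrite expr2 ler_piMl// ?invr_ge0 ?exprn_ge0//.
by rewrite invf_le1 ?exprn_gt0// exprn_ege1// ler1n.
Qed.

(** The second derivatives of smooth approximations form a Cauchy sequence in
    [L^2] of each smaller ball, by the interior Hessian bound. Their limit is
    the weak Hessian, and it comes with smooth functions that approximate the
    solution, its Laplacian, its gradient and its Hessian simultaneously: every
    estimate for smooth functions can then be passed to the limit. *)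
Lemma weak_second_derivatives u f Du : W12loc B1 u Du ->
  (forall phi, test_function B1 phi ->
    \sum_i \int[leb]_(x in B1) (Du i x * pderiv i phi x) = - \int[leb]_(x in B1) (f x * phi x)) ->
  (forall s : R, s < 1 -> sq_integrable (eball 0 s) f) ->
  exists D2u : 'I_n * 'I_n -> V -> R, [/\ weak_D2 B1 u Du D2u,
    forall p (r : R), r < 1 -> sq_integrable (eball 0 r) (D2u p) &
    forall r e : R, r < 1 -> 0 < e ->
    exists v, [/\ smooth v, sqint (eball 0 r) (fun x => v x - u x) <= e,
      sqint (eball 0 r) (fun x => laplacian v x - f x) <= e,
      forall i, sqint (eball 0 r) (fun x => pderiv i v x - Du i x) <= e &
      forall i j, sqint (eball 0 r) (fun x => pderiv j (pderiv i v) x - D2u (i, j) x) <= e]].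
Proof.
move=> WD wf Sf; have [Lu LD] := WD.
have Su r : r < 1 -> sq_integrable (eball 0 r) u by move=> r1; exact: Lloc2_sq_integrable r1 Lu.
have SD i r : r < 1 -> sq_integrable (eball 0 r) (Du i).
  by move=> r1; exact: Lloc2_sq_integrable r1 (LD i).1.
have ek k : 0 < (2 ^- k) ^+ 2 :> R by rewrite exprn_gt0// invr_gt0 exprn_gt0.
have [v hv] := choice (fun k => smooth_approximation WD wf Sf (radius_lt1 k) (ek k)).
have sv k : smooth (v k) by have [] := hv k.
have sub (h : V -> R) r k : r <= radius k -> sq_integrable (eball 0 (radius k)) h ->
    sqint (eball 0 r) h <= sqint (eball 0 (radius k)) h.
  by move=> rk Sh; apply: sqintS => //; [exact: measurable_eball..|exact: subset_eball].
have hu r k : r <= radius k -> sqint (eball 0 r) (fun x => v k x - u x) <= (2 ^- k) ^+ 2.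
  move=> rk; have [_ h _ _] := hv k; apply: le_trans h; apply: sub => //.
  apply: sq_integrableB; [exact: measurable_eball|exact: smooth_sq_integrable|exact: Su].
have hf r k : r <= radius k -> sqint (eball 0 r) (fun x => laplacian (v k) x - f x) <= (2 ^- k) ^+ 2.
  move=> rk; have [_ _ h _] := hv k; apply: le_trans h; apply: sub => //.
  apply: sq_integrableB; [exact: measurable_eball| |exact: Sf].
  exact: smooth_sq_integrable _ _ (smooth_laplacian (sv k)).
have hD r k i : r <= radius k -> sqint (eball 0 r) (fun x => pderiv i (v k) x - Du i x) <= (2 ^- k) ^+ 2.
  move=> rk; have [_ _ _ h] := hv k; apply: le_trans (h i); apply: sub => //.
  apply: sq_integrableB; [exact: measurable_eball| |exact: SD].
  exact: smooth_sq_integrable _ _ (smooth_pderiv i (sv k)).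
have HG (p : 'I_n * 'I_n) : exists2 G : V -> R, measurable_fun setT G & forall r : R, r < 1 ->
    sq_integrable (eball 0 r) G /\ forall e : R, 0 < e -> exists K, forall k, (K <= k)%N ->
      sqint (eball 0 r) (fun x => pderiv p.2 (pderiv p.1 (v k)) x - G x) <= e.
  have spp k := smooth_pderiv p.2 (smooth_pderiv p.1 (sv k)).
  apply: (@riesz_fischer R n (fun k => pderiv p.2 (pderiv p.1 (v k)))).
  - by move=> k; exact: continuous_measurable_rV (smooth_continuous (spp k)).
  - by move=> k r; exact: smooth_sq_integrable _ _ (spp k).
  move=> r r1; pose r0 := Num.max r 2^-1.
  have r00 : 0 < r0 by rewrite lt_max invr_gt0 ltr0Sn orbT.
  have r01 : r0 < 1 by rewrite gt_max r1 invf_lt1// ltr1n.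
  pose s := (r0 + 1) / 2 / r0.
  have s1 : 1 < s by rewrite /s ltr_pdivlMr// mul1r; lra.
  have rs : r0 * s = (r0 + 1) / 2 by rewrite /s; field; rewrite gt_eqF.
  have rs1 : r0 * s < 1 by rewrite rs; lra.
  have [K hK] := exists_radius rs1; have [C C0 hC] := hessian_bound n s1.
  have C1 : 0 <= C * (r0 ^- 4 + 1) by rewrite mulr_ge0// addr_ge0// invr_ge0 exprn_ge0// ltW.
  exists K; exists (C * (r0 ^- 4 + 1) * 4) => [|k l /andP[Kk kl]]; first by rewrite mulr_ge0.
  have hC0 w : smooth w -> \int[leb]_(y in eball 0 r0) hess_sq w y <=
      C * (r0 ^- 4 * sqint (eball 0 (r0 * s)) w + sqint (eball 0 (r0 * s)) (laplacian w)).
    move=> sw; have := hC w 0 0 r0 sw r00.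
    by have -> : (fun y => laplacian w y - 0) = laplacian w by apply/funext => y; rewrite subr0.
  have Kl : (K <= l)%N by exact: leq_trans kl.
  have H := hessian_cauchy p.1 p.2 r00 (sv l) (sv k) hC0 C0 (Su _ rs1) (Sf _ rs1)
    (hu _ _ (hK l Kl)) (hu _ _ (hK k Kk)) (hf _ _ (hK l Kl)) (hf _ _ (hK k Kk)).
  apply: le_trans (le_trans _ H) _.
    apply: sqintS; [exact: measurable_eball|exact: measurable_eball| |].
      by apply: subset_eball; rewrite le_max lexx.
    exact: smooth_sq_integrable _ _ (smoothB (spp l) (spp k)).
  rewrite -[leRHS]mulrA ler_wpM2l//.
  have : (2 ^- l) ^+ 2 <= (2 ^- k) ^+ 2 :> R.
    rewrite lerXn2r ?nnegrE ?invr_ge0 ?exprn_ge0// lef_pV2 ?posrE ?exprn_gt0//.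
    by rewrite ler_weXn2l// ler1n.
  by move: (_ ^+ 2) (_ ^+ 2) => a b ab; lra.
pose D2u p := s2val (cid2 (HG p)).
have mD2 p : measurable_fun setT (D2u p) := s2valP (cid2 (HG p)).
have hD2 p r : r < 1 -> _ := s2valP' (cid2 (HG p)) r.
have SD2 p r : r < 1 -> sq_integrable (eball 0 r) (D2u p) by move=> /(hD2 p)[].
have approx (r e : R) : r < 1 -> 0 < e ->
    exists v, [/\ smooth v, sqint (eball 0 r) (fun x => v x - u x) <= e,
      sqint (eball 0 r) (fun x => laplacian v x - f x) <= e,
      forall i, sqint (eball 0 r) (fun x => pderiv i v x - Du i x) <= e &
      forall i j, sqint (eball 0 r) (fun x => pderiv j (pderiv i v) x - D2u (i, j) x) <= e].
  move=> r1 e0; have [K1 hK1] := exists_radius r1; have [K2 hK2] := exists_power e0.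
  have H p : exists K, forall k, (K <= k)%N ->
      sqint (eball 0 r) (fun x => pderiv p.2 (pderiv p.1 (v k)) x - D2u p x) <= e.
    by have [_] := hD2 p r r1; exact.
  have [K3 hK3] := choice H.
  pose k := maxn K1 (maxn K2 (\max_p K3 p)).
  have k1 : (K1 <= k)%N by exact: leq_maxl.
  have k2 : (K2 <= k)%N by rewrite /k leq_max (leq_maxl K2) orbT.
  exists (v k); split => //.
  - exact: le_trans (hu _ _ (hK1 k k1)) (hK2 k k2).
  - exact: le_trans (hf _ _ (hK1 k k1)) (hK2 k k2).
  - by move=> i; exact: le_trans (hD _ _ i (hK1 k k1)) (hK2 k k2).
  - move=> i j; apply: (hK3 (i, j) k); rewrite /k !leq_max.
    by rewrite (leq_bigmax (i, j)) !orbT.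
exists D2u; split; [|exact: SD2|exact: approx].
split; first by move=> i; exact: (LD i).2.
move=> i j; split.
- by have [_ []] := LD i.
- apply: sq_integrable_Lloc1; first exact: measurable_funTS.
  by move=> r r1; exact: SD2.
move=> phi /test_function_supported[sp [s s1 Sp]].
pose r := (s + 1) / 2; have sr : s < r by rewrite /r; lra.
have r1 : r < 1 by rewrite /r; lra.
have rB : eball 0 r `<=` B1 by apply: subset_eball; exact: ltW.
have Sdp := supported_pderiv j sp Sp.
have out (h : V -> R) x : supported 0 s h -> ~ eball 0 r x -> h x = 0.
  move=> Sh nx; apply: Sh; apply: lt_le_trans sr _; rewrite leNgt; apply/negP => xr.
  by apply: nx; rewrite eballE.
rewrite (Rintegral_vanish rB); last by move=> x _ nx; rewrite (out _ _ Sdp nx) mulr0.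
rewrite [in RHS](Rintegral_vanish rB); last by move=> x _ nx; rewrite (out _ _ Sp nx) mulr0.
have mr := @measurable_eball R n 0 r.
apply: (pairing_limit mr); [exact: SD|exact: SD2| | |].
- exact: smooth_sq_integrable _ _ (smooth_pderiv j sp).
- exact: smooth_sq_integrable.
move=> e e0; have [w [sw _ _ h1 h2]] := approx r e r1 e0.
have si := smooth_pderiv i sw; have sij := smooth_pderiv j si.
exists (pderiv i w); exists (pderiv j (pderiv i w)); split.
- exact: smooth_sq_integrable _ _ si.
- exact: smooth_sq_integrable _ _ sij.
- exact: h1.
- exact: h2.
have S1 : supported 0 s (fun x => phi x * pderiv i w x) by move=> x xs; rewrite (Sp x xs) mul0r.
have := Rintegral_by_parts j sp si Sp.
rewrite (Rintegral_vanish (@subsetT _ (eball 0 r))); last by move=> x _ nx; rewrite (out _ _ Sp nx) mul0r.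
rewrite [in RHS](Rintegral_vanish (@subsetT _ (eball 0 r))); last by move=> x _ nx; rewrite (out _ _ Sdp nx) mul0r.
move=> H.
have E1 : \int[leb]_(x in eball 0 r) (pderiv i w x * pderiv j phi x) =
    \int[leb]_(x in eball 0 r) (pderiv j phi x * pderiv i w x).
  by apply: eq_Rintegral => x _; exact: (mulrC (pderiv i w x) (pderiv j phi x)).
have E2 : \int[leb]_(x in eball 0 r) (pderiv j (pderiv i w) x * phi x) =
    \int[leb]_(x in eball 0 r) (phi x * pderiv j (pderiv i w) x).
  by apply: eq_Rintegral => x _; exact: (mulrC (pderiv j (pderiv i w) x) (phi x)).
apply: etrans (congr2 +%R E1 (etrans E2 H)) _; exact: subrr.
Qed.

End second_derivatives.

(** * Campanato iteration *)

Section campanato_iteration.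
Context (R : realType) (n : nat).
Local Notation V := 'rV[R]_n.
Local Notation leb := (lebesgue_rV R n).
Implicit Types (f g u v P : V -> R) (x y z : V) (A : set V).

Lemma excess_step (n4 : nat) (C0 th X0 F r a a' b q : R) : 0 <= C0 -> 0 < th ->
  C0 * th ^+ 2 <= 4^-1 -> 0 < r -> 0 <= F ->
  a' <= C0 * (th ^+ (n4 + 2) * a + r ^+ 4 * b) ->
  a <= r ^+ n4 * (q * X0 + 2 * C0 * th ^- n4 * F) ->
  r ^+ 4 * b <= F * r ^+ n4 -> 0 <= q * X0 ->
  a' <= (th * r) ^+ n4 * (4^-1 * q * X0 + 2 * C0 * th ^- n4 * F).
Proof.
move=> C00 th0 Cth r0 F0 ha' ha hb X00; apply: le_trans ha' _.
have t0 : 0 < th ^+ n4 by rewrite exprn_gt0.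
have s0 : 0 < r ^+ n4 by rewrite exprn_gt0.
have h1 := ler_wpM2l C00 (lerD (ler_wpM2l (exprn_ge0 (n4 + 2) (ltW th0)) ha) hb).
apply: le_trans h1 _.
have E1 : C0 * (th ^+ (n4 + 2) * (r ^+ n4 * (q * X0 + 2 * C0 * th ^- n4 * F)) + F * r ^+ n4) =
  th ^+ n4 * r ^+ n4 * ((C0 * th ^+ 2) * (q * X0 + 2 * C0 * th ^- n4 * F) + C0 * th ^- n4 * F).
  by rewrite exprD; field; rewrite gt_eqF.
rewrite E1 exprMn; apply: ler_wpM2l; first by rewrite mulr_ge0 ?ltW.
have D0 : 0 <= C0 * th ^- n4 * F by rewrite !mulr_ge0// invr_ge0 ltW.
have E2 : 2 * C0 * th ^- n4 * F = 2 * (C0 * th ^- n4 * F) by ring.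
have E3 : 4^-1 * q * X0 = 4^-1 * (q * X0) by ring.
rewrite E2 E3; move: D0 X00; move: (C0 * th ^- n4 * F) (q * X0) => d x d0 x0.
have := ler_wpM2r (addr_ge0 x0 (mulr_ge0 (ler0n R 2) d0)) Cth; lra.
Qed.

(** Campanato's iteration. If [P] approximates [v] at one scale, applying
    [quadratic_approximation] to [v - P] and adding the result to [P] gives an
    approximation at the next scale. For [th] small the squared distance divided
    by [r ^+ (n + 4)] is divided by four at each step, up to the oscillation [F]
    of the Laplacian, which adds up to a geometric series. The factor [4 ^- K]
    in front of the initial distance is kept: it makes the starting radius
    irrelevant after enough steps. *)
Lemma excess_decay : exists2 th : R, 0 < th <= 2^-1 & exists2 C, 0 <= C &
  forall v x0 (rho F : R) (c : nat -> R) (K : nat), smooth v -> 0 < rho -> 0 <= F ->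
    (forall k, (k < K)%N -> sqint (eball x0 (th ^+ k * rho)) (fun x => laplacian v x - c k) <=
       F * (th ^+ k * rho) ^+ n) ->
    exists2 P, quadratic P & sqint (eball x0 (th ^+ K * rho)) (fun x => v x - P x) <=
      (th ^+ K * rho) ^+ (n + 4) *
      (4 ^- K * (rho ^- (n + 4) * sqint (eball x0 rho) v) + C * F).
Proof.
have [C0 C00 hC] := quadratic_approximation R n.
pose th : R := (2 * (1 + C0))^-1.
have d0 : 0 < 1 + C0 by rewrite ltr_pwDl.
have th0 : 0 < th by rewrite invr_gt0 mulr_gt0.
have thC : th * (1 + C0) = 2^-1 by rewrite /th; field; rewrite gt_eqF.
have th2 : th <= 2^-1 by rewrite -thC ler_peMr ?(ltW th0)// lerDl.
have Cth : C0 * th ^+ 2 <= 4^-1.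
  have h1 : C0 * th <= 2^-1 by rewrite -thC mulrC; apply: ler_wpM2l; [exact: ltW|rewrite lerDr].
  have -> : C0 * th ^+ 2 = (C0 * th) * th by ring.
  have -> : 4^-1 = 2^-1 * 2^-1 :> R by field.
  by apply: ler_pM => //; [rewrite mulr_ge0// ltW|exact: ltW].
exists th; first by rewrite th0.
have C10 : 0 <= 2 * C0 * th ^- (n + 4) by rewrite !mulr_ge0// invr_ge0 exprn_ge0 ?ltW.
exists (2 * C0 * th ^- (n + 4)) => // v x0 rho F c K sv rho0 F0; elim: K => [_|K IH H].
  exists (fun=> 0); first exact: quadratic_cst.
  rewrite !expr0 !mul1r invr1 mul1r mulrDr mulrA mulfV ?expf_neq0 ?gt_eqF// mul1r.
  have -> : (fun x => v x - 0) = v by apply/funext => x; rewrite subr0.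
  rewrite lerDl mulr_ge0//; [by rewrite exprn_ge0// ltW|exact: mulr_ge0].
have [|P qP hP] := IH _; first by move=> k kK; apply: H; rewrite ltnS ltnW.
have [sP _] := qP; have [cP LP] := quadratic_laplacian qP.
pose r := th ^+ K * rho; have r0 : 0 < r by rewrite mulr_gt0 ?exprn_gt0.
have th12 : 0 < th <= 2^-1 by rewrite th0.
have [Q qQ hQ] := hC th _ (c K - cP) x0 r th12 r0 (smoothB sv sP).
exists (fun x => P x + Q x); first exact: quadraticD.
rewrite exprS -mulrA -/r.
have -> : (fun x => v x - (P x + Q x)) = (fun x => v x - P x - Q x).
  by apply/funext => x; rewrite opprD addrA.
have E : (fun x => laplacian (fun x => v x - P x) x - (c K - cP)) = (fun x => laplacian v x - c K).
  apply/funext => x; rewrite (laplacianB sv sP) LP.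
  by move: (laplacian v x) => l; ring.
rewrite E in hQ.
have hK : r ^+ 4 * sqint (eball x0 r) (fun x => laplacian v x - c K) <= F * r ^+ (n + 4).
  have := ler_wpM2l (exprn_ge0 4 (ltW r0)) (H K (ltnSn K)); rewrite -/r => h.
  by apply: le_trans h _; rewrite mulrCA -exprD addnC.
have X0 : 0 <= 4 ^- K * (rho ^- (n + 4) * sqint (eball x0 rho) v).
  by rewrite mulr_ge0 ?invr_ge0 ?exprn_ge0// mulr_ge0 ?sqint_ge0// invr_ge0 exprn_ge0// ltW.
have E6 : (n + 6 = n + 4 + 2)%N by rewrite -addnA.
rewrite E6 in hQ; have := excess_step C00 th0 Cth r0 F0 hQ hP hK X0.
by rewrite -invfM -exprS.
Qed.

Lemma hessian_decay_arith (n0 : nat) (Ch C1 s th X F r a b rn : R) :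
  0 <= Ch -> 0 <= C1 -> 0 < s -> 0 < th -> 0 < r -> 0 < rn -> th * rn < r * s ->
  0 <= X -> 0 <= F ->
  a <= rn ^+ (n0 + 4) * (X + C1 * F) -> b <= F * rn ^+ n0 ->
  Ch * (r ^- 4 * a + b) <=
  Ch * ((s / th) ^+ (n0 + 4) * (1 + C1) + (s / th) ^+ n0) * (r ^+ n0 * (X + F)).
Proof.
move=> Ch0 C10 s0 th0 r0 rn0 thr X0 F0 ha hb; rewrite -mulrA; apply: ler_wpM2l => //.
have hr : rn <= r * (s / th) by rewrite mulrA ler_pdivlMr// mulrC ltW.
have st0 : 0 < s / th by rewrite divr_gt0.
pose q := s / th; rewrite -/q in hr st0 *.
have p m : rn ^+ m <= r ^+ m * q ^+ m.
  by rewrite -exprMn lerXn2r// nnegrE ltW// mulr_gt0.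
have r40 : 0 <= r ^- 4 by rewrite invr_ge0 exprn_ge0// ltW.
have XF0 : 0 <= X + C1 * F by rewrite addr_ge0// mulr_ge0.
have h1 := ler_wpM2l r40 (le_trans ha (ler_wpM2r XF0 (p (n0 + 4)%N))).
have h2 := le_trans hb (ler_wpM2l F0 (p n0)).
apply: le_trans (lerD h1 h2) _.
have -> : r ^- 4 * (r ^+ (n0 + 4) * q ^+ (n0 + 4) * (X + C1 * F)) =
    r ^+ n0 * q ^+ (n0 + 4) * (X + C1 * F).
  by rewrite exprD; field; rewrite gt_eqF.
have P0 : 0 <= r ^+ n0 * q ^+ (n0 + 4) by rewrite mulr_ge0 ?exprn_ge0 ?ltW.
have Q0 : 0 <= r ^+ n0 * q ^+ n0 by rewrite mulr_ge0 ?exprn_ge0 ?ltW.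
have -> : (q ^+ (n0 + 4) * (1 + C1) + q ^+ n0) * (r ^+ n0 * (X + F)) =
    r ^+ n0 * q ^+ (n0 + 4) * ((1 + C1) * (X + F)) + r ^+ n0 * q ^+ n0 * (X + F) by ring.
apply: lerD.
  apply: ler_wpM2l => //; rewrite mulrDl mul1r mulrDr.
  have := mulr_ge0 C10 X0; lra.
by rewrite mulrC; apply: ler_wpM2l => //; rewrite lerDr.
Qed.

(** The interior Hessian bound applied to [v - P], with [P] the quadratic
    function of [excess_decay]: its Hessian is the constant [m]. The radius [r]
    lies between two consecutive scales of the iteration. *)
Lemma hessian_decay : exists2 th : R, 0 < th <= 2^-1 & forall s : R, 1 < s ->
  exists2 C, 0 <= C &
  forall v x0 (rho r F : R) (c : nat -> R) (K : nat), smooth v -> 0 < rho -> 0 < r -> 0 <= F ->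
    th ^+ K.+1 * rho < r * s <= th ^+ K * rho ->
    (forall k, (k <= K)%N -> sqint (eball x0 (th ^+ k * rho)) (fun x => laplacian v x - c k) <=
       F * (th ^+ k * rho) ^+ n) ->
    exists m : 'I_n -> 'I_n -> R,
      \int[leb]_(x in eball x0 r) (\sum_i \sum_j (pderiv j (pderiv i v) x - m i j) ^+ 2) <=
      C * (r ^+ n * (4 ^- K * (rho ^- (n + 4) * sqint (eball x0 rho) v) + F)).
Proof.
have [th th12 [C1 C10 hC1]] := excess_decay; exists th => // s s1.
have s0 : 0 < s by apply: lt_trans s1.
have /andP[th0 _] := th12.
have [Ch Ch0 hCh] := hessian_bound n s1.
have q0 : 0 <= s / th by rewrite divr_ge0 ?ltW.
exists (Ch * ((s / th) ^+ (n + 4) * (1 + C1) + (s / th) ^+ n)).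
  by rewrite mulr_ge0// addr_ge0 ?exprn_ge0// mulr_ge0 ?exprn_ge0// addr_ge0.
move=> v x0 rho r F c K sv rho0 r0 F0 /andP[thr rth] H.
have [|P qP hP] := hC1 v x0 rho F c K sv rho0 F0; first by move=> k /ltnW; exact: H.
have [sP [m mP]] := qP; have [cP LP] := quadratic_laplacian qP; exists m.
have sd := smoothB sv sP.
have -> : (fun x => \sum_i \sum_j (pderiv j (pderiv i v) x - m i j) ^+ 2) =
    hess_sq (fun x => v x - P x).
  apply/funext => x; apply: eq_bigr => i _; apply: eq_bigr => j _.
  rewrite (smooth_pderivB i sv sP).
  rewrite (smooth_pderivB j (smooth_pderiv i sv) (smooth_pderiv i sP)).
  by rewrite (mP i j).
apply: le_trans (hCh _ (c K - cP) x0 r sd r0) _.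
have E : (fun x => laplacian (fun x => v x - P x) x - (c K - cP)) = (fun x => laplacian v x - c K).
  apply/funext => x; rewrite (laplacianB sv sP) LP.
  by move: (laplacian v x) => l; ring.
rewrite E; pose rn := th ^+ K * rho; have rn0 : 0 < rn by rewrite mulr_gt0 ?exprn_gt0.
have sub (h : V -> R) : smooth h -> sqint (eball x0 (r * s)) h <= sqint (eball x0 rn) h.
  move=> sh; apply: sqintS; [exact: measurable_eball..|exact: subset_eball|].
  exact: smooth_sq_integrable.
have X0 : 0 <= 4 ^- K * (rho ^- (n + 4) * sqint (eball x0 rho) v).
  by rewrite mulr_ge0 ?invr_ge0 ?exprn_ge0// mulr_ge0 ?sqint_ge0// invr_ge0 exprn_ge0// ltW.
have thr' : th * rn < r * s by rewrite /rn mulrA -exprS.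
apply: (hessian_decay_arith Ch0 C10 s0 th0 r0 rn0 thr' X0 F0).
- exact: le_trans (sub _ sd) hP.
- exact: le_trans (sub _ (smoothB (smooth_laplacian sv) (@smooth_cst R n (c K)))) (H K (leqnn K)).
Qed.

End campanato_iteration.

(** * Estimates for weak solutions *)

Section weak_campanato.
Context (R : realType) (n : nat).
Local Notation V := 'rV[R]_n.
Local Notation leb := (lebesgue_rV R n).
Implicit Types (f g u v P : V -> R) (x y z : V) (A : set V) (Du : 'I_n -> V -> R)
  (D2u : 'I_n * 'I_n -> V -> R).

(** The mean is the orthogonal projection to the constants. *)
Lemma sqint_mean_le A f (c : R) : measurable A -> (0 < leb A)%E -> (leb A < +oo)%E ->
  sq_integrable A f -> sqint A (fun x => f x - mean A f) <= sqint A (fun x => f x - c).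
Proof.
move=> mA A0 Aoo Sf; have Sc d := sq_integrable_cst d mA Aoo.
have m0 : 0 < fine (leb A) by apply: fine_gt0; rewrite A0.
have fi := sq_integrable_integrable mA Aoo Sf.
have S1 := sq_integrableB mA Sf (Sc (mean A f)).
have i1 := sq_integrable_integrable mA Aoo S1.
pose d := mean A f - c; have [_ j1] := S1.
have [_ j3] := Sc d; have j2 := integrable_RZ (2 * d) mA i1.
have I0 : \int[leb]_(x in A) (f x - mean A f) = 0.
  have [_ ic] := Sc 1.
  rewrite RintegralB//; last exact: sq_integrable_integrable (Sc _).
  have -> : \int[leb]_(x in A) mean A f = mean A f * fine (leb A) by exact: Rintegral_cst.
  by rewrite /mean mulrAC mulVf ?mul1r ?subrr// gt_eqF.
have E : (fun x => (f x - c) ^+ 2) =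
    (fun x => (f x - mean A f) ^+ 2 + 2 * d * (f x - mean A f) + d ^+ 2).
  by apply/funext => x; rewrite /d; ring.
rewrite [leRHS]/sqint E (RintegralD mA (integrable_RD mA j1 j2) j3) (RintegralD mA j1 j2).
rewrite (RintegralZl _ mA i1) I0 mulr0 addr0 lerDl.
by apply: Rintegral_ge0 => x _; exact: sqr_ge0.
Qed.

(** Passage to the limit of a bound for smooth approximations [d] of [D]: the
    error [e] is arbitrary while [M] is not, and the factor 2 comes from
    comparing the squares of [D] and [d]. *)
Lemma approximation_bound (N : finType) A (Y X M : R) : measurable A -> 0 <= M ->
  (forall e : R, 0 < e -> exists D d : N -> V -> R,
    [/\ Y <= \sum_p sqint A (D p), forall p, sq_integrable A (D p),
      forall p, sq_integrable A (d p), forall p, sqint A (fun x => d p x - D p x) <= e &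
      \int[leb]_(x in A) (\sum_p d p x ^+ 2) <= X + M * e]) -> Y <= 2 * X.
Proof.
move=> mA M0 H; apply/ler_addgt0Pr => t t0.
pose Q : R := 2 * #|N|%:R + 2 * M + 1.
have Q0 : 0 < Q by rewrite ltr_wpDl// addr_ge0// mulr_ge0.
have [D [d [hY SD Sd dD hX]]] := H (t / Q) (divr_gt0 t0 Q0).
apply: le_trans hY _.
apply: (@le_trans _ _ (\sum_p (2 * (t / Q) + 2 * sqint A (d p)))).
  apply: ler_sum => p _.
  have := sqintB_le mA (Sd p) (sq_integrableB mA (Sd p) (SD p)).
  have -> : (fun x => d p x - (d p x - D p x)) = D p.
    by apply/funext => x; rewrite opprB addrC subrK.
  have := dD p; lra.
rewrite big_split /= sumr_const -mulr_sumr.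
have -> : \sum_p sqint A (d p) = \int[leb]_(x in A) (\sum_p d p x ^+ 2).
  by rewrite Rintegral_sum// => p; have [] := Sd p.
have -> : 2 * X + t = 2 * (t / Q) *+ #|N| + 2 * (X + M * (t / Q)) + t / Q.
  by rewrite -mulr_natl /Q; field; rewrite gt_eqF.
have tQ : 0 <= t / Q by rewrite divr_ge0// ltW.
by apply: le_trans (_ : _ <= 2 * (t / Q) *+ #|N| + 2 * (X + M * (t / Q))) _;
  [rewrite lerD2l ler_wpM2l|rewrite lerDl].
Qed.

Section local_bounds.
Variables (u f : V -> R) (Du : 'I_n -> V -> R) (D2u : 'I_n * 'I_n -> V -> R) (r1 : R).
Hypotheses (Su : sq_integrable (eball 0 r1) u) (Sf : sq_integrable (eball 0 r1) f)
  (SD : forall i, sq_integrable (eball 0 r1) (Du i))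
  (SD2 : forall p, sq_integrable (eball 0 r1) (D2u p))
  (approx : forall e : R, 0 < e ->
    exists v, [/\ smooth v, sqint (eball 0 r1) (fun x => v x - u x) <= e,
      sqint (eball 0 r1) (fun x => laplacian v x - f x) <= e,
      forall i, sqint (eball 0 r1) (fun x => pderiv i v x - Du i x) <= e &
      forall i j, sqint (eball 0 r1) (fun x => pderiv j (pderiv i v) x - D2u (i, j) x) <= e]).

Let m1 : measurable (eball (0 : V) r1). Proof. exact: measurable_eball. Qed.

Let close_le A g h (e : R) : measurable A -> A `<=` eball 0 r1 -> smooth g ->
  sq_integrable (eball 0 r1) h -> sqint (eball 0 r1) (fun x => g x - h x) <= e ->
  sqint A g <= 2 * sqint A h + 2 * e.
Proof.
move=> mA Ar sg Sh he.
have Sg := smooth_sq_integrable 0 r1 sg; have Sgh := sq_integrableB m1 Sg Sh.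
have := sqintD_le mA (sq_integrableS mA m1 Ar Sgh) (sq_integrableS mA m1 Ar Sh).
have -> : (fun x => g x - h x + h x) = g by apply/funext => x; rewrite subrK.
have := sqintS mA m1 Ar Sgh; lra.
Qed.

Lemma weak_gradient_bound (r s C : R) : 0 < r -> r <= r1 -> s <= r1 -> 0 <= C ->
  (forall v, smooth v -> \int[leb]_(y in eball 0 r) grad_sq v y <=
     C * (sqint (eball 0 s) v + sqint (eball 0 s) (laplacian v))) ->
  \sum_i sqint (eball 0 r) (Du i) <= 4 * C * (sqint (eball 0 s) u + sqint (eball 0 s) f).
Proof.
move=> r0 rr sr C0 hC; have mr := @measurable_eball R n 0 r; have ms := @measurable_eball R n 0 s.
have rS : eball (0 : V) r `<=` eball 0 r1 by exact: subset_eball.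
have sS : eball (0 : V) s `<=` eball 0 r1 by exact: subset_eball.
have -> : 4 * C * (sqint (eball 0 s) u + sqint (eball 0 s) f) =
  2 * (2 * C * (sqint (eball 0 s) u + sqint (eball 0 s) f)) by ring.
apply: (@approximation_bound _ (eball 0 r) _ _ (4 * C) mr); first by rewrite mulr_ge0.
move=> e e0; have [v [sv h1 h2 h3 _]] := approx e0.
exists Du, (fun i => pderiv i v); split => //.
- by move=> i; exact: sq_integrableS mr m1 rS (SD i).
- by move=> i; exact: smooth_sq_integrable _ _ (smooth_pderiv i sv).
- move=> i; apply: le_trans (h3 i); apply: (sqintS mr m1 rS).
  exact: sq_integrableB m1 (smooth_sq_integrable _ _ (smooth_pderiv i sv)) (SD i).
apply: le_trans (hC v sv) _.
have k1 := close_le ms sS sv Su h1; have k2 := close_le ms sS (smooth_laplacian sv) Sf h2.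
apply: le_trans (ler_wpM2l C0 (lerD k1 k2)) _.
move: (sqint _ u) (sqint _ f) => a b; rewrite le_eqVlt; apply/orP; left; apply/eqP; ring.
Qed.

Lemma weak_hessian_bound (r s C : R) : 0 < r -> r <= r1 -> s <= r1 -> 0 <= C ->
  (forall v, smooth v -> \int[leb]_(y in eball 0 r) hess_sq v y <=
     C * (sqint (eball 0 s) v + sqint (eball 0 s) (laplacian v))) ->
  \sum_p sqint (eball 0 r) (D2u p) <= 4 * C * (sqint (eball 0 s) u + sqint (eball 0 s) f).
Proof.
move=> r0 rr sr C0 hC; have mr := @measurable_eball R n 0 r; have ms := @measurable_eball R n 0 s.
have rS : eball (0 : V) r `<=` eball 0 r1 by exact: subset_eball.
have sS : eball (0 : V) s `<=` eball 0 r1 by exact: subset_eball.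
have -> : 4 * C * (sqint (eball 0 s) u + sqint (eball 0 s) f) =
  2 * (2 * C * (sqint (eball 0 s) u + sqint (eball 0 s) f)) by ring.
apply: (@approximation_bound _ (eball 0 r) _ _ (4 * C) mr); first by rewrite mulr_ge0.
move=> e e0; have [v [sv h1 h2 _ h4]] := approx e0.
have sp (p : 'I_n * 'I_n) := smooth_pderiv p.2 (smooth_pderiv p.1 sv).
exists D2u, (fun p => pderiv p.2 (pderiv p.1 v)); split => //.
- by move=> p; exact: sq_integrableS mr m1 rS (SD2 p).
- by move=> p; exact: smooth_sq_integrable _ _ (sp p).
- move=> [i j]; apply: le_trans (h4 i j); apply: (sqintS mr m1 rS).
  exact: sq_integrableB m1 (smooth_sq_integrable _ _ (sp (i, j))) (SD2 (i, j)).
have -> : (fun x => \sum_(p : 'I_n * 'I_n) pderiv p.2 (pderiv p.1 v) x ^+ 2) = hess_sq v.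
  by apply/funext => x; rewrite /hess_sq pair_bigA.
apply: le_trans (hC v sv) _.
have k1 := close_le ms sS sv Su h1; have k2 := close_le ms sS (smooth_laplacian sv) Sf h2.
apply: le_trans (ler_wpM2l C0 (lerD k1 k2)) _.
move: (sqint _ u) (sqint _ f) => a b; rewrite le_eqVlt; apply/orP; left; apply/eqP; ring.
Qed.

(** [hessian_decay] at the limit. The set [A] will be the intersection of a
    ball with the domain, on which the mean is a better constant than the [m]
    of the smooth approximation. *)
Lemma weak_hessian_decay (th s C : R) : 0 < th <= 2^-1 -> 1 < s -> 0 <= C ->
  (forall v x0 (rho r F : R) (c : nat -> R) (K : nat), smooth v -> 0 < rho -> 0 < r -> 0 <= F ->
    th ^+ K.+1 * rho < r * s <= th ^+ K * rho ->
    (forall k, (k <= K)%N -> sqint (eball x0 (th ^+ k * rho)) (fun x => laplacian v x - c k) <=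
       F * (th ^+ k * rho) ^+ n) ->
    exists m : 'I_n -> 'I_n -> R,
      \int[leb]_(x in eball x0 r) (\sum_i \sum_j (pderiv j (pderiv i v) x - m i j) ^+ 2) <=
      C * (r ^+ n * (4 ^- K * (rho ^- (n + 4) * sqint (eball x0 rho) v) + F))) ->
  forall x0 (rho r F : R) (c : nat -> R) (K : nat) A, 0 < rho -> 0 < r -> 0 <= F ->
    eball x0 rho `<=` eball 0 r1 ->
    th ^+ K.+1 * rho < r * s <= th ^+ K * rho ->
    (forall k, (k <= K)%N -> sqint (eball x0 (th ^+ k * rho)) (fun x => f x - c k) <=
       F * (th ^+ k * rho) ^+ n) ->
    measurable A -> (0 < leb A)%E -> A `<=` eball x0 r ->
    \sum_p sqint A (fun x => D2u p x - mean A (D2u p)) <=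
      4 * C * (r ^+ n * (4 ^- K * (rho ^- (n + 4) * sqint (eball x0 rho) u) + F)).
Proof.
move=> /andP[th0 th1] s1 C0 hC x0 rho r F c K A rho0 r0 F0 xr1 rK hf mA A0 Ar.
have thk k : th ^+ k <= 1 by rewrite exprn_ile1 ?(ltW th0)//; lra.
have rr : r <= rho.
  have /andP[_ h] := rK; apply: le_trans (_ : r * s <= _); first by rewrite ler_peMr// ltW.
  by apply: le_trans h _; rewrite ler_piMl// ltW.
have mr := @measurable_eball R n x0 r; have mrho := @measurable_eball R n x0 rho.
have rS : eball x0 r `<=` eball 0 r1 by apply: subset_trans xr1; exact: subset_eball.
have Aoo : (leb A < +oo)%E.
  by apply: le_lt_trans (lebesgue_eball_lty x0 r); apply: le_measure => //; rewrite inE.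
pose rk k := th ^+ k * rho; have rk0 k : 0 < rk k by rewrite mulr_gt0 ?exprn_gt0.
pose U := sqint (eball x0 rho) u.
pose q : R := 4 ^- K * rho ^- (n + 4); have q0 : 0 <= q.
  by rewrite mulr_ge0// invr_ge0 exprn_ge0// ltW.
have rn0 : 0 <= r ^+ n by rewrite exprn_ge0// ltW.
have Rn0 : 0 <= rk K ^- n by rewrite invr_ge0 exprn_ge0// ltW.
have -> : 4 * C * (r ^+ n * (4 ^- K * (rho ^- (n + 4) * U) + F)) =
  2 * (2 * C * (r ^+ n * (q * U + F))) by rewrite /q; ring.
apply: (@approximation_bound _ (eball x0 r) _ _ (C * (r ^+ n * (q * 2 + 2 * rk K ^- n))) mr).
  by rewrite !mulr_ge0// addr_ge0// mulr_ge0.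
move=> e e0; have [v [sv h1 h2 _ h4]] := approx e0.
have sL := smooth_laplacian sv.
have F'0 : 0 <= 2 * F + 2 * (e * rk K ^- n).
  by rewrite addr_ge0// mulr_ge0// mulr_ge0// ltW.
have hL k : (k <= K)%N -> sqint (eball x0 (rk k)) (fun x => laplacian v x - c k) <=
    (2 * F + 2 * (e * rk K ^- n)) * rk k ^+ n.
  move=> kK; have mk := @measurable_eball R n x0 (rk k).
  have kS : eball x0 (rk k) `<=` eball 0 r1.
    by apply: subset_trans xr1; apply: subset_eball; rewrite /rk ler_piMl// ltW.
  have S1 := smooth_sq_integrable x0 (rk k) sL.
  have S2 := sq_integrableS mk m1 kS Sf.
  have S3 := sq_integrable_cst (c k) mk (lebesgue_eball_lty _ _).
  apply: le_trans (sqint_triangle mk S1 S2 S3) _.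
  have l1 := le_trans (sqintS mk m1 kS (sq_integrableB m1 (smooth_sq_integrable 0 r1 sL) Sf)) h2.
  have l2 := hf k kK.
  have l3 : e <= e * rk K ^- n * rk k ^+ n.
    rewrite -mulrA ler_peMr ?(ltW e0)// mulrC ler_pdivlMr ?exprn_gt0// mul1r.
    rewrite lerXn2r ?nnegrE ?(ltW (rk0 _))// /rk ler_wpM2r ?(ltW rho0)//.
    by apply: ler_wiXn2l => //; [exact: ltW|lra].
  rewrite -/(rk k) in l2; move: l1 l2 l3.
  move: (sqint _ _) (sqint _ _) => a1 a2 l1 l2 l3; rewrite [leRHS]mulrDl.
  have -> : 2 * (e / rk K ^+ n) * rk k ^+ n = 2 * (e * rk K ^- n * rk k ^+ n) by ring.
  have -> : 2 * F * rk k ^+ n = 2 * (F * rk k ^+ n) by ring.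
  lra.
have [m hm] := hC v x0 rho r _ c K sv rho0 r0 F'0 rK hL.
exists (fun p x => D2u p x - m p.1 p.2), (fun p x => pderiv p.2 (pderiv p.1 v) x - m p.1 p.2).
have sp (p : 'I_n * 'I_n) := smooth_pderiv p.2 (smooth_pderiv p.1 sv).
have SDr p : sq_integrable (eball x0 r) (fun x => D2u p x - m p.1 p.2).
  apply: (sq_integrableB mr (sq_integrableS mr m1 rS (SD2 p))).
  exact: sq_integrable_cst mr (lebesgue_eball_lty _ _).
split => //.
- apply: ler_sum => p _; apply: le_trans (sqint_mean_le (m p.1 p.2) mA A0 Aoo _) _.
    exact: sq_integrableS mA mr Ar (sq_integrableS mr m1 rS (SD2 p)).
  exact: sqintS mA mr Ar (SDr p).
- move=> p; exact: smooth_sq_integrable _ _ (smoothB (sp p) (@smooth_cst R n (m p.1 p.2))).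
- move=> [i j]; apply: le_trans (h4 i j).
  have -> : (fun x => pderiv (i, j).2 (pderiv (i, j).1 v) x - m (i, j).1 (i, j).2 -
      (D2u (i, j) x - m (i, j).1 (i, j).2)) = (fun x => pderiv j (pderiv i v) x - D2u (i, j) x).
    apply/funext => x /=; move: (pderiv j _ x) (D2u _ x) (m i j) => a1 a2 a3; ring.
  apply: (sqintS mr m1 rS).
  exact: sq_integrableB m1 (smooth_sq_integrable _ _ (sp (i, j))) (SD2 (i, j)).
have -> : (fun x => \sum_(p : 'I_n * 'I_n) (pderiv p.2 (pderiv p.1 v) x - m p.1 p.2) ^+ 2) =
    (fun x => \sum_i \sum_j (pderiv j (pderiv i v) x - m i j) ^+ 2).
  by apply/funext => x; rewrite pair_bigA.
apply: le_trans hm _; have k1 := close_le mrho xr1 sv Su h1.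
have -> : 2 * C * (r ^+ n * (q * U + F)) + C * (r ^+ n * (q * 2 + 2 * rk K ^- n)) * e =
  C * (r ^+ n * (q * (2 * U + 2 * e) + (2 * F + 2 * (e * rk K ^- n)))) by ring.
apply: ler_wpM2l => //; apply: ler_wpM2l => //; rewrite lerD2r mulrA.
exact: ler_wpM2l.
Qed.

End local_bounds.
End weak_campanato.

(** * Averages and scales *)

Section averages.
Context (R : realType) (n : nat).
Local Notation V := 'rV[R]_n.
Local Notation leb := (lebesgue_rV R n).
Implicit Types (f g u v : V -> R) (x y z : V) (A B : set V).

Lemma sqrte_le_sqr (X : \bar R) (S : R) : (0 <= X)%E -> (sqrte X <= S%:E)%E -> (X <= (S ^+ 2)%:E)%E.
Proof.
move=> X0 XS; have S0 : 0 <= S by rewrite -lee_fin; exact: le_trans (sqrte_ge0 X) XS.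
by rewrite -(lee_sqrt _ (_ : 0 <= _)%E) ?lee_fin ?sqr_ge0//= sqrtr_sqr ger0_norm.
Qed.

Lemma integral_sum_sqr (N : finType) A (F : N -> V -> R) : measurable A ->
  (forall p, sq_integrable A (F p)) ->
  (\int[leb]_(x in A) (\sum_p F p x ^+ 2)%:E = (\sum_p sqint A (F p))%:E)%E.
Proof.
move=> mA SF; have iF p : leb.-integrable A (EFin \o (fun x => F p x ^+ 2)) by have [] := SF p.
rewrite -(Rintegral_sum mA iF) /Rintegral fineK//.
exact: integrable_fin_num (integrable_fin_sum mA iF).
Qed.

Lemma L2normE (N : finType) A (F : N -> V -> R) : measurable A ->
  (forall p, sq_integrable A (F p)) -> L2norm A F = (Num.sqrt (\sum_p sqint A (F p)))%:E.
Proof. by move=> mA SF; rewrite /L2norm integral_sum_sqr. Qed.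

Lemma oscillationE (N : finType) A (F : N -> V -> R) : measurable A -> (leb A < +oo)%E ->
  (forall p, sq_integrable A (F p)) -> oscillation A F =
  (Num.sqrt ((fine (leb A))^-1 * \sum_p sqint A (fun x => F p x - mean A (F p))))%:E.
Proof.
move=> mA Aoo SF; rewrite /oscillation /L2avg integral_sum_sqr// => p.
by apply: sq_integrableB => //; exact: sq_integrable_cst.
Qed.

Lemma sq_integrable_lty A f : measurable A -> measurable_fun A f ->
  (\int[leb]_(x in A) (f x ^+ 2)%:E < +oo)%E -> sq_integrable A f.
Proof.
move=> mA mf foo; split => //; apply/integrableP; split.
  by apply/measurable_EFinP; exact: measurable_funX.
by move: foo; congr (_ < _)%E; apply: eq_integral => x _ /=; rewrite ger0_norm ?sqr_ge0.
Qed.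

Lemma L2norm_sq_integrable A f (nu : R) : measurable A -> measurable_fun A f ->
  (L2norm A (scalar_fun f) <= nu%:E)%E -> sq_integrable A f /\ sqint A f <= nu ^+ 2.
Proof.
move=> mA mf; rewrite /L2norm /scalar_fun.
have -> : (\int[leb]_(x in A) (\sum_(i : unit) f x ^+ 2)%:E = \int[leb]_(x in A) (f x ^+ 2)%:E)%E.
  by apply: eq_integral => x _; rewrite big_const card_unit /= addr0.
have I0 : (0 <= \int[leb]_(x in A) (f x ^+ 2)%:E)%E.
  by apply: integral_ge0 => x _; rewrite lee_fin sqr_ge0.
move=> /(sqrte_le_sqr I0) H.
have Sf : sq_integrable A f by apply: sq_integrable_lty => //; apply: le_lt_trans H _; rewrite ltry.
split => //; have [_ i2] := Sf.
by rewrite -lee_fin /sqint /Rintegral fineK//; exact: integrable_fin_num.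
Qed.

Lemma oscillation_sq_integrable A f (S : R) : measurable A -> measurable_fun A f ->
  (0 < leb A)%E -> (leb A < +oo)%E -> (oscillation A (scalar_fun f) <= S%:E)%E ->
  sq_integrable A f /\ sqint A (fun x => f x - mean A f) <= fine (leb A) * S ^+ 2.
Proof.
move=> mA mf A0 Aoo; rewrite /oscillation /L2avg /scalar_fun.
have m0 : 0 < fine (leb A) by apply: fine_gt0; rewrite A0.
have -> : (\int[leb]_(x in A) (\sum_(i : unit) (f x - mean A f) ^+ 2)%:E =
    \int[leb]_(x in A) ((f x - mean A f) ^+ 2)%:E)%E.
  by apply: eq_integral => x _; rewrite big_const card_unit /= addr0.
have I0 : (0 <= \int[leb]_(x in A) ((f x - mean A f) ^+ 2)%:E)%E.
  by apply: integral_ge0 => x _; rewrite lee_fin sqr_ge0.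
move=> /sqrte_le_sqr-/(_ (mule_ge0 _ I0)) H.
have {}H : (\int[leb]_(x in A) ((f x - mean A f) ^+ 2)%:E <= (fine (leb A) * S ^+ 2)%:E)%E.
  rewrite EFinM -lee_pdivrMl// H// lee_fin invr_ge0 ltW//.
have Sg : sq_integrable A (fun x => f x - mean A f).
  apply: sq_integrable_lty => //; first exact: measurable_funB.
  by apply: le_lt_trans H _; rewrite ltry.
have [_ i2] := Sg; split.
  have := sq_integrableD mA Sg (sq_integrable_cst (mean A f) mA Aoo).
  by congr sq_integrable; apply/funext => x; rewrite subrK.
by rewrite -lee_fin /sqint /Rintegral fineK//; exact: integrable_fin_num.
Qed.

Lemma sq_integrableU A B f : measurable A -> measurable B ->
  sq_integrable A f -> sq_integrable B f -> sq_integrable (A `|` B) f.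
Proof.
move=> mA mB [mfA iA] [mfB iB]; have mU := measurableU _ _ mA mB.
have mfU : measurable_fun (A `|` B) f by apply/measurable_funU.
split => //.
have jA : leb.-integrable setT ((EFin \o (fun x => f x ^+ 2)) \_ A) by rewrite -integrable_mkcond.
have jB : leb.-integrable setT ((EFin \o (fun x => f x ^+ 2)) \_ B) by rewrite -integrable_mkcond.
rewrite integrable_mkcond//.
apply: (le_integrable measurableT _ _ (integrableD measurableT jA jB)).
  by apply/(measurable_restrictT _ mU); apply/measurable_EFinP; exact: measurable_funX.
move=> x _; rewrite !patchE in_setU /=; move: (f x ^+ 2) (sqr_ge0 (f x)) => a a0.
by case: (x \in A); case: (x \in B) => /=; rewrite lee_fin ?addr0 ?add0r// !ger0_norm ?addr_ge0// lerDl.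
Qed.

(** The closed ball is covered by finitely many balls of radius [d]. *)
Lemma sq_integrable_cover f (s d : R) : 0 < d ->
  (forall x, enorm x <= s -> sq_integrable (eball x d) f) -> sq_integrable (eball 0 s) f.
Proof.
move=> d0 H; have cK := @compact_ecball R n 0 s.
have op x : [set y : V | enorm (y - 0) <= s] x -> open (eball x d) by move=> _; exact: eball_open.
have cov : [set y : V | enorm (y - 0) <= s] `<=` cover [set y | enorm (y - 0) <= s] (fun x => eball x d).
  by move=> x xs; exists x => //=; rewrite eballE subrr enorm0.
have := cK; rewrite compact_cover => /(_ V _ _ op cov)[D DK KD].
have SD (l : seq V) : (forall x, x \in l -> enorm x <= s) ->
    measurable (\big[setU/set0]_(x <- l) eball x d) /\ sq_integrable (\big[setU/set0]_(x <- l) eball x d) f.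
  elim: l => [_|x l IH hl]; first by rewrite big_nil; split => //; split; [exact: measurable_fun_set0|exact: integrable_set0].
  have [|ml Sl] := IH _; first by move=> y yl; apply: hl; rewrite inE yl orbT.
  rewrite big_cons; have mx := @measurable_eball R n x d; split; first exact: measurableU.
  by apply: sq_integrableU => //; apply: H; apply: hl; rewrite inE eqxx.
have [|mD sD] := SD (finmap.enum_fset D); first by move=> x /DK; rewrite inE /= subr0.
apply: sq_integrableS sD => //; first exact: measurable_eball.
move=> y; rewrite eballE => /ltW ys; have := KD y ys; rewrite /cover -bigcup_seq.
by move=> [x xD yx]; exists x.
Qed.

(** The index [K] is the number of steps of the iteration that lead from the
    radius [rho] to a radius comparable with [y]. *)
Lemma scale_index (th rho y : R) : 0 < th <= 2^-1 -> 0 < rho -> 0 < y <= rho ->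
  exists K, th ^+ K.+1 * rho < y <= th ^+ K * rho.
Proof.
move=> /andP[th0 th1] rho0 /andP[y0 yr].
have ex : exists k, th ^+ k * rho < y.
  exists (Num.trunc (rho / y)).+1; rewrite -ltr_pdivlMr//.
  apply: le_lt_trans (_ : 2^-1 ^+ (Num.trunc (rho / y)).+1 < _); first by apply: lerXn2r => //; rewrite nnegrE; [exact: ltW|rewrite invr_ge0].
  rewrite exprVn -[ltRHS]invrK ltf_pV2 ?posrE ?exprn_gt0 ?invr_gt0 ?divr_gt0// invf_div.
  apply: lt_le_trans (truncnS_gt _) _; rewrite -natrX ler_nat; apply: ltnW; exact: ltn_expl.
case: (ex_minnP ex) => -[|K] hK hmin.
  by exfalso; move: hK; rewrite expr0 mul1r ltNge yr.
exists K; rewrite hK /= leNgt; apply/negP => /hmin; rewrite ltnn//.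
Qed.

Lemma exists_power4 (a : R) : 0 < a -> exists J, 4 ^- J <= a.
Proof.
move=> a0; exists (Num.trunc a^-1).+1; rewrite -[leRHS]invrK lef_pV2 ?posrE ?exprn_gt0 ?invr_gt0//.
apply: le_trans (ltW (truncnS_gt _)) _; rewrite -natrX ler_nat; apply: ltnW; exact: ltn_expl.
Qed.

Lemma sqrt_le_linear (C U S nu : R) : 0 <= C -> 0 <= S -> 0 <= nu -> U <= nu ^+ 2 ->
  Num.sqrt (C * (U + S ^+ 2)) <= (1 + C) * (nu + S).
Proof.
move=> C0 S0 nu0 hU; have H0 : 0 <= (1 + C) * (nu + S) by rewrite mulr_ge0 ?addr_ge0.
rewrite -(ger0_norm H0) -sqrtr_sqr ler_sqrt ?sqr_ge0// exprMn.
have h1 : U + S ^+ 2 <= (nu + S) ^+ 2.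
  by rewrite sqrrD; have := mulr_ge0 nu0 S0; rewrite mulr2n; lra.
apply: le_trans (ler_wpM2l C0 h1) _; apply: ler_wpM2r; first exact: sqr_ge0.
by rewrite sqrrD expr1n mul1r; have := sqr_ge0 C; rewrite mulr2n; lra.
Qed.

Lemma eball_sub1 x (r : R) : enorm x + r <= 1 -> eball x r `&` eball 0 1 = eball x r.
Proof. by move=> xr; apply/setIidPl; apply: sub_eball; rewrite subr0. Qed.

Lemma eballI_lty x A (r : R) : measurable A -> (leb (eball x r `&` A) < +oo)%E.
Proof.
move=> mA; apply: le_lt_trans (lebesgue_eball_lty x r); apply: le_measure; rewrite ?inE//.
- by apply: measurableI => //; exact: measurable_eball.
- exact: measurable_eball.
Qed.

End averages.

(** * Oscillations and BMO *)

Section main_estimates.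
Context (R : realType) (n : nat).
Local Notation V := 'rV[R]_n.
Local Notation leb := (lebesgue_rV R n).
Implicit Types (f g u v : V -> R) (x y z : V) (A B : set V) (D2u : 'I_n * 'I_n -> V -> R).

Let B1 : set V := eball 0 1.

Definition frobenius_osc A D2u : R := \sum_p sqint A (fun x => D2u p x - mean A (D2u p)).

(** The lower bound on the measure of [A] makes normalised integrals on [A]
    comparable with integrals divided by [r ^+ n]. *)
Lemma oscillation_le_sqrt A D2u x (r mu X : R) : measurable A -> A `<=` eball x r ->
  0 < mu -> 0 < r -> ((mu * r ^+ n)%:E <= leb A)%E ->
  (forall p, sq_integrable A (D2u p)) -> frobenius_osc A D2u <= r ^+ n * X -> 0 <= X ->
  (oscillation A D2u <= (Num.sqrt (mu^-1 * X))%:E)%E.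
Proof.
move=> mA Ar mu0 r0 hA SD hX X0; have rn : 0 < r ^+ n by rewrite exprn_gt0.
have Aoo : (leb A < +oo)%E.
  apply: le_lt_trans (lebesgue_eball_lty x r); apply: le_measure; rewrite ?inE//.
  exact: measurable_eball.
rewrite oscillationE// lee_fin ler_wsqrtr//.
have mA0 : mu * r ^+ n <= fine (leb A) by rewrite -lee_fin fineK// ge0_fin_numE.
have m0 : 0 < mu * r ^+ n by rewrite mulr_gt0.
have Y0 : 0 <= frobenius_osc A D2u by apply: sumr_ge0 => p _; exact: sqint_ge0.
apply: (@le_trans _ _ ((mu * r ^+ n)^-1 * (r ^+ n * X))); last first.
  by rewrite invfM -mulrA mulKf// gt_eqF.
apply: ler_pM => //; first by rewrite invr_ge0 fine_ge0.
by rewrite lef_pV2 ?posrE//; exact: lt_le_trans mA0.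
Qed.

Lemma BMO_at_intro A D2u x (r0 S : R) : measurable A ->
  (forall (r : R) p, 0 < r < r0 -> sq_integrable (eball x r `&` A) (D2u p)) ->
  (forall r : R, 0 < r < r0 -> (oscillation (eball x r `&` A) D2u <= S%:E)%E) ->
  BMO_at A r0 x D2u /\ (BMO_seminorm_at A r0 x D2u <= S%:E)%E.
Proof.
move=> mA SD hS.
have le : (BMO_seminorm_at A r0 x D2u <= S%:E)%E.
  by apply: ge_ereal_sup => _ [r /= rr <-]; apply: hS; move: rr; rewrite in_itv.
split => //; split; last by apply: le_lt_trans le _; rewrite ltry.
move=> p r rr; apply: sq_integrable_integrable; [|exact: eballI_lty|exact: SD].
by apply: measurableI => //; exact: measurable_eball.
Qed.

Lemma BMO_at_oscillation f x (r0 r : R) (S : R) : measurable_fun B1 f ->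
  (BMO_seminorm_at B1 r0 x (scalar_fun f) <= S%:E)%E -> 0 < r < r0 -> enorm x + r <= 1 ->
  sq_integrable (eball x r) f /\
  sqint (eball x r) (fun y => f y - mean (eball x r) f) <=
    unit_ball_volume R n * S ^+ 2 * r ^+ n.
Proof.
move=> mf hS rr xr; have /andP[r_gt0 _] := rr; have E := eball_sub1 xr.
have mr := @measurable_eball R n x r; have w0 := unit_ball_volume_gt0 R n.
have vr := lebesgue_eball x r_gt0.
have osc : (oscillation (eball x r) (scalar_fun f) <= S%:E)%E.
  apply: le_trans hS; apply: ereal_sup_ubound; exists r; first by rewrite /= in_itv.
  by rewrite E.
have [|||Sf hf] := oscillation_sq_integrable mr _ _ _ osc.
- by apply: measurable_funS mf; [exact: measurable_eball|rewrite -E => y []].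
- by rewrite vr lte_fin mulr_gt0// exprn_gt0.
- exact: lebesgue_eball_lty.
split => //; apply: le_trans hf _; rewrite vr /=.
by rewrite le_eqVlt; apply/orP; left; apply/eqP; ring.
Qed.

(** Finite oscillation on a ball gives square integrability there; finitely
    many balls of a common radius, inside the unit ball, cover [eball 0 s]. *)
Lemma BMO_sq_integrable f (rf : R) : 0 < rf -> measurable_fun B1 f ->
  BMO B1 rf (scalar_fun f) -> forall s : R, s < 1 -> sq_integrable (eball 0 s) f.
Proof.
move=> rf0 mf [_ Hoo] s s1.
have s10 : 0 < 1 - s by rewrite subr_gt0.
pose d := Num.min rf (1 - s) / 2.
have m0 : 0 < Num.min rf (1 - s) by rewrite lt_min rf0.
have d0 : 0 < d by rewrite divr_gt0.
have : d < Num.min rf (1 - s) by rewrite /d ltr_pdivrMr// ltr_pMr// ltr1n.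
rewrite lt_min => /andP[drf ds].
apply: (sq_integrable_cover d0) => x xs.
pose S := fine (BMO_seminorm B1 rf (scalar_fun f)).
have x1 : B1 x by rewrite /B1 eballE subr0; exact: le_lt_trans s1.
have H : (BMO_seminorm_at B1 rf x (scalar_fun f) <= BMO_seminorm B1 rf (scalar_fun f))%E.
  by apply: ereal_sup_ubound; exists x.
have H0 : (0 <= BMO_seminorm_at B1 rf x (scalar_fun f))%E.
  apply: le_trans (sqrte_ge0 _) _; last apply: ereal_sup_ubound; last first.
    by exists d => //=; rewrite in_itv/= d0.
have HS : (BMO_seminorm_at B1 rf x (scalar_fun f) <= S%:E)%E.
  by rewrite /S fineK// ge0_fin_numE//; exact: le_trans H.
have dd : 0 < d < rf by rewrite d0.
have xd : enorm x + d <= 1 by rewrite -lerBrDr (le_trans xs)// lerBrDr addrC -lerBrDr ltW.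
by have [] := BMO_at_oscillation mf HS dd xd.
Qed.

End main_estimates.

(** * The two estimates *)

Section main_theorem.
Context (R : realType) (n : nat).
Local Notation V := 'rV[R]_n.
Local Notation leb := (lebesgue_rV R n).
Implicit Types (f g u v : V -> R) (x y z : V) (A B : set V) (D2u : 'I_n * 'I_n -> V -> R).

Let B1 : set V := eball 0 1.
Let mB1 : measurable B1. Proof. exact: measurable_eball. Qed.

(** The norms on the right may be infinite; the bound on [T] only matters when
    they are finite. *)
Lemma le_bound_ereal (a b : \bar R) (T Cf S : R) : (0 <= a)%E -> (0 <= b)%E -> 0 < Cf -> 0 <= S ->
  (forall nu, a = nu%:E -> T <= Cf * (nu + S)) ->
  (T%:E <= Cf%:E * (a + b + S%:E))%E.
Proof.
move=> a0 b0 C0 S0 H; case: a a0 H => [nu| |] //= nu0 H.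
  apply: (@le_trans _ _ (Cf%:E * (nu%:E + S%:E))%E).
    by rewrite -EFinD -EFinM lee_fin; exact: H.
  apply: lee_wpmul2l; first by rewrite lee_fin ltW.
  by rewrite leeD2r// leeDl.
by rewrite addye ?gt_eqF ?(lt_le_trans _ b0)// addye// gt0_muley ?lte_fin// leey.
Qed.

Lemma le_bound_ereal2 (a b : \bar R) (T Cf S : R) : (0 <= a)%E -> (0 <= b)%E -> 0 < Cf -> 0 <= S ->
  (forall nu nf, a = nu%:E -> b = nf%:E -> T <= Cf * (nu + (nf + S))) ->
  (T%:E <= Cf%:E * (a + (b + S%:E)))%E.
Proof.
move=> a0 b0 C0 S0 H; case: a a0 H => [nu| |] //= nu0 H; last first.
  by rewrite addye ?gt_eqF ?(lt_le_trans _ (adde_ge0 b0 _))// ?lee_fin// gt0_muley ?lte_fin// leey.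
case: b b0 H => [nf| |] //= nf0 H; last by rewrite addye// addey// gt0_muley ?lte_fin// leey.
by rewrite -!EFinD -EFinM lee_fin; exact: H.
Qed.

Lemma L2norm_ge0 (N : finType) A (F : N -> V -> R) : (0 <= L2norm A F)%E.
Proof. exact: sqrte_ge0. Qed.

Lemma BMO_seminorm_at_ge0 (N : finType) A (r0 : R) x (F : N -> V -> R) : 0 < r0 ->
  (0 <= BMO_seminorm_at A r0 x F)%E.
Proof.
move=> r00; apply: (@le_trans _ _ (oscillation (eball x (r0 / 2) `&` A) F)); first exact: sqrte_ge0.
apply: ereal_sup_ubound; exists (r0 / 2) => //=; rewrite in_itv/= divr_gt0//=.
by rewrite ltr_pdivrMr// ltr_pMr// ltr1n.
Qed.

(** The iteration starts at the radius [eta]. For [r < eta ^+ 2] the ball of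
    radius [r / eta] lies in that of radius [eta], so [weak_hessian_decay]
    applies with ratio [eta^-1]. As the starting radius is fixed, the factor
    [eta ^- (n + 4)] of the initial term goes into the constant. *)
Lemma W2BMO_at_origin (eta : R) : 0 < eta < 1 -> exists2 C : R, 0 < C &
  forall u f, weak_solution B1 u f -> BMO_at B1 1 0 (scalar_fun f) ->
  exists Du D2u, W2BMO_at B1 (eta ^+ 2) 0 u Du D2u /\
    (BMO_seminorm_at B1 (eta ^+ 2) 0 D2u <=
     C%:E * (L2norm B1 (scalar_fun u) + L2norm B1 (scalar_fun f)
             + BMO_seminorm_at B1 1 0 (scalar_fun f)))%E.
Proof.
move=> /andP[eta0 eta1]; have w0 := unit_ball_volume_gt0 R n; set w := unit_ball_volume R n in w0.
have [th th12 hth] := @hessian_decay R n.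
have s1 : 1 < eta^-1 by rewrite invf_gt1.
have [C C0 hC] := hth _ s1.
pose p := eta ^- (n + 4); have p0 : 0 <= p by rewrite invr_ge0 exprn_ge0// ltW.
pose C' := w^-1 * (4 * C * (p + w)).
have C'0 : 0 <= C' by rewrite !mulr_ge0 ?invr_ge0 ?addr_ge0 ?(ltW w0).
exists (1 + C') => [|u f [Lf [Du WD wf]] [_ Hoo]]; first by rewrite ltr_pwDl.
have [mf _] := Lf; have [Lu _] := WD; have [mu _] := Lu.
pose S := fine (BMO_seminorm_at B1 1 0 (scalar_fun f)).
have H0 := @BMO_seminorm_at_ge0 _ B1 1 0 (scalar_fun f) ltr01.
have SE : BMO_seminorm_at B1 1 0 (scalar_fun f) = S%:E by rewrite /S fineK// ge0_fin_numE.
have S0 : 0 <= S by rewrite -lee_fin -SE.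
have hf r : 0 < r < 1 -> sq_integrable (eball 0 r) f /\
    sqint (eball 0 r) (fun y => f y - mean (eball 0 r) f) <= w * S ^+ 2 * r ^+ n.
  move=> rr; apply: (BMO_at_oscillation mf _ rr); first by rewrite SE.
  by rewrite enorm0 add0r; case/andP: rr => _ /ltW.
have Sf s : s < 1 -> sq_integrable (eball 0 s) f.
  move=> s_lt1; pose r := Num.max s 2^-1.
  have rr : 0 < r < 1 by rewrite lt_max gt_max s_lt1 invr_gt0 ltr0Sn orbT /= invf_lt1// ltr1n.
  have [Sr _] := hf r rr; apply: sq_integrableS Sr; [exact: measurable_eball..|].
  by apply: subset_eball; rewrite le_max lexx.
have [D2u [wD2 SD2 approx]] := weak_second_derivatives WD wf Sf.
exists Du, D2u.
have Su := Lloc2_sq_integrable eta1 Lu.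
pose U := sqint (eball 0 eta) u; have U0 : 0 <= U by exact: sqint_ge0.
pose X := 4 * C * (p * U + w * S ^+ 2).
have F0 : 0 <= w * S ^+ 2 by rewrite mulr_ge0 ?sqr_ge0// ltW.
have X0 : 0 <= X by rewrite mulr_ge0 ?mulr_ge0// addr_ge0// mulr_ge0.
have osc r : 0 < r < eta ^+ 2 -> (oscillation (eball 0 r `&` B1) D2u <= (Num.sqrt (w^-1 * X))%:E)%E.
  move=> /andP[r0 r2]; have r_eta : r < eta by apply: lt_trans r2 _; rewrite expr2 gtr_pMr.
  have re : 0 < r * eta^-1 <= eta.
    by rewrite divr_gt0//= ler_pdivrMr// -expr2 ltW.
  have [K hK] := scale_index th12 eta0 re.
  rewrite eball_sub1; last by rewrite enorm0 add0r ltW// (lt_trans r_eta).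
  have mr := @measurable_eball R n 0 r; have vr := lebesgue_eball (0 : V) r0.
  apply: (oscillation_le_sqrt (x := 0) (r := r)) => //.
  - by rewrite vr mulrC.
  - by move=> q; apply: SD2; exact: lt_trans eta1.
  have A0 : (0 < leb (eball 0 r))%E by rewrite vr lte_fin mulr_gt0// exprn_gt0.
  have th1 k : th ^+ k * eta <= eta.
    by case/andP: th12 => t0 t1; rewrite ler_piMl ?(ltW eta0)// exprn_ile1 ?(ltW t0)//; lra.
  have := @weak_hessian_decay R n u f Du D2u eta Su (Sf _ eta1) (fun q => SD2 q _ eta1)
    (fun e => approx eta e eta1) th eta^-1 C th12 s1 C0 hC 0 eta r (w * S ^+ 2)
    (fun k => mean (eball 0 (th ^+ k * eta)) f) K (eball 0 r) eta0 r0 F0 (@subset_refl _ _) hK.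
  move=> H; apply: le_trans (H _ mr A0 (@subset_refl _ _)) _.
    move=> k kK; have [|_] := hf (th ^+ k * eta) _; last by [].
    by case/andP: th12 => t0 t1; rewrite mulr_gt0 ?exprn_gt0//= (le_lt_trans (th1 k)).
  rewrite -/U -/p /X mulrCA; apply: ler_wpM2l; first by rewrite exprn_ge0// ltW.
  apply: ler_wpM2l; first by rewrite mulr_ge0.
  rewrite lerD2r ler_piMl ?mulr_ge0//.
  by rewrite invf_le1 ?exprn_gt0// exprn_ege1// ler1n.
have [B le] : BMO_at B1 (eta ^+ 2) 0 D2u /\
    (BMO_seminorm_at B1 (eta ^+ 2) 0 D2u <= (Num.sqrt (w^-1 * X))%:E)%E.
  apply: BMO_at_intro => // r q /andP[r0 r2].
  have r_eta : r < eta by apply: lt_trans r2 _; rewrite expr2 gtr_pMr.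
  rewrite eball_sub1; last by rewrite enorm0 add0r ltW// (lt_trans r_eta).
  by apply: SD2; exact: lt_trans eta1.
split; first by split.
apply: le_trans le _; rewrite SE; apply: le_bound_ereal => //; try exact: L2norm_ge0.
  by rewrite ltr_pwDl.
move=> nu uE; have nu0 : 0 <= nu by rewrite -lee_fin -uE L2norm_ge0.
have [SuB1 hU] : sq_integrable B1 u /\ sqint B1 u <= nu ^+ 2.
  by apply: L2norm_sq_integrable => //; rewrite uE.
have UB : U <= nu ^+ 2.
  apply: le_trans hU; apply: sqintS => //; first exact: measurable_eball.
  by apply: subset_eball; exact: ltW.
apply: le_trans (sqrt_le_linear C'0 S0 nu0 UB); apply: ler_wsqrtr.
rewrite /X /C' -[leRHS]mulrA; apply: ler_wpM2l; first by rewrite invr_ge0 ltW.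
rewrite -[leRHS]mulrA; apply: ler_wpM2l; first by rewrite mulr_ge0.
have := mulr_ge0 p0 (sqr_ge0 S); have := mulr_ge0 (ltW w0) U0.
by move: (S ^+ 2) => S2; lra.
Qed.

Lemma weak_pderiv_restrict (r : R) i u v : r <= 1 ->
  weak_pderiv B1 i u v -> weak_pderiv (eball 0 r) i u v.
Proof.
move=> r1 [Lu Lv H]; have rB : eball 0 r `<=` B1 by exact: subset_eball.
have mr := @measurable_eball R n 0 r.
have L (h : V -> R) : Lloc B1 1 h -> Lloc (eball 0 r) 1 h.
  move=> [mh Ih]; split; first exact: measurable_funS mh.
  by move=> K cK Kr; apply: Ih => //; exact: subset_trans rB.
split; [exact: L|exact: L|].
move=> phi [sp [K [cK Kr K0]]].
have tp : test_function B1 phi by split => //; exists K; split => //; exact: subset_trans rB.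
have [r0|r0] := leP r 0.
  have E : eball (0 : V) r = set0.
    apply/seteqP; split => // x; rewrite eballE => xr.
    by have := lt_le_trans xr r0; rewrite ltNge enorm_ge0.
  by rewrite E !Rintegral_set0 oppr0.
have [s /andP[_ sr] Ks] := compact_sub_eball r0 cK Kr.
have Sp : supported 0 s phi by move=> y ys; apply: K0 => /Ks; rewrite leNgt ys.
have Sdp := supported_pderiv i sp Sp.
have out (h : V -> R) x : supported 0 s h -> ~ eball 0 r x -> h x = 0.
  move=> Sh nx; apply: Sh; apply: lt_le_trans sr _; rewrite leNgt; apply/negP => xr.
  by apply: nx; rewrite eballE.
have := H phi tp.
rewrite (Rintegral_vanish rB); last by move=> x _ nx; rewrite (out _ _ Sdp nx) mulr0.
by rewrite [in RHS](Rintegral_vanish rB)// => x _ nx; rewrite (out _ _ Sp nx) mulr0.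
Qed.

(** A ball satisfies an interior cone condition: moving [x] towards the
    origin leaves room for a ball of half the radius. *)
Lemma eballI_half_volume x (r : R) : enorm x < 2^-1 -> 0 < r <= 1 ->
  ((unit_ball_volume R n / 2 ^+ n * r ^+ n)%:E <= leb (eball x r `&` eball 0 2^-1))%E.
Proof.
move=> xh /andP[r0 r1].
have r20 : 0 < r / 2 by rewrite divr_gt0.
have -> : unit_ball_volume R n / 2 ^+ n * r ^+ n = (r / 2) ^+ n * unit_ball_volume R n.
  by rewrite expr_div_n; field; rewrite expf_neq0.
(* The ball of radius [r / 2] about [(1 - r) *: x] lies in both balls. *)
rewrite -(lebesgue_eball ((1 - r) *: x) r20); apply: le_measure; rewrite ?inE.
- exact: measurable_eball.
- by apply: measurableI; exact: measurable_eball.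
have rx := ler_wpM2l (ltW r0) (ltW xh).
have rx' : enorm ((1 - r) *: x) <= (1 - r) * 2^-1.
  by rewrite enormZ ger0_norm ?subr_ge0// ler_wpM2l ?subr_ge0// ltW.
rewrite subsetI; split; apply: sub_eball.
  by rewrite scalerBl scale1r addrAC subrr add0r enormN enormZ gtr0_norm//; lra.
by rewrite subr0; lra.
Qed.

Lemma L2norm_mono A u (nu : R) : A `<=` B1 -> measurable A -> measurable_fun B1 u ->
  L2norm B1 (scalar_fun u) = nu%:E -> sq_integrable A u /\ sqint A u <= nu ^+ 2.
Proof.
move=> AB mA mu uE.
have [S1 h] : sq_integrable B1 u /\ sqint B1 u <= nu ^+ 2.
  by apply: L2norm_sq_integrable => //; rewrite uE.
split; first exact: sq_integrableS S1.
by apply: le_trans h; exact: sqintS.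
Qed.

(** Here the iteration has to start at a radius [rho < rf], and the initial term
    carries a factor [rho ^- (n + 4)] on which the constant must not depend.
    The factor [4 ^- K] produced by [K] steps compensates for it as soon as
    [4 ^- K <= rho ^+ (n + 4)]; the radius [ru] is chosen so small that every
    [r < ru] is reached only after that many steps. The norms of [u], [Du] and
    [D2u] are bounded by the interior estimates between the balls of radii
    [1 / 2] and [3 / 4]. *)
Lemma W2BMO_interior : exists2 C : R, 0 < C &
  forall rf : R, 0 < rf -> exists2 ru : R, 0 < ru &
  forall u f, weak_solution B1 u f -> BMO B1 rf (scalar_fun f) ->
  exists Du D2u, W2BMO (eball 0 2^-1) ru u Du D2u /\
    (W2BMO_norm (eball 0 2^-1) ru u Du D2u <=
     C%:E * (L2norm B1 (scalar_fun u) + BMO_norm B1 rf (scalar_fun f)))%E.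
Proof.
have w0 := unit_ball_volume_gt0 R n; set w := unit_ball_volume R n in w0.
have [th th12 hth] := @hessian_decay R n.
have s1 : 1 < 2 :> R by rewrite ltr1n.
have [C C0 hC] := hth _ s1.
have s32 : 1 < 3 / 2 :> R by lra.
have [Ch Ch0 hCh] := hessian_bound n s32; have [Cg Cg0 hCg] := gradient_bound n s32.
have half0 : 0 < 2^-1 :> R by rewrite invr_gt0.
have E34 : 2^-1 * (3 / 2) = 3 / 4 :> R by field.
have r341 : 3 / 4 < 1 :> R by lra.
have r342 : 2^-1 <= 3 / 4 :> R by lra.
have hH v : smooth v -> \int[leb]_(y in eball 0 2^-1) hess_sq v y <=
    16 * Ch * (sqint (eball 0 (3 / 4)) v + sqint (eball 0 (3 / 4)) (laplacian v)).
  move=> sv; have := hCh v 0 0 2^-1 sv half0; rewrite E34.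
  have -> : (fun y => laplacian v y - 0) = laplacian v by apply/funext => y; rewrite subr0.
  move=> h; apply: le_trans h _.
  have -> : 2^-1 ^- 4 = 16 :> R by rewrite exprVn invrK; ring.
  rewrite [16 * Ch]mulrC -mulrA; apply: ler_wpM2l => //; rewrite mulrDr lerD2l.
  by rewrite ler_peMl ?sqint_ge0// ler1n.
have hG v : smooth v -> \int[leb]_(y in eball 0 2^-1) grad_sq v y <=
    4 * Cg * (sqint (eball 0 (3 / 4)) v + sqint (eball 0 (3 / 4)) (laplacian v)).
  move=> sv; have := hCg v 0 2^-1 sv half0; rewrite E34.
  move=> h; apply: le_trans h _.
  have -> : 2^-1 ^- 2 = 4 :> R by rewrite exprVn invrK; ring.
  have E (a : R) : 4 * Cg * a = Cg * (4 * a) by ring.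
  rewrite E; apply: ler_wpM2l => //; rewrite mulrDr lerD2l.
  by apply: ler_wpM2r; [exact: sqint_ge0|rewrite expr2; lra].
pose mu := w / 2 ^+ n; have mu0 : 0 < mu by rewrite divr_gt0// exprn_gt0.
pose C' := mu^-1 * (4 * C * (1 + w)).
have C'0 : 0 <= C' by rewrite !mulr_ge0 ?invr_ge0 ?addr_ge0 ?(ltW w0) ?(ltW mu0).
pose C1 := 4 * (4 * Cg); pose C2 := 4 * (16 * Ch).
have C10 : 0 <= C1 by rewrite !mulr_ge0.
have C20 : 0 <= C2 by rewrite !mulr_ge0.
pose Cf := 1 + (1 + C1) + (1 + C2) + (1 + C').
have Cf0 : 0 < Cf by rewrite /Cf; lra.
exists Cf => // rf rf0.
pose rho := Num.min rf 4^-1 / 2.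
have m0 : 0 < Num.min rf 4^-1 by rewrite lt_min rf0 invr_gt0 ltr0n.
have rho0 : 0 < rho by rewrite divr_gt0.
have : rho < Num.min rf 4^-1 by rewrite /rho ltr_pdivrMr// ltr_pMr// ltr1n.
rewrite lt_min => /andP[rho_rf rho4].
have /andP[th0 th1] := th12.
have [J hJ] : exists J, 4 ^- J <= rho ^+ (n + 4) by apply: exists_power4; exact: exprn_gt0.
have thk k : th ^+ k * rho <= rho by rewrite ler_piMl ?(ltW rho0)// exprn_ile1 ?(ltW th0)//; lra.
pose ru := th ^+ J.+1 * rho / 2.
have ru0 : 0 < ru by rewrite divr_gt0// mulr_gt0// exprn_gt0.
have ru_rho : ru <= rho.
  have := thk J.+1; rewrite /ru; move: (_ * rho) => a h; lra.
exists ru => // u f [Lf [Du WD wf]] Bf.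
have [mf _] := Lf; have [Lu _] := WD; have [mu_ _] := Lu.
have Sf := BMO_sq_integrable rf0 mf Bf.
have [Bx Hoo] := Bf.
pose S := fine (BMO_seminorm B1 rf (scalar_fun f)).
have x00 : B1 0 by rewrite /B1 eballE subrr enorm0.
have Hx x : B1 x -> (BMO_seminorm_at B1 rf x (scalar_fun f) <= BMO_seminorm B1 rf (scalar_fun f))%E.
  by move=> x1; apply: ereal_sup_ubound; exists x.
have H0 : (0 <= BMO_seminorm B1 rf (scalar_fun f))%E.
  by apply: le_trans (Hx 0 x00); exact: BMO_seminorm_at_ge0.
have SE : BMO_seminorm B1 rf (scalar_fun f) = S%:E by rewrite /S fineK// ge0_fin_numE.
have S0 : 0 <= S by rewrite -lee_fin -SE.
have [D2u [wD2 SD2 approx]] := weak_second_derivatives WD wf Sf.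
exists Du, D2u.
have Su := Lloc2_sq_integrable r341 Lu.
have SDu i := Lloc2_sq_integrable r341 (WD.2 i).1.
pose U := sqint (eball 0 (3 / 4)) u; have U0 : 0 <= U by exact: sqint_ge0.
pose Ff := sqint (eball 0 (3 / 4)) f.
pose X := 4 * C * (U + w * S ^+ 2).
have F0 : 0 <= w * S ^+ 2 by rewrite mulr_ge0 ?sqr_ge0// ltW.
have X0 : 0 <= X by rewrite mulr_ge0 ?mulr_ge0// addr_ge0.
have mh := @measurable_eball R n 0 2^-1; have m34 := @measurable_eball R n 0 (3 / 4).
have hS34 : eball (0 : V) 2^-1 `<=` eball 0 (3 / 4) by exact: subset_eball.
have SD2h q : sq_integrable (eball 0 2^-1) (D2u q) := sq_integrableS mh m34 hS34 (SD2 q _ r341).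
have mI x (r : R) : measurable (eball x r `&` eball 0 2^-1).
  by apply: measurableI => //; exact: measurable_eball.
have SDI x (r : R) q : sq_integrable (eball x r `&` eball 0 2^-1) (D2u q).
  by apply: sq_integrableS (SD2h q) => // y [].
have osc x r : eball 0 2^-1 x -> 0 < r < ru ->
    (oscillation (eball x r `&` eball 0 2^-1) D2u <= (Num.sqrt (mu^-1 * X))%:E)%E.
  rewrite eballE subr0 => xh /andP[r0 r_ru].
  have r2 : 0 < r * 2 <= rho.
    rewrite mulr_gt0//=; have := thk J.+1; move: r_ru; rewrite /ru ltr_pdivlMr//.
    by move=> a b; rewrite (le_trans (ltW a)).
  have r1 : 0 < r <= 1 by rewrite r0; move: (ltW r_ru) ru_rho rho4 => a b c; lra.
  have [K hK] := scale_index th12 rho0 r2.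
  (* Fewer than [J] steps would not get from [rho] below [ru]. *)
  have JK : (J <= K)%N.
    rewrite leqNgt; apply/negP => KJ; have /andP[hK1 _] := hK.
    have : th ^+ J.+1 * rho <= th ^+ K.+1 * rho.
      rewrite ler_wpM2r ?(ltW rho0)//; apply: ler_wiXn2l; [exact: ltW|lra|exact: ltnW].
    move: r_ru; rewrite /ru ltr_pdivlMr// => a b.
    by have := lt_le_trans (lt_trans hK1 a) b; rewrite ltxx.
  have vol := eballI_half_volume xh r1; rewrite -/w -/mu in vol.
  apply: (oscillation_le_sqrt (x := x) (r := r)) => //.
  have A0 : (0 < leb (eball x r `&` eball 0 2^-1))%E.
    by apply: lt_le_trans vol; rewrite lte_fin mulr_gt0// exprn_gt0.
  have xrho : eball x rho `<=` eball 0 (3 / 4).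
    by apply: sub_eball; rewrite subr0; lra.
  have := @weak_hessian_decay R n u f Du D2u (3 / 4) Su (Sf _ r341) (fun q => SD2 q _ r341)
    (fun e => approx (3 / 4) e r341) th 2 C th12 s1 C0 hC x rho r (w * S ^+ 2)
    (fun k => mean (eball x (th ^+ k * rho)) f) K (eball x r `&` eball 0 2^-1) rho0 r0 F0 xrho hK.
  move=> H; apply: le_trans (H _ (mI _ _) A0 _) _.
  - move=> k kK; have tk0 : 0 < th ^+ k * rho by rewrite mulr_gt0// exprn_gt0.
    have tk1 : 0 < th ^+ k * rho < rf by rewrite tk0; exact: le_lt_trans (thk k) rho_rf.
    have xB : B1 x by rewrite /B1 eballE subr0; lra.
    have hSx : (BMO_seminorm_at B1 rf x (scalar_fun f) <= S%:E)%E by rewrite -SE; exact: Hx.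
    have xtk : enorm x + th ^+ k * rho <= 1.
      by have := thk k; move: (_ * rho) => a h; lra.
    by have [] := BMO_at_oscillation mf hSx tk1 xtk.
  - by move=> y [].
  rewrite /X mulrCA; apply: ler_wpM2l; first by rewrite exprn_ge0// ltW.
  apply: ler_wpM2l; first by rewrite mulr_ge0.
  rewrite lerD2r mulrA; apply: (@le_trans _ _ (1 * U)); last by rewrite mul1r.
  apply: ler_pM; [|exact: sqint_ge0| |].
  - by rewrite mulr_ge0 ?invr_ge0 ?exprn_ge0// ltW.
  - rewrite ler_pdivrMr ?exprn_gt0// mul1r; apply: le_trans hJ.
    by rewrite lef_pV2 ?posrE ?exprn_gt0// ler_weXn2l// ler1n.
  apply: sqintS => //; exact: measurable_eball.
have bmo x : eball 0 2^-1 x -> BMO_at (eball 0 2^-1) ru x D2u /\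
    (BMO_seminorm_at (eball 0 2^-1) ru x D2u <= (Num.sqrt (mu^-1 * X))%:E)%E.
  by move=> xh; apply: BMO_at_intro => // r rr; exact: osc.
have sem : (BMO_seminorm (eball 0 2^-1) ru D2u <= (Num.sqrt (mu^-1 * X))%:E)%E.
  by apply: ge_ereal_sup => _ [x xh <-]; have [] := bmo x xh.
split.
  split.
    have [w1 w2] := wD2; have h1 : 2^-1 <= 1 :> R by lra.
    by split => [i|i j]; apply: weak_pderiv_restrict.
  split; first by move=> x xh; have [] := bmo x xh.
  by apply: le_lt_trans sem _; rewrite ltry.
have Suh := sq_integrableS mh m34 hS34 Su.
have SDuh i := sq_integrableS mh m34 hS34 (SDu i).
rewrite /W2BMO_norm /BMO_norm SE.
rewrite (L2normE mh (F := scalar_fun u) (fun _ => Suh)) (L2normE mh SDuh) (L2normE mh SD2h).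
set a := Num.sqrt _; set b := Num.sqrt _; set c := Num.sqrt _.
apply: (@le_trans _ _ (a + b + (c + Num.sqrt (mu^-1 * X)))%:E).
  by rewrite !EFinD leeD2l// leeD2l.
apply: le_bound_ereal2 => //; try exact: L2norm_ge0.
move=> nu nf uE fE.
have nu0 : 0 <= nu by rewrite -lee_fin -uE L2norm_ge0.
have nf0 : 0 <= nf by rewrite -lee_fin -fE L2norm_ge0.
have sub34 : eball (0 : V) (3 / 4) `<=` B1 by apply: subset_eball; exact: ltW.
have [_ hU] := L2norm_mono sub34 m34 mu_ uE; have [_ hF] := L2norm_mono sub34 m34 mf fE.
have UF : U + Ff <= U + nf ^+ 2 by rewrite lerD2l.
have ha : a <= nu.
  rewrite /a -(ger0_norm nu0) -sqrtr_sqr; apply: ler_wsqrtr.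
  rewrite (eq_bigr (fun=> sqint (eball 0 2^-1) u))// big_const card_unit /= addr0.
  apply: le_trans hU.
  exact: sqintS mh m34 hS34 Su.
have hb : b <= (1 + C1) * (nu + nf).
  apply: le_trans (sqrt_le_linear C10 nf0 nu0 hU); apply: ler_wsqrtr.
  have Cg4 : 0 <= 4 * Cg by rewrite mulr_ge0.
  apply: le_trans (ler_wpM2l C10 UF).
  exact: (weak_gradient_bound Su (Sf _ r341) SDu (fun e => approx (3 / 4) e r341) half0 r342 (lexx _) Cg4 hG).
have hc : c <= (1 + C2) * (nu + nf).
  apply: le_trans (sqrt_le_linear C20 nf0 nu0 hU); apply: ler_wsqrtr.
  have Ch16 : 0 <= 16 * Ch by rewrite mulr_ge0.
  apply: le_trans (ler_wpM2l C20 UF).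
  exact: (weak_hessian_bound Su (Sf _ r341) (fun q => SD2 q _ r341) (fun e => approx (3 / 4) e r341) half0 r342 (lexx _) Ch16 hH).
have hT : Num.sqrt (mu^-1 * X) <= (1 + C') * (nu + S).
  apply: le_trans (sqrt_le_linear C'0 S0 nu0 hU); apply: ler_wsqrtr.
  rewrite /X /C' -[leRHS]mulrA; apply: ler_wpM2l; first by rewrite invr_ge0 ltW.
  rewrite -[leRHS]mulrA; apply: ler_wpM2l; first by rewrite mulr_ge0.
  have := mulr_ge0 (ltW w0) U0; have := sqr_ge0 S; rewrite -/U.
  by move: (S ^+ 2) => S2 h1 h2; lra.
move: ha hb hc hT; rewrite /Cf; move: a b c (Num.sqrt _) => a b c t.
have := mulr_ge0 C10 S0; have := mulr_ge0 C20 S0; have := mulr_ge0 C'0 nf0.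
by move=> *; nra.
Qed.

End main_theorem.

Theorem theorem2p3 (R : realType) (n : nat) (delta eta Cbar : R)
    (n_gt0 : (0 < n)%N)
    (triple : approximation_triple n delta eta Cbar) :
  (exists2 C : R, 0 < C &
    forall u f : 'rV[R]_n -> R,
      weak_solution (eball 0 1) u f ->
      BMO_at (eball 0 1) 1 0 (scalar_fun f) ->
      exists Du D2u,
        W2BMO_at (eball 0 1) (eta ^+ 2) 0 u Du D2u /\
        (BMO_seminorm_at (eball 0 1) (eta ^+ 2) 0 D2u <=
         C%:E * (L2norm (eball 0 1) (scalar_fun u) + L2norm (eball 0 1) (scalar_fun f)
                 + BMO_seminorm_at (eball 0 1) 1 0 (scalar_fun f)))%E)
  /\
  (exists2 C : R, 0 < C &
    forall rf : R, 0 < rf -> exists2 ru : R, 0 < ru &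
    forall u f : 'rV[R]_n -> R,
      weak_solution (eball 0 1) u f ->
      BMO (eball 0 1) rf (scalar_fun f) ->
      exists Du D2u,
        W2BMO (eball 0 2^-1) ru u Du D2u /\
        (W2BMO_norm (eball 0 2^-1) ru u Du D2u <=
         C%:E * (L2norm (eball 0 1) (scalar_fun u)
                 + BMO_norm (eball 0 1) rf (scalar_fun f)))%E).
Proof.
have [_ eta01 _] := triple.
by split; [exact: W2BMO_at_origin|exact: W2BMO_interior].
Qed.
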